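(* Let $K\subset\mathbb C$ be a closed Lipschitz-thin set with $\mathcal H^2(K)=0$. Suppose $f\colon\mathbb C\setminus K\to\mathbb C$ is holomorphic and there exists $\alpha<\pi/2$ such that $|\arg f'(z)|\le\alpha$ for all $z\in\mathbb C\setminus K$ (in particular, $f'\ne0$ on $\mathbb C\setminus K$). Then $f$ extends to an entire function, which is in fact linear (i.e., of the form $z\mapsto cz+d$ with $c,d\in\mathbb C$).
   Context: $\mathbb C$ is identified with $\mathbb R^2$, and $\mathcal H^2$ is two-dimensional Hausdorff measure. For $\epsilon>0$, a curve (continuous map) $\gamma\colon[\alpha_0,\beta_0]\to\mathbb R^n$ is an $\epsilon$-Lipschitz graph if for every $\alpha_0\le t<s\le\beta_0$ the angle between the vectors $\gamma(s)-\gamma(t)$ and $\gamma(\beta_0)-\gamma(\alpha_0)$ is less than $\epsilon$ (in particular these vectors are nonzero, so that the angle is defined). A set $E\subset\mathbb R^n$ is Lipschitz-thin if for any $\epsilon>0$, any two distinct points $a,b\in\mathbb R^n$ can be connected by an $\epsilon$-Lipschitz graph that is disjoint from $E\setminus\{a,b\}$. $\arg$ denotes the principal argument, with values in $(-\pi,\pi]$. *)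

(* Defs.v *)
From HB Require Import structures.
From mathcomp Require Import all_boot all_order all_algebra.
From mathcomp Require Import all_classical all_reals all_analysis.
From mathcomp Require Import complex.
From mathcomp Require Import ring lra.
Set Implicit Arguments.
Unset Strict Implicit.
Unset Printing Implicit Defensive.
Import Order.TTheory GRing.Theory Num.Theory.
Import numFieldNormedType.Exports.
Local Open Scope classical_set_scope.
Local Open Scope ring_scope.

(* The norm [`|x|] of ['rV[R]_n] is the sup norm. It induces the same
   topology as the Euclidean one, but angles and diameters below are
   Euclidean. *)
Definition dotv (R : realType) (n : nat) (u v : 'rV[R]_n) : R :=
  \sum_(i < n) u 0 i * v 0 i.

Definition normv (R : realType) (n : nat) (u : 'rV[R]_n) : R :=
  Num.sqrt (dotv u u).

(* Meaningful only for nonzero [u] and [v]. *)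
Definition angle (R : realType) (n : nat) (u v : 'rV[R]_n) : R :=
  acos (dotv u v / (normv u * normv v)).

(* The pair [t = a0], [s = b0] is included, so for [a0 < b0] the total
   displacement is required to be nonzero too. *)
Definition Lipschitz_graph (R : realType) (n : nat) (eps a0 b0 : R)
    (gamma : R -> 'rV[R]_n) : Prop :=
  {within `[a0, b0], continuous gamma} /\
  forall t s : R, a0 <= t -> t < s -> s <= b0 ->
    [/\ gamma s - gamma t != 0, gamma b0 - gamma a0 != 0
      & angle (gamma s - gamma t) (gamma b0 - gamma a0) < eps].

Definition Lipschitz_thin (R : realType) (n : nat) (E : set 'rV[R]_n) : Prop :=
  forall eps : R, 0 < eps -> forall a b : 'rV[R]_n, a != b ->
    exists (a0 b0 : R) (gamma : R -> 'rV[R]_n),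
      [/\ a0 < b0, gamma a0 = a, gamma b0 = b,
          Lipschitz_graph eps a0 b0 gamma
        & (gamma @` `[a0, b0]) `&` (E `\` [set a; b]) = set0].

Section Hausdorff.
Local Open Scope ereal_scope.

(* Equal to [-oo] on the empty set. *)
Definition diam (R : realType) (n : nat) (A : set 'rV[R]_n) : \bar R :=
  ereal_sup [set (normv (p.1 - p.2)%R)%:E | p in A `*` A].

(* Empty sets of a cover contribute nothing to the sum. *)
Definition Hausdorff_content (R : realType) (n : nat) (s delta : R)
    (A : set 'rV[R]_n) : \bar R :=
  ereal_inf [set \sum_(0 <= k <oo | U k != set0) poweR (diam (U k)) s |
    U in [set U : nat -> set 'rV[R]_n |
      A `<=` \bigcup_k U k /\ forall k, diam (U k) <= delta%:E]].

(* Without the factor that makes [n]-dimensional Hausdorff measure agree with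
   Lebesgue measure. *)
Definition Hausdorff_measure (R : realType) (n : nat) (s : R)
    (A : set 'rV[R]_n) : \bar R :=
  ereal_sup [set Hausdorff_content s delta A |
    delta in [set delta : R | (0 < delta)%R]].

End Hausdorff.

(* [R[i]^o] is [R[i]] with the topology of its modulus, as a normed space
   over itself, so that [derivable f z 1] and [derive1 f z] are complex
   differentiability and the complex derivative. *)
Definition plane_of_complex (R : realType) (z : R[i]^o) : 'rV[R]_2 :=
  \row_(i < 2) (if i == 0 then complex.Re z else complex.Im z).

(* To be used for open [U]. *)
Definition holomorphic_on (R : realType) (U : set R[i]^o)
    (f : R[i]^o -> R[i]^o) : Prop :=
  forall z, U z -> derivable f z 1.

(* Meaningful only for nonzero [z]; see [ArgP]. *)
Definition Arg (R : realType) (z : R[i]) : R :=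
  let theta := acos (complex.Re z / Normc.normc z) in
  if 0 <= complex.Im z then theta else - theta.

Lemma ArgP (R : realType) (z : R[i]) : z != 0 ->
  - pi < Arg z <= pi /\
  z = Complex (Normc.normc z * cos (Arg z)) (Normc.normc z * sin (Arg z)).
Proof.
case: z => x y z0; rewrite /Arg/=; set r := Num.sqrt _.
have r2 : r ^+ 2 = x ^+ 2 + y ^+ 2.
  by rewrite sqr_sqrtr// addr_ge0// sqr_ge0.
have r0 : 0 < r.
  rewrite sqrtr_gt0 lt0r addr_ge0 ?sqr_ge0// andbT paddr_eq0 ?sqr_ge0//.
  by rewrite !sqrf_eq0; apply: contra z0 => /andP[/eqP-> /eqP->].
have rn0 : r != 0 by rewrite gt_eqF.
set c := x / r; have xE : r * c = x by rewrite mulrC divfK.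
have c2 : 1 - c ^+ 2 = (y / r) ^+ 2.
  rewrite !expr_div_n; apply: (mulIf (expf_neq0 2 rn0)).
  by rewrite mulrBl mul1r !divfK ?expf_neq0// r2 addrC addKr.
have c1 : -1 <= c <= 1.
  have := sqr_ge0 (y / r); rewrite -c2 => ?.
  by apply/andP; split; nra.
have cosE : cos (acos c) = c by rewrite acosK// in_itv.
have sinE : sin (acos c) = `|y| / r.
  by rewrite sin_acos// c2 sqrtr_sqr normrM normfV (gtr0_norm r0).
have rsin : r * (`|y| / r) = `|y| by rewrite mulrC divfK.
have pi0 := pi_gt0 R.
have a0 := acos_ge0 c1; have api := acos_lepi c1.
case: (lerP 0 y) => y0; rewrite ?cosN ?sinN cosE sinE ?mulrN rsin xE.
  by rewrite (ger0_norm y0); split=> //; lra.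
rewrite (ltr0_norm y0) opprK; split=> //.
have : acos c < pi.
  apply: acos_ltpi; case/andP: c1 => c1 ->; rewrite andbT lt_neqAle c1 andbT.
  apply/eqP => ce; move: c2; rewrite -ce sqrrN expr1n subrr => /esym/eqP.
  by rewrite sqrf_eq0 mulf_eq0 invr_eq0 (negbTE rn0) orbF lt_eqF.
by lra.
Qed.

(* Main.v *)
(** Following [f] along Lipschitz graphs with small angle shows that all
    difference quotients [(f b - f a) / (b - a)] lie in one sector of opening
    less than [pi].  A map with this property on a dense set extends to the
    plane with the same property, and a map of the plane with this property is
    quasisymmetric.  So the extension [F] of [f] is continuous, injective and
    open, and its squared oscillation on a square is at most a constant times
    the area of the image of the square.

    For a rectangle [Q], Goursat's bisection gives
    [|int_(dQ) F| <= e |Q| + (C / t) |O n Q| + C t |F(Q)|], where [O] is any open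
    cover of [K]: small rectangles away from [K] are handled by complex
    differentiability, those inside [O] by the oscillation estimate and AM-GM.
    As [|O|] can be made arbitrarily small, all rectangle integrals vanish and
    [F] has a complex primitive.

    Finally [(F (z + h) - F z) * conj h] has nonnegative real part for every
    [h], hence is constant in [z] by Liouville's theorem; so [F] is additive up
    to a constant, and complex differentiable at one point, hence affine. *)
Require Import Defs.
From HB Require Import structures.
From mathcomp Require Import all_boot all_order all_algebra.
From mathcomp Require Import all_classical all_reals all_analysis.
From mathcomp Require Import complex.
From mathcomp Require Import ring lra.

Set Implicit Arguments.
Unset Strict Implicit.
Unset Printing Implicit Defensive.
Import Order.TTheory GRing.Theory Num.Theory.
Import numFieldNormedType.Exports.
Local Open Scope classical_set_scope.
Local Open Scope ring_scope.
Local Notation Re := complex.Re.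
Local Notation Im := complex.Im.
Local Notation nrm := Normc.normc.
Local Notation "z ^*" := (conjc z) : ring_scope.

(** Nothing bounds the size of [f'], so near [K] no modulus of continuity can be had by integrating
    the derivative; every estimate has to come from the angle alone. For that the difference
    quotient is multiplied by |b - a|^2: the sector condition on (F b - F a) conj(b - a) is a pair
    of real inequalities between values of [F], free of derivatives and stable under limits.

    Distortion bounds rest on one remark: when [c] is close to the midpoint of [a] and [b], the
    directions of [c - a] and [b - c] differ so little that the increments of [F] over the two steps
    cannot cancel.

    In the bisection, a rectangle of side s near [K] contributes about s times the oscillation rho
    of [F]. Such products do not add up, but s^2 and rho^2 are bounded by areas of disjoint sets.
    The area of the image is finite and not small, which is why the weight t is fixed first and the
    cover [O] only afterwards.

    The bisection yields a primitive of [F] and not yet a derivative of [F], so Liouville's theorem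
    is proved for the derivative of a differentiable function, using Fourier coefficients on
    circles. *)

(** * Norm and cones in the complex plane *)

Section ComplexNorm.
Variable R : realType.
Implicit Types (z w : R[i]) (k : R).

Lemma nrm_sqr z : nrm z ^+ 2 = Re z ^+ 2 + Im z ^+ 2.
Proof. by case: z => x y /=; rewrite sqr_sqrtr// addr_ge0// sqr_ge0. Qed.

Lemma nrm_ge0 z : 0 <= nrm z.
Proof. by case: z => x y /=; exact: sqrtr_ge0. Qed.

Lemma nrm0 : nrm (0 : R[i]) = 0. Proof. exact: Normc.normc0. Qed.

Lemma nrm1 : nrm (1 : R[i]) = 1. Proof. exact: Normc.normc1. Qed.

Lemma nrm_eq0 z : (nrm z == 0) = (z == 0).
Proof.
by apply/eqP/eqP => [|->]; [exact: Normc.eq0_normc|exact: nrm0].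
Qed.

Lemma nrm_gt0 z : (0 < nrm z) = (z != 0).
Proof. by rewrite lt0r nrm_ge0 andbT nrm_eq0. Qed.

Lemma nrmM z w : nrm (z * w) = nrm z * nrm w.
Proof. exact: Normc.normcM. Qed.

Lemma nrmN z : nrm (- z) = nrm z.
Proof. by case: z => x y /=; rewrite !sqrrN. Qed.

Lemma nrm_distC z w : nrm (z - w) = nrm (w - z).
Proof. by rewrite -nrmN opprB. Qed.

Lemma nrmJ z : nrm z^* = nrm z.
Proof. by case: z => x y /=; rewrite sqrrN. Qed.

Lemma nrmD z w : nrm (z + w) <= nrm z + nrm w.
Proof. exact: le_normcD. Qed.

Lemma nrm_triangle z w c : nrm (z - w) <= nrm (z - c) + nrm (c - w).
Proof. by apply: le_trans (nrmD _ _); rewrite addrA subrK. Qed.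

Lemma Re_le_nrm z : `|Re z| <= nrm z.
Proof.
rewrite -(ler_pXn2r (ltn0Sn 1)) ?nnegrE ?nrm_ge0// nrm_sqr -normrX.
by rewrite ger0_norm ?sqr_ge0// lerDl sqr_ge0.
Qed.

Lemma Im_le_nrm z : `|Im z| <= nrm z.
Proof.
rewrite -(ler_pXn2r (ltn0Sn 1)) ?nnegrE ?nrm_ge0// nrm_sqr -normrX.
by rewrite ger0_norm ?sqr_ge0// lerDr sqr_ge0.
Qed.

Lemma nrm_le_Re_Im z : nrm z <= `|Re z| + `|Im z|.
Proof.
rewrite -(ler_pXn2r (ltn0Sn 1)) ?nnegrE ?nrm_ge0 ?addr_ge0// nrm_sqr.
rewrite sqrrD -addrA !real_normK ?num_real// lerD2l lerDr.
by rewrite mulrn_wge0// mulr_ge0.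
Qed.

Lemma nrm_real (x : R) : nrm (x%:C)%C = `|x|.
Proof. by rewrite /= expr0n addr0 sqrtr_sqr. Qed.

Lemma Re_add z w : Re (z + w) = Re z + Re w.
Proof. by case: z; case: w. Qed.

Lemma Im_add z w : Im (z + w) = Im z + Im w.
Proof. by case: z; case: w. Qed.

Lemma Re_opp z : Re (- z) = - Re z. Proof. by case: z. Qed.

Lemma Im_opp z : Im (- z) = - Im z. Proof. by case: z. Qed.

Lemma Re_mul z w : Re (z * w) = Re z * Re w - Im z * Im w.
Proof. by case: z; case: w. Qed.

Lemma Im_mul z w : Im (z * w) = Re z * Im w + Im z * Re w.
Proof. by case: z => a b; case: w => c d. Qed.

Lemma Re_conjc z : Re z^* = Re z. Proof. by case: z. Qed.

Lemma Im_conjc z : Im z^* = - Im z. Proof. by case: z. Qed.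

Lemma complex_ext z w : Re z = Re w -> Im z = Im w -> z = w.
Proof. by case: z => a b; case: w => c d /= -> ->. Qed.

Lemma mulJ z : z * z^* = ((nrm z ^+ 2)%:C)%C.
Proof.
apply: complex_ext; rewrite ?Re_mul ?Im_mul Re_conjc Im_conjc ?nrm_sqr/=; ring.
Qed.

Lemma Re_conj_nrm z w : Re (z * w^*) <= nrm z * nrm w.
Proof. by rewrite -(nrmJ w) -nrmM; exact: le_trans (ler_norm _) (Re_le_nrm _). Qed.

End ComplexNorm.

Section Cone.
Variable R : realType.
Implicit Types (z w a b c : R[i]) (k : R) (F : R[i] -> R[i]).

(** For [k > 0] this is the closed sector of half-angle [atan k] about the positive axis, vertex
    included. *)
Definition cone k z := `|Im z| <= k * Re z.

(* For [k > 0] this is delta-monotonicity of [F] on [D]. *)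
Definition sectorial k (D : set R[i]) F :=
  forall a b, D a -> D b -> cone k ((F b - F a) * (b - a)^*).


Lemma cone_Re_ge0 k z : 0 < k -> cone k z -> 0 <= Re z.
Proof.
by move=> k0 h; have := le_trans (normr_ge0 _) h; rewrite pmulr_rge0.
Qed.

Lemma cone_nrm k z : 0 < k -> cone k z -> nrm z <= (1 + k) * Re z.
Proof.
move=> k0 h; have z0 := cone_Re_ge0 k0 h; apply: le_trans (nrm_le_Re_Im z) _.
by rewrite mulrDl mul1r (ger0_norm z0) lerD2l.
Qed.

(** The condition on [w] describes the sector of half-angle pi/2 - atan k, so the arguments of [z]
    and [w] add up to at most pi/2. *)
Lemma cone_dual k z w : 0 < k -> cone k z -> k * `|Im w| <= Re w ->
  0 <= Re (z * w).
Proof.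
move=> k0 hz hw; have z0 := cone_Re_ge0 k0 hz.
rewrite Re_mul subr_ge0; apply: le_trans (ler_norm _) _; rewrite normrM.
apply: (@le_trans _ _ (k * Re z * `|Im w|)); first exact: ler_wpM2r.
by rewrite mulrAC mulrC ler_wpM2l.
Qed.

Lemma cone0 k : cone k 0.
Proof. by rewrite /cone/= normr0 mulr0. Qed.

Lemma coneZ k (t : R) z : 0 <= t -> cone k z -> cone k ((t%:C)%C * z).
Proof.
move=> t0; rewrite /cone Re_mul Im_mul/= !mul0r subr0 addr0 normrM (ger0_norm t0).
by move=> h; rewrite mulrCA ler_wpM2l.
Qed.

Section Sectorial.
Variables (k : R) (D : set R[i]) (F : R[i] -> R[i]).
Hypotheses (k0 : 0 < k) (sF : sectorial k D F).

(** The steps [c - a] and [b - c] are so nearly parallel that [F b - F c], which is in the sector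
    about [b - c], has a nonnegative component along [c - a]. Adding it to [F c - F a] does not
    shorten the component along [c - a], and this component controls the norm of [F c - F a]. *)
Lemma sectorial_triangle a b c : D a -> D b -> D c ->
  k * `|Im ((b - c) * (c - a)^*)| <= Re ((b - c) * (c - a)^*) ->
  nrm (F c - F a) <= (1 + k) * nrm (F b - F a).
Proof.
move=> Da Db Dc h; have k0' := k0; have k1 : 0 <= 1 + k by lra.
have [->|ca] := eqVneq c a; first by rewrite subrr nrm0 mulr_ge0// nrm_ge0.
have [->|bc] := eqVneq b c; first by apply: ler_peMl; [exact: nrm_ge0|lra].
have p0 : 0 < nrm (c - a) by rewrite nrm_gt0 subr_eq0.
have q0 : 0 < nrm (b - c) by rewrite nrm_gt0 subr_eq0.
have hu := cone_nrm k0 (sF Da Dc).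
have := cone_dual k0 (sF Dc Db) h.
(* The positive factor |b - c|^2 trades the direction [b - c] for the direction [c - a]. *)
have -> : (F b - F c) * (b - c)^* * ((b - c) * (c - a)^*) =
    ((nrm (b - c) ^+ 2)%:C)%C * ((F b - F c) * (c - a)^*).
  by rewrite -mulJ; ring.
rewrite [Re _]Re_mul/= mul0r subr0 pmulr_rge0 ?exprn_gt0// => hv.
rewrite -(ler_pM2r p0) -{1}(nrmJ (c - a)) -nrmM; apply: le_trans hu _.
rewrite -mulrA ler_wpM2l//; apply: le_trans (Re_conj_nrm _ _).
have -> : F b - F a = (F c - F a) + (F b - F c) by ring.
by rewrite [(_ + (F b - F c)) * _]mulrDl Re_add lerDl.
Qed.

End Sectorial.
End Cone.

(** * Quasisymmetry *)

Section QuasiSymmetry.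
Variable R : realType.
Implicit Types (z w a b c d p : R[i]) (k : R).

(** With s = |d| and r = |z| the real part is s^2 - r^2 and the imaginary part at most 2 s r. The
    inequality 2 k s r <= s^2 - r^2 is the sum of s (s - (2k+1) r) >= 0 and r (s - r) >= 0, whence
    the constant 2k+1. *)
Lemma dual_cone_of_small k d z : 0 < k -> (2 * k + 1) * nrm z <= nrm d ->
  k * `|Im ((d - z) * (d + z)^*)| <= Re ((d - z) * (d + z)^*).
Proof.
move=> k0 h; set r := nrm z in h; set s := nrm d in h.
have r0 : 0 <= r by exact: nrm_ge0.
have -> : Re ((d - z) * (d + z)^*) = s ^+ 2 - r ^+ 2.
  by rewrite !nrm_sqr; case: d {h s}; case: z {r0 r} => a b c e /=; ring.
have : `|Im ((d - z) * (d + z)^*)| <= 2 * (s * r).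
  have -> : Im ((d - z) * (d + z)^*) = 2 * Im (d * z^*).
    by case: d {h s}; case: z {r0 r} => a b c e /=; ring.
  rewrite normrM ger0_norm// ler_wpM2l//; apply: le_trans (Im_le_nrm _) _.
  by rewrite nrmM nrmJ.
move=> hi; apply: (@le_trans _ _ (k * (2 * (s * r)))); first by rewrite ler_wpM2l// ltW.
have rs : r <= s by nra.
have : 0 <= s * (s - (2 * k + 1) * r) by rewrite mulr_ge0 ?nrm_ge0// subr_ge0.
have : 0 <= r * (s - r) by rewrite mulr_ge0// subr_ge0.
by lra.
Qed.

Section Total.
Variables (k : R) (F : R[i] -> R[i]).
Hypotheses (k0 : 0 < k) (sF : sectorial k setT F).

(** Stated for arbitrary [D] and [G] because it also bounds [f] on the complement of [K], before an
    extension exists. *)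
Lemma sectorial_midpoint (D : set R[i]) (G : R[i] -> R[i]) m d z :
  sectorial k D G -> D (m - d) -> D (m + d) -> D z ->
  (2 * k + 1) * nrm (z - m) <= nrm d ->
  nrm (G z - G (m - d)) <= (1 + k) * nrm (G (m + d) - G (m - d)).
Proof.
move=> sG Da Db Dz h; apply: (sectorial_triangle k0 sG) => //.
have -> : m + d - z = d - (z - m) by ring.
have -> : z - (m - d) = d + (z - m) by ring.
exact: dual_cone_of_small.
Qed.

Let tau := (2 * k + 1)^-1.

(** The radius enters squared, so that one enlargement multiplies it by 1 + tau^2 and no square root
    appears. *)
Let osc_le p (s M : R) :=
  forall z, nrm (z - p) ^+ 2 <= s -> nrm (F z - F p) <= M.

(* The point [z] is close to the midpoint of two points of the smaller disc
   that lie almost on opposite sides of it. *)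
Lemma osc_le_grow p s M :
  osc_le p s M -> osc_le p ((1 + tau ^+ 2) * s) ((3 + 2 * k) * M).
Proof.
move=> h z zs; have k0' := k0.
have t0 : 0 < tau by rewrite invr_gt0; lra.
have t1 : 0 < 1 + tau ^+ 2 by rewrite ltr_pwDl// sqr_ge0.
(* The point [m] lies on the segment from [p] to [z], and [d] is perpendicular to it. The choice
   gives 1 - mu = tau nu, so that |z - m| = tau |d|, and mu^2 + nu^2 = mu, so that m + d and m - d
   lie in the smaller disc. *)
pose mu := (1 + tau ^+ 2)^-1; pose nu := tau * mu.
have mu0 : 0 < mu by rewrite invr_gt0.
have muE : mu * (1 + tau ^+ 2) = 1 by rewrite mulVf// gt_eqF.
set y := z - p.
pose m := p + (mu%:C)%C * y; pose d := Complex 0 nu * y.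
have nd : nrm d = nu * nrm y.
  rewrite nrmM; congr (_ * _); rewrite /= expr0n add0r sqrtr_sqr ger0_norm//.
  by rewrite mulr_ge0// ltW.
have nm : nrm (z - m) = tau * nu * nrm y.
  have -> : z - m = ((tau * nu)%:C)%C * y.
    have -> : tau * nu = 1 - mu by rewrite -[in RHS]muE /nu; ring.
    rewrite /m /y; case: (z) => z1 z2; case: (p) => p1 p2.
    by apply: complex_ext => /=; ring.
  by rewrite nrmM nrm_real ger0_norm// !mulr_ge0// ltW.
have in_ball e : e ^+ 2 = nu ^+ 2 -> nrm (m + Complex 0 e * y - p) ^+ 2 <= s.
  move=> ee; have -> : m + Complex 0 e * y - p = Complex mu e * y.
    rewrite /m; case: (y) => y1 y2; case: (p) => p1 p2 /=.
    by apply: complex_ext => /=; ring.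
  rewrite nrmM exprMn nrm_sqr/= ee.
  have -> : mu ^+ 2 + nu ^+ 2 = mu.
    by rewrite -[RHS]mulr1 -[in RHS]muE /nu; ring.
  by rewrite -(ler_pM2l t1) mulrA [_ * mu]mulrC muE mul1r.
have Nd : m - d = m + Complex 0 (- nu) * y.
  by congr (_ + _); rewrite /d; case: (y) => y1 y2; apply: complex_ext => /=; ring.
have hx := h _ (in_ball (- nu) (sqrrN _)); rewrite -Nd in hx.
have hy := h _ (in_ball nu erefl); rewrite -/d in hy.
have hz : nrm (F z - F (m - d)) <= (1 + k) * nrm (F (m + d) - F (m - d)).
  apply: (sectorial_midpoint sF) => //; rewrite nm nd !mulrA /tau divff ?mul1r//.
  by rewrite gt_eqF//; lra.
have hyx := nrm_triangle (F (m + d)) (F (m - d)) (F p).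
rewrite [nrm (F p - _)]nrm_distC in hyx.
have hzp := nrm_triangle (F z) (F p) (F (m - d)).
(* From [z] to [m - d] costs (1 + k) 2M and from [m - d] to [p] another M, which gives the factor 3
   + 2k. *)
have : (1 + k) * nrm (F (m + d) - F (m - d)) <= (1 + k) * (2 * M).
  by rewrite ler_wpM2l//; lra.
by lra.
Qed.

Lemma osc_le_iter p s M n :
  osc_le p s M -> osc_le p ((1 + tau ^+ 2) ^+ n * s) ((3 + 2 * k) ^+ n * M).
Proof.
move=> h; elim: n => [|n IHn]; first by rewrite !expr0 !mul1r.
by rewrite !(exprS _ n) -!mulrA; exact: (osc_le_grow IHn).
Qed.

(** On a small disc about the midpoint of [a] and [b] the oscillation is bounded by
    [sectorial_midpoint]. Finitely many enlargements, their number depending on [k] and [r] only,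
    reach a disc that contains [a] and [z]. *)
Lemma sectorial_quasisymmetric (r : R) : exists2 L : R, 0 < L &
  forall a b z, nrm (z - a) <= r * nrm (b - a) ->
    nrm (F z - F a) <= L * nrm (F b - F a).
Proof.
have k0' := k0; have t0 : 0 < tau by rewrite invr_gt0; lra.
(* After [n] enlargements of the disc of radius tau |d| the radius is at least (2r+1)|d|, which
   bounds |z - a| + |a - m|. Such an [n] exists by Bernoulli's inequality. *)
have [n hn] : exists n : nat, (2 * r + 1) ^+ 2 <= (1 + tau ^+ 2) ^+ n * tau ^+ 2.
  have [n hn] : exists n : nat, (2 * r + 1) ^+ 2 / tau ^+ 2 / tau ^+ 2 <= n%:R.
    eexists; apply/ltW/archi_boundP.
    exact: divr_ge0 (divr_ge0 (sqr_ge0 _) (sqr_ge0 _)) (sqr_ge0 _).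
  exists n; rewrite -ler_pdivrMr ?exprn_gt0//; rewrite ler_pdivrMr ?exprn_gt0// in hn.
  apply: le_trans hn _; elim: n => [|n]; first by rewrite mul0r exprn_ge0// addr_ge0// sqr_ge0.
  rewrite -natr1 (exprS _ n) => IH.
  have h1 : 1 <= (1 + tau ^+ 2) ^+ n by rewrite exprn_ege1// lerDl sqr_ge0.
  have : 0 <= tau ^+ 2 by rewrite sqr_ge0.
  by nra.
exists (2 * ((3 + 2 * k) ^+ n * (2 * (1 + k)))).
  by rewrite !mulr_gt0 ?exprn_gt0//; lra.
move=> a b z hz; pose d := (b - a) / 2%:R; pose m := a + d.
have two : (2%:R : R[i]) != 0 by rewrite pnatr_eq0.
have Ea : a = m - d by rewrite /m addrK.
have Eb : b = m + d by rewrite /m /d; field.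
have hb w : (2 * k + 1) * nrm (w - m) <= nrm d ->
    nrm (F w - F a) <= (1 + k) * nrm (F b - F a).
  by move=> hw; rewrite {1 2}Ea {1}Eb; exact: (sectorial_midpoint sF).
have hm : nrm (F m - F a) <= (1 + k) * nrm (F b - F a).
  by apply: hb; rewrite subrr nrm0 mulr0 nrm_ge0.
have base : osc_le m (tau ^+ 2 * nrm d ^+ 2) (2 * (1 + k) * nrm (F b - F a)).
  move=> w; rewrite -exprMn ler_pXn2r ?nnegrE ?nrm_ge0//; last first.
    by rewrite mulr_ge0 ?nrm_ge0// ltW.
  rewrite mulrC ler_pdivlMr; last lra.
  rewrite mulrC => /hb hw; have := nrm_triangle (F w) (F m) (F a).
  by rewrite [nrm (F a - _)]nrm_distC; lra.
have nd : nrm (b - a) = 2 * nrm d.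
  rewrite Ea Eb; have -> : m + d - (m - d) = ((2:R)%:C)%C * d.
    by case: (m) => m1 m2; case: (d) => d1 d2; apply: complex_ext => /=; ring.
  by rewrite nrmM nrm_real ger0_norm.
have big := osc_le_iter (n := n) base.
have hz' : nrm (z - m) <= (2 * r + 1) * nrm d.
  have := nrm_triangle z m a; have -> : a - m = - d by rewrite /m; ring.
  by rewrite nrmN; rewrite nd in hz; lra.
have dist w : nrm (w - m) <= (2 * r + 1) * nrm d ->
    nrm (F w - F m) <= (3 + 2 * k) ^+ n * (2 * (1 + k) * nrm (F b - F a)).
  move=> hw; apply: big; apply: (@le_trans _ _ (((2 * r + 1) * nrm d) ^+ 2)).
    by rewrite ler_pXn2r ?nnegrE ?nrm_ge0//; exact: le_trans (nrm_ge0 _) hw.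
  by rewrite exprMn mulrA; apply: ler_wpM2r => //; rewrite sqr_ge0.
have := dist _ hz'; have := nrm_triangle (F z) (F a) (F m).
have : nrm (F m - F a) <= (3 + 2 * k) ^+ n * (2 * (1 + k) * nrm (F b - F a)).
  have [r0|r0] := lerP 0 r.
    rewrite nrm_distC; apply: dist; have -> : a - m = - d by rewrite /m; ring.
    by rewrite nrmN ler_peMl ?nrm_ge0//; lra.
  (* A negative [r] forces [b = a], hence [m = a]. *)
  have d0 : nrm d = 0.
    have := nrm_ge0 (z - a); have := nrm_ge0 d; rewrite nd in hz; nra.
  have -> : m = a by rewrite /m; move/eqP: d0; rewrite nrm_eq0 => /eqP ->; rewrite addr0.
  rewrite subrr nrm0 !mulr_ge0 ?nrm_ge0 ?exprn_ge0//; lra.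
move=> h1 h2 h3; apply: le_trans h2 _; rewrite mulrA -mulrA in h1 h3 *; lra.
Qed.

End Total.
End QuasiSymmetry.

(** * Increments along Lipschitz graphs *)

Section Path.
Variable R : realType.
Implicit Types (a b z w : R[i]) (k e d t s : R).

(** A supremum argument in which the two-sided comparison does the work of continuity: its left half
    carries the inequality to the supremum, its right half carries it beyond. It serves for sectors
    along arcs, for mean value inequalities and for compactness of segments. *)
Lemma locally_nondecreasing (phi : R -> R) (a b : R) : a <= b ->
  (forall t, a <= t <= b -> exists2 d : R, 0 < d & forall s, a <= s <= b ->
    `|s - t| < d -> (t < s -> phi t <= phi s) /\ (s < t -> phi s <= phi t)) ->
  phi a <= phi b.
Proof.
move=> ab h; pose A := [set t | a <= t <= b /\ phi a <= phi t].
have Aa : A a by split; rewrite ?lexx.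
have ubA : ubound A b by move=> t [/andP[]].
have hsA : has_sup A by split; [exists a|exists b].
set c := sup A; have ac : a <= c by exact: sup_upper_bound.
have cb : c <= b by apply: ge_sup => //; exists a.
have [d d0 hd] := h c (introT andP (conj ac cb)).
have Ac : phi a <= phi c.
  have [t At ct] := sup_adherent d0 hsA; have tc := sup_upper_bound hsA At.
  case: At => tab at_; apply: le_trans at_ _.
  have [->//|tc'] := eqVneq t c.
  have td : `|t - c| < d by rewrite distrC ger0_norm ?subr_ge0//; rewrite -/c in ct; lra.
  by have [_] := hd t tab td; apply; rewrite lt_neqAle tc'.
have [cb'|] := ltP c b; last by move=> bc; have <- : c = b by apply/le_anti/andP.
pose s := Num.min b (c + d / 2).
have cs : c < s by rewrite lt_min cb'/=; lra.
have sb : s <= b by rewrite ge_min lexx.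
have sd : s <= c + d / 2 by rewrite ge_min lexx orbT.
have sab : a <= s <= b by rewrite sb andbT; lra.
have sd' : `|s - c| < d by rewrite gtr0_norm ?subr_gt0//; lra.
have [/(_ cs) h1 _] := hd s sab sd'.
have : A s by split=> //; exact: le_trans h1.
by move=> /(sup_upper_bound hsA); rewrite -/c leNgt cs.
Qed.

Definition cderiv (f : R[i] -> R[i]) z l := forall e : R, 0 < e ->
  exists2 d : R, 0 < d & forall w, nrm (w - z) < d ->
    nrm (f w - f z - l * (w - z)) <= e * nrm (w - z).

(** The aperture (2k+1)^-1 is small enough for the two angles to add up to less than pi/2: with h =
    (2k+1)^-1 one has k h <= 1/2, so at least half of Re z Re w survives in the real part. The bound
    on the norm leaves room for an error term. *)
Lemma cone_mul k z w : 0 < k -> cone k z -> cone (2 * k + 1)^-1 w ->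
  cone (2 * k + 2) (z * w) /\
  nrm (z * w) <= 4 * (k + 1) * Re (z * w).
Proof.
move=> k0 hz hw; pose h : R := (2 * k + 1)^-1.
have h0 : 0 < h by rewrite invr_gt0; lra.
have hE : h * (2 * k + 1) = 1 by rewrite mulVf// gt_eqF//; lra.
have z0 := cone_Re_ge0 k0 hz; have w0 := cone_Re_ge0 h0 hw.
have nz := cone_nrm k0 hz; have nw := cone_nrm h0 hw.
have zw0 : 0 <= Re z * Re w by rewrite mulr_ge0.
have h1 : h <= 1 by nra.
have kh : 2 * (k * h) <= 1 by nra.
rewrite /cone -/h in hz hw.
have i1 : `|Im z * Im w| <= k * h * (Re z * Re w).
  by rewrite normrM mulrACA; apply: ler_pM.
have re : Re z * Re w <= 2 * Re (z * w).
  have := ler_norm (Im z * Im w); rewrite Re_mul; nra.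
have i2 : `|Im (z * w)| <= (k + 1) * (Re z * Re w).
  rewrite Im_mul; apply: le_trans (ler_normD _ _) _; rewrite !normrM.
  rewrite (ger0_norm z0) (ger0_norm w0).
  have := ler_wpM2l z0 hw; have := ler_wpM2r w0 hz; nra.
split; first by rewrite /cone; nra.
rewrite nrmM; apply: (@le_trans _ _ ((1 + k) * Re z * ((1 + h) * Re w))).
  by apply: ler_pM => //; exact: nrm_ge0.
have : (1 + h) * (Re z * Re w) <= 2 * (Re z * Re w) by rewrite ler_wpM2r//; lra.
by nra.
Qed.

(** A sector is an intersection of two half-planes, so it suffices that two real linear functions of
    [f (g t) * v] do not decrease in [t]. Locally the increment of [f] is [f'] times a step of the
    arc up to a small error; the step lies in a narrow sector about the chord, and [cone_mul]
    applies. The error widens 2k+2 to 2k+3. *)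
Lemma cone_increment k (f f' : R[i] -> R[i]) (D : set R[i]) (a0 b0 : R)
    (g : R -> R[i]) :
  0 < k -> a0 < b0 ->
  (forall z, D z -> cderiv f z (f' z)) ->
  (forall z, D z -> f' z != 0 /\ cone k (f' z)) ->
  (forall t, a0 <= t <= b0 -> D (g t)) ->
  (forall t, a0 <= t <= b0 -> forall e : R, 0 < e -> exists2 d : R, 0 < d &
     forall s, a0 <= s <= b0 -> `|s - t| < d -> nrm (g s - g t) < e) ->
  (forall t s, a0 <= t -> t < s -> s <= b0 ->
     g s != g t /\ cone (2 * k + 1)^-1 ((g s - g t) * (g b0 - g a0)^*)) ->
  cone (2 * k + 3) ((f (g b0) - f (g a0)) * (g b0 - g a0)^*).
Proof.
move=> k0 ab df cf' Dg cg hg; set v := (g b0 - g a0)^*.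
have v0 : v != 0.
  by rewrite conjc_eq0 subr_eq0; have [] := hg a0 b0 (lexx _) ab (lexx _).
pose E := nrm v; have E0 : 0 < E by rewrite nrm_gt0.
have loc t : a0 <= t <= b0 -> exists2 d : R, 0 < d & forall s, a0 <= s <= b0 ->
    `|s - t| < d ->
    (t < s -> cone (2 * k + 3) ((f (g s) - f (g t)) * v)) /\
    (s < t -> cone (2 * k + 3) ((f (g t) - f (g s)) * v)).
  move=> tab; have Dt := Dg _ tab; have [f0 cf] := cf' _ Dt.
  have nf0 : 0 < nrm (f' (g t)) by rewrite nrm_gt0.
  (* By the norm bound of [cone_mul] this makes the error at most Re y / (2k+4), exactly what (2k+2)
     Re y + err <= (2k+3) (Re y - err) requires. *)
  pose e := nrm (f' (g t)) / (4 * (k + 1)) / (2 * k + 4).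
  have e0 : 0 < e by rewrite !divr_gt0//; lra.
  have [d1 d10 hd1] := df _ Dt e e0; have [d d0 hd] := cg _ tab d1 d10.
  exists d => // s sab std.
  (* The sign [c] treats the points after and before [t] at once. *)
  have key c x : (c = 1 \/ c = - 1) -> x = c * (g s - g t) ->
      cone (2 * k + 1)^-1 (x * v) -> cone (2 * k + 3) (c * (f (g s) - f (g t)) * v).
    move=> c1 xE hx; have := hd1 _ (hd s sab std); set err := _ - _ => herr.
    have nx : nrm x = nrm (g s - g t).
      by rewrite xE nrmM; case: c1 => ->; rewrite ?nrmN nrm1 mul1r.
    have -> : c * (f (g s) - f (g t)) * v = f' (g t) * (x * v) + c * err * v.
      by rewrite /err xE; ring.
    have [h1 h2] := cone_mul k0 cf hx; set y := f' (g t) * (x * v) in h1 h2 *.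
    have ne : nrm (c * err * v) * (2 * k + 4) <= Re y.
      have hne : nrm (c * err * v) <= e * nrm x * E.
        rewrite nrmM -/E ler_wpM2r ?(ltW E0)// nrmM nx.
        by case: c1 => ->; rewrite ?nrmN nrm1 mul1r.
      have k4 : 0 < 2 * k + 4 by lra.
      have k1 : 0 < 4 * (k + 1) by lra.
      rewrite -(ler_pM2l k1); apply: le_trans h2.
      have -> : nrm y = nrm (f' (g t)) * (nrm x * E) by rewrite /y !nrmM.
      apply: (@le_trans _ _ (4 * (k + 1) * (e * nrm x * E * (2 * k + 4)))).
        by rewrite ler_pM2l// ler_pM2r.
      rewrite /e le_eqVlt; apply/orP; left; apply/eqP; field.
      by apply/andP; split; rewrite gt_eqF//; lra.
    have := Re_le_nrm (c * err * v); have := Im_le_nrm (c * err * v).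
    set y' := c * err * v in ne *; rewrite /cone in h1 * => hi hr.
    have hr' : - nrm y' <= Re y'.
      by rewrite lerNl; apply: le_trans hr; rewrite -normrN ler_norm.
    rewrite Im_add Re_add; apply: le_trans (ler_normD _ _) _; nra.
  case/andP: tab => t0 t1; case/andP: sab => s0 s1; split=> lts.
    rewrite -[f (g s) - _]mul1r; apply: (key 1 (g s - g t)); [by left|by rewrite mul1r|].
    by have [] := hg t s t0 lts s1.
  have -> : f (g t) - f (g s) = -1 * (f (g s) - f (g t)) by ring.
  apply: (key _ (g t - g s)); [by right|by ring|].
  by have [] := hg s t s0 lts t1.
have half (c : R) : `|c| = 1 -> forall z, cone (2 * k + 3) z ->
    0 <= (2 * k + 3) * Re z + c * Im z.
  move=> c1 z; rewrite /cone => hz.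
  have : `|c * Im z| <= (2 * k + 3) * Re z by rewrite normrM c1 mul1r.
  by rewrite ler_norml => /andP[]; lra.
have mono (c : R) : `|c| = 1 -> 0 <= (2 * k + 3) * Re ((f (g b0) - f (g a0)) * v) +
    c * Im ((f (g b0) - f (g a0)) * v).
  move=> c1; pose phi t := (2 * k + 3) * Re (f (g t) * v) + c * Im (f (g t) * v).
  have -> : (2 * k + 3) * Re ((f (g b0) - f (g a0)) * v) +
    c * Im ((f (g b0) - f (g a0)) * v) = phi b0 - phi a0.
    by rewrite /phi mulrBl Re_add Im_add Re_opp Im_opp; ring.
  have inc t s : cone (2 * k + 3) ((f (g s) - f (g t)) * v) -> phi t <= phi s.
    by move=> /(half c c1); rewrite /phi mulrBl Re_add Im_add Re_opp Im_opp; lra.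
  rewrite subr_ge0; apply: locally_nondecreasing => [|t tab]; first exact: ltW.
  have [d d0 hd] := loc t tab; exists d => // s sab std.
  by have [h1 h2] := hd s sab std; split=> ts; apply: inc; [exact: h1|exact: h2].
have := mono 1 (normr1 _); have := mono (-1) (normrN1 _).
by rewrite /cone ler_norml; set x := Re _; set y := Im _ => ? ?; apply/andP; split; lra.
Qed.

End Path.

(** * From real vectors, angles and arguments to complex norms and sectors *)

Section Interface.
Variable R : realType.
Implicit Types (a b z w : R[i]) (K : set R[i]^o).

Lemma nrm_normr (z : R[i]^o) : `|z| = ((nrm z)%:C)%C.
Proof. by case: z. Qed.

Lemma closed_compl_ball K z : closed K -> ~ K z ->
  exists2 r : R, 0 < r & forall w, nrm (w - z) < r -> ~ K w.
Proof.
move=> /closed_openC; rewrite openE => /(_ z) + Kz => /(_ Kz).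
move=> /nbhs_normP[e /= e0 he]; move: e0; rewrite ltcE/= => /andP[/eqP ei er].
exists (Re e) => // w hw; apply: he => /=; rewrite nrm_normr ltcE/= ei eqxx/=.
by rewrite nrm_distC.
Qed.

Lemma derivable_cderiv (f : R[i]^o -> R[i]^o) (z : R[i]^o) :
  derivable f z 1 -> cderiv f z (derive1 f z).
Proof.
move=> df; have : (h^-1 *: (f (h + z) - f z) @[h --> (0 : R[i]^o)^'] --> derive1 f z).
  rewrite /derive1 => /=.
  have -> : (fun h : R[i]^o => h^-1 *: (f (h + z) - f z)) =
      (fun h : R[i]^o => h^-1 *: ((f \o shift z) (h *: (1 : R[i]^o)) - f z)).
    by apply/funext => h /=; rewrite /GRing.scale/= mulr1.
  exact: df.
move=> /cvgrPdist_lt h e e0; have ec0 : 0 < (e%:C)%C :> R[i] by rewrite ltcR.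
have /nbhs_normP[d /= d0 hd] := h _ ec0.
move: d0; rewrite ltcE/= => /andP[/eqP di dr]; exists (Re d) => // w hw.
have [->|wz] := eqVneq w z; first by rewrite !subrr mulr0 subr0 nrm0 mulr0.
have wz0 : w - z != 0 by rewrite subr_eq0.
have := hd (w - z); rewrite /= sub0r normrN nrm_normr ltcE/= di eqxx/= => /(_ hw wz0).
rewrite subrK nrm_normr ltcR => /ltW hle.
have alg (u l v : R[i]) : u != 0 -> v - l * u = - u * (l - u^-1 * v).
  by move=> u0; field.
rewrite (alg (w - z) (derive1 f z) (f w - f z) wz0).
by rewrite nrmM nrmN mulrC ler_wpM2r// nrm_ge0.
Qed.

Lemma Arg_cone (alpha : R) : alpha < pi / 2 -> exists2 k : R, 0 < k &
  forall z, z != 0 -> `|Arg z| <= alpha -> cone k z.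
Proof.
move=> ha; have [a0|a0] := ltP alpha 0.
  by exists 1 => // z _ h; have := le_lt_trans h a0; rewrite normr_lt0.
have pi0 := pi_gt0 R.
have ca : 0 < cos alpha by rewrite cos_gt0_pihalf// ha andbT; lra.
(* A cruder slope than the tangent of [alpha]: it only needs |Im z| <= |z| and Re z >= |z| cos
   alpha. *)
exists (cos alpha)^-1; first by rewrite invr_gt0.
move=> z z0 hz; have [_ zE] := ArgP z0; set r := nrm z in zE.
have r0 : 0 <= r by exact: nrm_ge0.
rewrite /cone; have -> : Re z = r * cos (Arg z) by rewrite {1}zE.
apply: le_trans (Im_le_nrm z) _; rewrite -/r mulrCA ler_peMr//.
rewrite mulrC ler_pdivlMr// mul1r.
have -> : cos (Arg z) = cos `|Arg z| by case: (ler0P (Arg z)) => // _; rewrite cosN.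
have [->//|ne] := eqVneq `|Arg z| alpha.
apply/ltW; rewrite ltr_cos ?in_itv/=; last 2 first.
- by rewrite normr_ge0/=; lra.
- by rewrite a0/=; lra.
by rewrite lt_neqAle ne.
Qed.

Lemma dotv_plane (z w : R[i]^o) :
  dotv (plane_of_complex z) (plane_of_complex w) = Re (z * w^*).
Proof.
rewrite /dotv big_ord_recl big_ord1 !mxE/= Re_mul Re_conjc Im_conjc; ring.
Qed.

Lemma normv_plane (z : R[i]^o) : normv (plane_of_complex z) = nrm z.
Proof.
rewrite /normv dotv_plane mulJ/= sqrtr_sqr ger0_norm//; exact: nrm_ge0.
Qed.

Lemma plane_of_complexB (z w : R[i]^o) :
  plane_of_complex (z - w) = plane_of_complex z - plane_of_complex w.
Proof.
apply/rowP => i; rewrite !mxE; case: ifP => _; first by rewrite Re_add Re_opp.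
by rewrite Im_add Im_opp.
Qed.

Definition complex_of_plane (u : 'rV[R]_2) : R[i] := Complex (u 0 0) (u 0 1).

Lemma complex_of_planeK u : plane_of_complex (complex_of_plane u) = u.
Proof.
by apply/rowP => i; rewrite !mxE; case: i => -[|[|]]//= h; congr (u _ _); exact/val_inj.
Qed.

Lemma plane_of_complexK (z : R[i]) : complex_of_plane (plane_of_complex z) = z.
Proof. by case: z => x y; rewrite /complex_of_plane !mxE. Qed.

Lemma angle_lt_cone (k : R) (z w : R[i]) : 0 < k -> z != 0 -> w != 0 ->
  angle (plane_of_complex z) (plane_of_complex w) < atan k ->
  cone k (z * w^*).
Proof.
move=> k0 z0 w0; rewrite /angle dotv_plane !normv_plane -(nrmJ w) -nrmM.
set y := z * _ => h; have y0 : 0 < nrm y by rewrite nrm_gt0 mulf_neq0// conjc_eq0.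
have := Re_le_nrm y; rewrite ler_norml => /andP[l1 l2].
have c1 : -1 <= Re y / nrm y <= 1.
  by rewrite ler_pdivlMr// ler_pdivrMr// mulN1r mul1r l1.
have pi0 := pi_gt0 R.
have := h; rewrite -ltr_cos ?in_itv/=; last 2 first.
- by rewrite acos_ge0// acos_lepi.
- have := @atan_ltpi2 R k; have := @lt_atan R _ _ k0; rewrite atan0 => ? ?.
  by apply/andP; split; lra.
rewrite acosK ?in_itv// cos_atan ltr_pdivlMr//.
have s0 : 0 < Num.sqrt (1 + k ^+ 2) by rewrite sqrtr_gt0; nra.
rewrite mulrC ltr_pdivrMr// => hc.
have k2 : 0 <= 1 + k ^+ 2 by nra.
have re0 : 0 < Re y by nra.
have : nrm y ^+ 2 < (Re y * Num.sqrt (1 + k ^+ 2)) ^+ 2.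
  by rewrite ltr_pXn2r ?nnegrE// ltW// mulr_gt0.
rewrite exprMn sqr_sqrtr// nrm_sqr => h2; rewrite /cone.
rewrite -(ler_pXn2r (ltn0Sn 1)) ?nnegrE//; last by rewrite mulr_ge0// ltW.
rewrite real_normK ?num_real//; apply: ltW; nra.
Qed.

(** Thinness lets the arc meet [K] at its two endpoints, hence the last clause. *)
Lemma thin_arc K (k : R) (a b : R[i]) : 0 < k ->
  Lipschitz_thin (@plane_of_complex R @` K) -> a != b ->
  exists (a0 b0 : R) (g : R -> R[i]), [/\ a0 < b0, g a0 = a, g b0 = b,
    forall t, a0 <= t <= b0 -> forall e : R, 0 < e -> exists2 d : R, 0 < d &
     forall s, a0 <= s <= b0 -> `|s - t| < d -> nrm (g s - g t) < e &
    (forall t s, a0 <= t -> t < s -> s <= b0 ->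
     g s != g t /\ cone k ((g s - g t) * (g b0 - g a0)^*)) /\
    (forall t, a0 <= t <= b0 -> K (g t) -> g t = a \/ g t = b)].
Proof.
move=> k0 thin ab; have e0 : 0 < atan k by rewrite -atan0; exact: lt_atan.
have ab' : plane_of_complex a != plane_of_complex b.
  by apply: contra ab => /eqP e; rewrite -(plane_of_complexK a) e plane_of_complexK.
have [a0 [b0 [gam [lt0 ga gb [cg ag] dis]]]] := thin _ e0 _ _ ab'.
have gE t : gam t = plane_of_complex (complex_of_plane (gam t)).
  by rewrite complex_of_planeK.
exists a0, b0, (fun t => complex_of_plane (gam t)); split=> //.
- by rewrite ga plane_of_complexK.
- by rewrite gb plane_of_complexK.
- move=> t tab e e_gt0; have tI : `[a0, b0]%classic t by rewrite /= in_itv.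
  have /subspace_continuousP/(_ _ tI) cgt := cg.
  have ci j : gam s 0 j @[s --> within `[a0, b0] (nbhs t)] --> gam t 0 j.
    by apply: (cvg_comp gam (fun M : 'rV[R]_2 => M 0 j) cgt); exact: coord_continuous.
  have e2 : 0 < e / 2 by rewrite divr_gt0.
  have FF : Filter (within `[a0, b0] (nbhs t)) by exact: within_filter.
  have /cvgrPdist_lt/(_ _ e2) h0 := ci 0.
  have /cvgrPdist_lt/(_ _ e2) h1 := ci 1.
  have := @filterI _ _ FF _ _ h0 h1; move=> /nbhs_ballP[d d0 hd].
  exists d => // s sab std; have sI : `[a0, b0]%classic s by rewrite /= in_itv.
  have [] := hd s _ sI; first by rewrite -ball_normE /= distrC.
  move=> l0 l1; rewrite /= distrC in l0; rewrite /= distrC in l1.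
  have := nrm_le_Re_Im (complex_of_plane (gam s) - complex_of_plane (gam t)).
  rewrite [X in `|X| + _]/= [X in _ + `|X|]/=. lra.
split=> [t s t0 ts s1|t tab Kt].
- have [n0 n1 ang] := ag t s t0 ts s1.
  have gn : complex_of_plane (gam s) != complex_of_plane (gam t).
    by apply: contra n0 => /eqP e; rewrite gE [gam t]gE e subrr.
  split=> //; apply: angle_lt_cone => //; first by rewrite subr_eq0.
    by rewrite subr_eq0; apply: contra n1 => /eqP e; rewrite gE [gam a0]gE e subrr.
  by rewrite !plane_of_complexB -!gE.
have [ea|na] := pselect (complex_of_plane (gam t) = a); first by left.
have [eb|nb] := pselect (complex_of_plane (gam t) = b); first by right.
exfalso; have : set0 (gam t).
  rewrite -dis; split; first by exists t => //; rewrite /= in_itv.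
  split; first by exists (complex_of_plane (gam t)).
  by case=> e; [apply: na|apply: nb]; rewrite e plane_of_complexK.
by [].
Qed.

(** An arc issuing from [z] never returns to an endpoint, so its points just after the start are
    close to [z] and outside [K]. *)
Lemma thin_compl_dense K : Lipschitz_thin (@plane_of_complex R @` K) ->
  forall z (e : R), 0 < e -> exists2 w, ~ K w & nrm (w - z) < e.
Proof.
move=> thin z e e0; have zz1 : z != z + 1.
  by rewrite eq_sym -subr_eq0 addrC addKr oner_eq0.
have [a0 [b0 [g [ab ga gb cg [inc hK]]]]] := thin_arc ltr01 thin zz1.
have [d d0 hd] := cg a0 (introT andP (conj (lexx _) (ltW ab))) e e0.
pose s := Num.min ((a0 + b0) / 2) (a0 + d / 2).
have s1 : a0 < s by rewrite lt_min; apply/andP; split; lra.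
have s2 : s <= (a0 + b0) / 2 by rewrite ge_min lexx.
have s3 : s <= a0 + d / 2 by rewrite ge_min lexx orbT.
have sb : s < b0 by lra.
have sab : a0 <= s <= b0 by apply/andP; split; exact: ltW.
exists (g s); last by rewrite -ga; apply: hd => //; rewrite gtr0_norm ?subr_gt0//; lra.
move=> /(hK _ sab)[e1|e1].
  by have [] := inc a0 s (lexx _) s1 (ltW sb); rewrite ga e1 eqxx.
by have [] := inc s b0 (ltW s1) sb (lexx _); rewrite gb e1 eqxx.
Qed.

(** Both endpoints are outside [K], so the whole arc is, and [cone_increment] applies along it. *)
Lemma thin_sectorial K (f f' : R[i] -> R[i]) (k : R) : 0 < k ->
  Lipschitz_thin (@plane_of_complex R @` K) ->
  (forall z, ~ K z -> cderiv f z (f' z)) ->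
  (forall z, ~ K z -> f' z != 0 /\ cone k (f' z)) ->
  sectorial (2 * k + 3) (~` K) f.
Proof.
move=> k0 thin df cf a b Ka Kb; have [->|ab] := eqVneq a b.
  by rewrite subrr mul0r; exact: cone0.
have h0 : 0 < (2 * k + 1)^-1 by rewrite invr_gt0; lra.
have [a0 [b0 [g [lt0 ga gb cg [inc hK]]]]] := thin_arc h0 thin ab.
rewrite -ga -gb; apply: (cone_increment (D := ~` K) k0 lt0 df cf) => //.
by move=> t tab Kt; case: (hK t tab Kt) => e; move: Kt; rewrite e.
Qed.

End Interface.

(** * Extension across the exceptional set *)

Section Extension.
Variable R : realType.
Implicit Types (a b z w p v : R[i]) (k e d t s : R) (F : R[i] -> R[i]).

Definition ccontinuous F := forall z e, 0 < e -> exists2 d, 0 < d &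
  forall w, nrm (w - z) < d -> nrm (F w - F z) < e.

Lemma cone_closed k z : 0 < k ->
  (forall e, 0 < e -> exists2 w, cone k w & nrm (w - z) < e) -> cone k z.
Proof.
move=> k0 h; rewrite /cone leNgt; apply/negP => gap.
have k1 : 0 < 1 + k by lra.
(* Moving [z] by less than [e] changes [|Im z| - k * Re z] by less than (1 + k) e, which cannot
   close the gap. *)
pose e := (`|Im z| - k * Re z) / (1 + k).
have e0 : 0 < e by rewrite divr_gt0// subr_gt0.
have eE : e * (1 + k) = `|Im z| - k * Re z by rewrite /e divfK// gt_eqF.
have [w cw wz] := h e e0; rewrite /cone in cw.
have hr := le_lt_trans (Re_le_nrm _) wz; have hi := le_lt_trans (Im_le_nrm _) wz.
rewrite Re_add Re_opp in hr; rewrite Im_add Im_opp in hi.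
have : `|Im z| <= `|Im w| + `|Im w - Im z|.
  by have := ler_distD (Im w) (Im z) 0; rewrite !subr0 distrC; lra.
have : Re w <= Re z + e by move: hr; rewrite ltr_norml => /andP[_]; lra.
by move=> h1 h2; nra.
Qed.

Lemma mulJ_approx a b e : 0 < e -> exists2 d, 0 < d & forall z w,
  nrm (z - a) < d -> nrm (w - b) < d -> nrm (z * w^* - a * b^*) < e.
Proof.
move=> e0; pose M := nrm a + nrm b + 1.
have a0 := nrm_ge0 a; have b0 := nrm_ge0 b.
have M0 : 0 < M by rewrite /M; lra.
exists (Num.min 1 (e / M)); first by rewrite lt_min ltr01 divr_gt0.
move=> z w; rewrite !lt_min => /andP[z1 ze] /andP[w1 we].
have -> : z * w^* - a * b^* = (z - a) * w^* + a * (w - b)^*.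
  by rewrite raddfB/=; ring.
apply: le_lt_trans (nrmD _ _) _; rewrite !nrmM !nrmJ.
have wb : nrm w <= nrm b + 1.
  by have := nrmD (w - b) b; rewrite subrK; lra.
rewrite ltr_pdivlMr// in ze; rewrite ltr_pdivlMr// in we.
have z0 := nrm_ge0 (z - a); have w0 := nrm_ge0 (w - b).
have : nrm (z - a) * nrm w <= nrm (z - a) * (nrm b + 1) by rewrite ler_wpM2l.
rewrite /M in ze we *.
have [->|an0] := eqVneq (nrm a) 0.
  rewrite mul0r addr0; have := nrm_ge0 a; nra.
have : 0 < nrm a by rewrite lt0r an0.
move=> a1 h.
have : (nrm (z - a) * nrm w + nrm a * nrm (w - b)) * (nrm a + nrm b + 1) <
    e * (nrm a + nrm b + 1).
  nra.
by rewrite ltr_pM2r.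
Qed.

Section Dense.
Variables (k : R) (D : set R[i]) (f : R[i] -> R[i]).

(** Take points of [D] near [z - 1] and [z + 1]: everything near [z] is close to their midpoint, and
    [sectorial_midpoint] bounds [f] there. *)
Lemma sectorial_locally_bounded z : 0 < k -> sectorial k D f ->
  (forall z e, 0 < e -> exists2 w, D w & nrm (w - z) < e) ->
  exists d M, [/\ 0 < d, 0 < M & forall w, D w -> nrm (w - z) < d -> nrm (f w) <= M].
Proof.
(* Chosen so that (2k+1) 2h <= 1 - h: here 2h bounds the distance to the midpoint, and 1 - h is a
   lower bound for half the distance of [a] and [b]. *)
move=> k0 sf dD; pose h : R := (4 * k + 3)^-1.
have h0 : 0 < h by rewrite invr_gt0; lra.
have hE : h * (4 * k + 3) = 1 by rewrite mulVf// gt_eqF//; lra.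
have [a Da ha] := dD (z - 1) h h0; have [b Db hb] := dD (z + 1) h h0.
exists h, ((1 + k) * nrm (f b - f a) + nrm (f a) + 1); split=> //.
  have := nrm_ge0 (f a).
  have : 0 <= (1 + k) * nrm (f b - f a) by rewrite mulr_ge0 ?nrm_ge0//; lra.
  by lra.
move=> w Dw wz.
have two : (2%:R : R[i]) != 0 by rewrite pnatr_eq0.
pose d := (b - a) / 2%:R; pose m := (a + b) / 2%:R.
have half (u : R[i]) : nrm (u / 2%:R) = nrm u / 2.
  have -> : (2%:R : R[i]) = ((2:R)%:C)%C by rewrite rmorph_nat.
  by rewrite nrmM Normc.normcV nrm_real ger0_norm.
have aE : a = m - d by rewrite /m /d; field.
have bE : b = m + d by rewrite /m /d; field.
have nd : 1 - h <= nrm d.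
  have -> : d = 1 + ((b - (z + 1)) - (a - (z - 1))) / 2%:R by rewrite /d; field.
  set u := _ / _; have : nrm u <= h.
    rewrite half ler_pdivrMr//; have := nrmD (b - (z + 1)) (- (a - (z - 1))).
    by rewrite nrmN; lra.
  by have := nrmD (1 + u) (- u); rewrite addrK nrmN nrm1; lra.
have nm : nrm (w - m) <= 2 * h.
  have -> : w - m = (w - z) + - (((b - (z + 1)) + (a - (z - 1))) / 2%:R).
    by rewrite /m; field.
  have := nrmD (w - z) (- (((b - (z + 1)) + (a - (z - 1))) / 2%:R)).
  rewrite nrmN half; have := nrmD (b - (z + 1)) (a - (z - 1)); lra.
have : nrm (f w - f a) <= (1 + k) * nrm (f b - f a).
  rewrite {1 2}aE {1}bE; apply: (sectorial_midpoint k0 sf) => //; first by rewrite -aE.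
    by rewrite -bE.
  apply: le_trans nd; apply: (@le_trans _ _ ((2 * k + 1) * (2 * h))); last lra.
  by rewrite ler_wpM2l//; lra.
by have := nrmD (f w - f a) (f a); rewrite subrK; lra.
Qed.

(** The values of [f] near [z] lie in a compact square, so the filter they generate has a cluster
    point. *)
Lemma sectorial_cluster z : 0 < k -> sectorial k D f ->
  (forall z e, 0 < e -> exists2 w, D w & nrm (w - z) < e) ->
  exists v, forall e, 0 < e -> exists w, [/\ D w, nrm (w - z) < e & nrm (f w - v) < e].
Proof.
move=> k0 sf dD; have [d [M [d0 M0 hM]]] := sectorial_locally_bounded z k0 sf dD.
pose B e := [set (Re (f w), Im (f w)) | w in [set w | D w /\ nrm (w - z) < e]].
pose G := filter_from [set e : R | 0 < e] B.
have GF : ProperFilter G.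
  apply: filter_from_proper; last first.
    by move=> e /= e0; have [w Dw wz] := dD z e e0; exists (Re (f w), Im (f w)), w.
  apply: filter_from_filter; first by exists 1 => /=.
  move=> i j /= i0 j0; exists (Num.min i j); first by rewrite /= lt_min i0.
  by move=> _ [w [Dw +] <-]; rewrite lt_min => /andP[wi wj]; split; exists w.
have cpt : compact (`[- M, M]%classic `*` `[- M, M]%classic : set (R * R)).
  by apply: compact_setX; exact: segment_compact.
have GM : G (`[- M, M]%classic `*` `[- M, M]%classic).
  exists d => // _ [w [Dw wz] <-]; have hw := hM _ Dw wz.
  by split; rewrite /= in_itv/= -ler_norml; apply: le_trans hw;
    [exact: Re_le_nrm|exact: Im_le_nrm].
have [[x y] [_ cl]] := cpt G GF GM.
exists (Complex x y) => e e0; have e2 : 0 < e / 2 by rewrite divr_gt0.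
have Be : G (B e) by exists e.
have nb : nbhs (x, y) (ball (x, y) (e / 2)) by exact: nbhsx_ballx.
have [[x' y'] [[w [Dw wz] [wx wy]] [/= bx by_]]] := cl _ _ Be nb.
exists w; split=> //; move: bx by_; rewrite -!ball_normE /= -wx -wy => bx by_.
apply: le_lt_trans (nrm_le_Re_Im _) _; rewrite Re_add Re_opp Im_add Im_opp/=.
by rewrite distrC [`|Im _ - _|]distrC; lra.
Qed.

(** Any choice of cluster values outside [D] will do: the sector is closed, so the condition passes
    to the limit for each pair of points. Continuity is a consequence of the sector condition and
    comes later. *)
Lemma sectorial_extension : 0 < k -> sectorial k D f ->
  (forall z e, 0 < e -> exists2 w, D w & nrm (w - z) < e) ->
  exists2 F, (forall z, D z -> F z = f z) & sectorial k setT F.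
Proof.
move=> k0 sf dD.
have ex z : exists v, (D z -> v = f z) /\ forall e, 0 < e ->
    exists w, [/\ D w, nrm (w - z) < e & nrm (f w - v) < e].
  have [Dz|nDz] := pselect (D z).
    by exists (f z); split=> // e e0; exists z; rewrite !subrr nrm0.
  by have [v hv] := sectorial_cluster z k0 sf dD; exists v.
have [F hF] := choice ex; exists F => [z|]; first by have [] := hF z.
move=> a b _ _; apply: cone_closed => // e e0.
have [d d0 hd] := mulJ_approx (F b - F a) (b - a) e0.
have d2 : 0 < d / 2 by rewrite divr_gt0.
have [a' [Da' aa' fa']] := (hF a).2 _ d2; have [b' [Db' bb' fb']] := (hF b).2 _ d2.
exists ((f b' - f a') * (b' - a')^*); first exact: sf.
have sub (u v u' v' : R[i]) : nrm (u - u') < d / 2 -> nrm (v - v') < d / 2 ->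
    nrm ((v - u) - (v' - u')) < d.
  move=> h1 h2; have -> : (v - u) - (v' - u') = (v - v') - (u - u') by ring.
  by have := nrmD (v - v') (- (u - u')); rewrite nrmN; lra.
by apply: hd; exact: sub.
Qed.

End Dense.

Section Total.
Variables (k : R) (F : R[i] -> R[i]).
Hypotheses (k0 : 0 < k) (sF : sectorial k setT F).

Lemma sectorial_real_step z t : 0 < t ->
  nrm (F (z + (t%:C)%C) - F z) <= (1 + k) * Re (F (z + (t%:C)%C) - F z).
Proof.
move=> t0; apply: cone_nrm => //.
have := sF (I : setT z) (I : setT (z + (t%:C)%C)).
have -> : (z + (t%:C)%C - z)^* = (t%:C)%C by rewrite addrAC subrr add0r/= oppr0.
move=> /(coneZ (ltW (_ : 0 < t^-1))); rewrite invr_gt0 => /(_ t0).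
by rewrite mulrCA -rmorphM/= mulVf ?gt_eqF// mulr1.
Qed.

(* The dyadic increments of [F] to the right of [p] all dominate the
   oscillation of [F] at [p], and their real parts add up. *)
Lemma sectorial_continuous : ccontinuous F.
Proof.
(* Both [p] and [z] are within twice the distance |x n - x n.+1| of [x n.+1], so the ratio 3 is
   ample. *)
have [L L0 hL] := sectorial_quasisymmetric k0 sF 3.
have k1 : 0 < 1 + k by apply: addr_gt0.
move=> p e e0; pose x n := p + (((2^-1 : R) ^+ n)%:C)%C.
have h0 n : 0 < (2^-1 : R) ^+ n by rewrite exprn_gt0// invr_gt0.
have hS n : (2^-1 : R) ^+ n = 2 * 2^-1 ^+ n.+1 by rewrite exprS mulrA divff// mul1r.
have step J z n : nrm (z - p) < 2^-1 ^+ J -> (n <= J)%N ->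
    n%:R * nrm (F z - F p) <= (1 + k) * (2 * L) * Re (F (x 0) - F (x n)).
  move=> hz; elim: n => [|n IHn] nJ; first by rewrite mul0r subrr /= mulr0.
  have {}IHn := IHn (ltnW nJ).
  have xx : x n = x n.+1 + (((2^-1 : R) ^+ n.+1)%:C)%C.
    by rewrite /x -addrA -rmorphD/= hS mulr2n mulrDl mul1r.
  have d1 : nrm (x n - x n.+1) = 2^-1 ^+ n.+1.
    by rewrite xx addrAC subrr add0r nrm_real ger0_norm// ltW.
  have hJ : (2^-1 : R) ^+ J <= 2^-1 ^+ n.+1.
    by apply: ler_wiXn2l => //; rewrite ?invr_ge0// invf_le1// ler1n.
  have px : nrm (p - x n.+1) = 2^-1 ^+ n.+1.
    by rewrite /x opprD addrA subrr add0r nrmN nrm_real ger0_norm// ltW.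
  have hzx : nrm (F z - F (x n.+1)) <= L * nrm (F (x n) - F (x n.+1)).
    apply: hL; rewrite d1; have := nrm_triangle z (x n.+1) p; rewrite px.
    by have := h0 n.+1; lra.
  have hpx : nrm (F p - F (x n.+1)) <= L * nrm (F (x n) - F (x n.+1)).
    by apply: hL; rewrite d1 px; have := h0 n.+1; lra.
  have := sectorial_real_step (x n.+1) (h0 n.+1); rewrite -xx => hr.
  have := nrm_triangle (F z) (F p) (F (x n.+1)).
  rewrite [nrm (F (x n.+1) - _)]nrm_distC => hzp.
  have hL2 : 2 * L * nrm (F (x n) - F (x n.+1)) <=
      2 * L * ((1 + k) * Re (F (x n) - F (x n.+1))).
    by rewrite ler_wpM2l//; lra.
  have -> : F (x 0) - F (x n.+1) = (F (x 0) - F (x n)) + (F (x n) - F (x n.+1)) by ring.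
  rewrite Re_add -natr1; lra.
(* The telescoped sum is bounded by [M], which does not depend on [J], so [J] times the increment at
   [z] is at most [M]. *)
pose M := (1 + k) * (2 * L) * Re (F (x 0) - F p).
have [J hJ] : exists J : nat, `|M| + 1 < J%:R * e.
  exists (Num.bound ((`|M| + 1) / e)); rewrite -ltr_pdivrMr// archi_boundP//.
  by rewrite divr_ge0 ?(ltW e0)// addr_ge0.
exists (2^-1 ^+ J); first exact: h0.
move=> z hz; have := step J z J hz (leqnn _).
have : Re (F (x 0) - F (x J)) <= Re (F (x 0) - F p).
  have := sectorial_real_step p (h0 J); rewrite -/(x J) => hr.
  have : 0 <= Re (F (x J) - F p).
    by have := le_trans (nrm_ge0 _) hr; rewrite pmulr_rge0.
  by rewrite !Re_add !Re_opp; lra.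
have C0 : 0 <= (1 + k) * (2 * L).
  by have := k1; have := L0; nra.
move=> /(ler_wpM2l C0) h h2; have := le_trans h2 h; rewrite -/M => hM.
have J0 : (0 : R) <= J%:R by [].
have MM := ler_norm M; rewrite ltNge; apply/negP => le.
have : J%:R * e <= J%:R * nrm (F z - F p) by rewrite ler_wpM2l.
by lra.
Qed.

(** If [F] took one value at two points, quasisymmetry would make it constant on every disc, in
    particular on the unit disc about [p]; this contradicts the nonzero derivative there. *)
Lemma sectorial_injective p l : l != 0 -> cderiv F p l -> injective F.
Proof.
move=> l0 dF a b Fab; apply/eqP/contraT => ab.
have nl : 0 < nrm l by rewrite nrm_gt0.
have ba : 0 < nrm (b - a) by rewrite nrm_gt0 subr_eq0 eq_sym.
pose r := (nrm (p - a) + 1) / nrm (b - a).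
have [L L0 hL] := sectorial_quasisymmetric k0 sF r.
have cst z : nrm (z - p) <= 1 -> F z = F a.
  move=> zp; have := hL a b z; rewrite Fab subrr nrm0 mulr0 /r divfK ?gt_eqF//.
  have := nrm_triangle z a p => h1 /(_ (ltac:(lra))) h2; apply/eqP.
  by rewrite -subr_eq0 -nrm_eq0 eq_le nrm_ge0 h2.
have l2 : 0 < nrm l / 2 by rewrite divr_gt0.
have [d d0 hd] := dF _ l2; pose t := Num.min (d / 2) 1.
have t0 : 0 < t by rewrite lt_min divr_gt0/=.
have td : t <= d / 2 by rewrite ge_min lexx.
have t1 : t <= 1 by rewrite ge_min lexx orbT.
have := hd (p + (t%:C)%C); have -> : p + (t%:C)%C - p = (t%:C)%C by rewrite addrAC subrr add0r.
rewrite nrm_real gtr0_norm// => /(_ (ltac:(lra))).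
rewrite !cst ?subrr ?nrm0//; last by rewrite addrAC subrr add0r nrm_real gtr0_norm.
by rewrite sub0r nrmN nrmM nrm_real gtr0_norm// ler_pM2r// => h; exfalso; clear -h nl; lra.
Qed.

End Total.
End Extension.

(** * Images of boxes and area *)

Section BoxImage.
Variable R : realType.
Implicit Types (z p v : R[i]) (k e d t s : R) (F : R[i] -> R[i]).

Lemma ccontinuous_comp_plane F (g : R[i] -> R) : ccontinuous F ->
  (forall z w, `|g z - g w| <= nrm (z - w)) ->
  continuous (fun q : R * R => g (F (Complex q.1 q.2))).
Proof.
move=> cF hg q; apply/cvgrPdist_lt => e e0.
have [d d0 hd] := cF (Complex q.1 q.2) e e0.
apply/(@nbhs_ballP R (R * R)%type); exists (d / 2) => /=; first by rewrite divr_gt0.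
move=> q' [/=]; rewrite -!ball_normE /= => h1 h2.
apply: le_lt_trans (hg _ _) _; rewrite nrm_distC; apply: hd.
apply: le_lt_trans (nrm_le_Re_Im _) _; rewrite /= distrC [`|q'.2 - _|]distrC.
by lra.
Qed.

Definition box (x0 x1 y0 y1 : R) : set R[i] :=
  [set z | x0 < Re z < x1 /\ y0 < Im z < y1].

Section Total.
Variables (k : R) (F : R[i] -> R[i]).
Hypotheses (k0 : 0 < k) (sF : sectorial k setT F) (iF : injective F).

(* A nearest point of the image of the closed box to [v] is [v] itself: the
   image of a direction can be used to get closer to [v]. *)
Lemma sectorial_box_image (L r w h : R) p v :
  0 < L -> 0 < w -> 0 < h -> 1 <= r -> w <= r * h ->
  (forall a b z : R[i], nrm (z - a) <= r * nrm (b - a) ->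
     nrm (F z - F a) <= L * nrm (F b - F a)) ->
  nrm (v - F p) < nrm (F (p + (w%:C)%C) - F p) / (2 * L) ->
  exists2 z, box (Re p - w) (Re p + w) (Im p - h) (Im p + h) z & F z = v.
Proof.
move=> L0 w0 h0 r1 wrh hL hv; have cF := sectorial_continuous k0 sF.
pose psi (q : R * R) := nrm (F (Complex q.1 q.2) - v).
have cpsi : continuous psi.
  apply: (@ccontinuous_comp_plane F (fun z => nrm (z - v)) cF) => a b.
  have := nrmD (a - b) (b - v); have := nrmD (b - a) (a - v).
  rewrite !addrA !subrK [nrm (b - a)]nrm_distC ler_norml => ? ?.
  by apply/andP; split; lra.
pose A : set (R * R) := `[Re p - w, Re p + w]%classic `*` `[Im p - h, Im p + h]%classic.
have Ap : A (Re p, Im p) by split; rewrite /= in_itv/=; apply/andP; split; lra.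
have A0 : A !=set0 by exists (Re p, Im p).
have cA : compact A by apply: compact_setX; exact: segment_compact.
have [c cinA cmin] := compact_EVT_min A0 cA (continuous_subspaceT cpsi).
pose z := Complex c.1 c.2.
have Ac : A c by move: cinA; rewrite inE.
have pE : Complex (Re p) (Im p) = p by case: (p).
have zp : nrm (F z - v) <= nrm (F p - v).
  by have := cmin (Re p, Im p); rewrite inE => /(_ Ap); rewrite /psi/= pE.
case: Ac; rewrite /= !in_itv/= => /andP[c1 c2] /andP[c3 c4].
(* Quasisymmetry read backwards: at such a [z] the value [F z] is more than twice as far from [F p]
   as [v] is, so [p] would be a strictly better candidate than [z]. Points on the sides of the box
   satisfy the inequality because [1 <= r] and [w <= r * h]. *)
have inner : w <= r * nrm (z - p) -> False.
  move=> hz; have := hL p z (p + (w%:C)%C).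
  rewrite [p + _]addrC addrK nrm_real gtr0_norm// => /(_ hz); rewrite addrC => h1.
  have := nrm_triangle (F z) (F p) v.
  move: hv; rewrite ltr_pdivlMr; last by rewrite mulr_gt0.
  by rewrite [nrm (F p - v)]nrm_distC in zp *; nra.
have rez : w <= `|c.1 - Re p| -> False.
  move=> hz; apply: inner; have := Re_le_nrm (z - p).
  have -> : Re (z - p) = c.1 - Re p by rewrite Re_add Re_opp.
  move=> h1; have : 0 <= nrm (z - p) := nrm_ge0 _; nra.
have imz : h <= `|c.2 - Im p| -> False.
  move=> hz; apply: inner; have := Im_le_nrm (z - p).
  have -> : Im (z - p) = c.2 - Im p by rewrite Im_add Im_opp.
  move=> h1; apply: le_trans wrh _; rewrite ler_wpM2l//; lra.
have rez' : `|c.1 - Re p| < w by rewrite ltNge; apply/negP.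
have imz' : `|c.2 - Im p| < h by rewrite ltNge; apply/negP.
exists z.
  move: rez' imz'; rewrite !ltr_norml /box/= => /andP[? ?] /andP[? ?].
  by split; apply/andP; split; lra.
(* Move [z] a little in the direction [e]. The change [u] of [F] is nonzero by injectivity,
   satisfies |u| |e| <= (1 + k) Re (u conj e), and is shorter than |e| / (1 + k) by continuity.
   Expanding the square gives |u - e| < |e|, against minimality. *)
apply/eqP/contraT => nv; pose e := v - F z.
have e0 : 0 < nrm e by rewrite nrm_gt0 subr_eq0 eq_sym.
have [d d0 hd] := cF z (nrm e / (1 + k)) (ltac:(by rewrite divr_gt0// addr_gt0)).
pose m := Num.min (w - `|c.1 - Re p|) (h - `|c.2 - Im p|).
have m0 : 0 < m by rewrite lt_min !subr_gt0 rez'.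
pose t := Num.min m d / (2 * nrm e).
have md0 : 0 < Num.min m d by rewrite lt_min m0.
have t0 : 0 < t by rewrite divr_gt0// mulr_gt0.
have tE : t * nrm e = Num.min m d / 2 by rewrite /t invfM mulrA divfK// gt_eqF.
pose z' := z + (t%:C)%C * e.
have zz' : nrm (z' - z) = Num.min m d / 2.
  by rewrite /z' [z + _]addrC addrK nrmM nrm_real gtr0_norm.
have md : Num.min m d <= d by rewrite ge_min lexx orbT.
have mm : Num.min m d <= m by rewrite ge_min lexx.
have m1 : m <= w - `|c.1 - Re p| by rewrite ge_min lexx.
have m2 : m <= h - `|c.2 - Im p| by rewrite ge_min lexx orbT.
pose u := F z' - F z.
have u1 : nrm u < nrm e / (1 + k) by apply: hd; rewrite zz'; lra.
have u0 : 0 < nrm u.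
  rewrite nrm_gt0 subr_eq0; apply/eqP => /iF /eqP; rewrite -subr_eq0 -nrm_eq0 zz'.
  by rewrite gt_eqF// divr_gt0.
have cu : nrm u * nrm e <= (1 + k) * Re (u * e^*).
  rewrite -(nrmJ e) -nrmM; apply: cone_nrm => //.
  have := sF (I : setT z) (I : setT z'); rewrite -/u.
  have -> : (z' - z)^* = (t%:C)%C * e^*.
    by rewrite /z' [z + _]addrC addrK rmorphM/= oppr0.
  move=> /(coneZ (ltW (_ : 0 < t^-1))); rewrite invr_gt0 => /(_ t0).
  by rewrite mulrCA [(_%:C)%C * _]mulrA -rmorphM/= mulVf ?gt_eqF// mul1r.
have A' : A (Re z', Im z').
  have := Re_le_nrm (z' - z); have := Im_le_nrm (z' - z); rewrite zz'.
  rewrite Re_add Re_opp Im_add Im_opp [Re z]/= [Im z]/= => hi hr.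
  have := ler_distD (c.1) (Re z') (Re p); have := ler_distD (c.2) (Im z') (Im p).
  move=> hi2 hr2.
  have : `|Re z' - Re p| <= w by lra.
  have : `|Im z' - Im p| <= h by lra.
  rewrite !ler_norml => /andP[l1 l2] /andP[l3 l4].
  by clear -l1 l2 l3 l4; split; rewrite /= in_itv/=; apply/andP; split; lra.
have := cmin (Re z', Im z'); rewrite inE => /(_ A'); rewrite /psi/=.
have -> : Complex (Re z') (Im z') = z' by case: (z').
rewrite leNgt -/z => /negP; case.
have -> : F z' - v = u - e by rewrite /u /e; ring.
have -> : nrm (F z - v) = nrm e by rewrite nrm_distC.
rewrite -(ltr_pXn2r (ltn0Sn 1)) ?nnegrE ?nrm_ge0//.
have -> : nrm (u - e) ^+ 2 = nrm u ^+ 2 - 2 * Re (u * e^*) + nrm e ^+ 2.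
  by rewrite !nrm_sqr Re_mul Re_conjc Im_conjc Re_add Im_add Re_opp Im_opp; ring.
rewrite ltr_pdivlMr ?addr_gt0// in u1.
have k1 : 0 < 1 + k by apply: addr_gt0.
have : nrm u * ((1 + k) * nrm u) < (1 + k) * Re (u * e^*) by nra.
by rewrite mulrCA ltr_pM2l// => h1; have := mulr_gt0 u0 u0; nra.
Qed.

(** Pairs of reals are the space on which [area] lives; with the identity for [F] this is the set
    [U] itself seen there. *)
Definition image_set (U : set R[i]) : set (R * R) :=
  [set (Re (F z), Im (F z)) | z in U].

Lemma image_set_box_open x0 x1 y0 y1 : open (image_set (box x0 x1 y0 y1)).
Proof.
have [L L0 hL] := sectorial_quasisymmetric k0 sF 1.
rewrite openE => _ [p [/andP[a1 a2] /andP[a3 a4]] <-].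
pose d1 := Num.min (Re p - x0) (x1 - Re p); pose d2 := Num.min (Im p - y0) (y1 - Im p).
pose d := Num.min d1 d2.
have d0 : 0 < d by rewrite !lt_min !subr_gt0 a1 a2 a3.
have : d <= d1 by rewrite ge_min lexx.
have : d <= d2 by rewrite ge_min lexx orbT.
rewrite !le_min => /andP[b1 b2] /andP[b3 b4].
have im := sectorial_box_image (p := p) L0 d0 d0 (lexx 1) (ltac:(by rewrite mul1r)) hL.
set rho := nrm _ / _ in im.
have rho0 : 0 < rho.
  rewrite divr_gt0 ?mulr_gt0// nrm_gt0 subr_eq0; apply/eqP => /iF/eqP.
  by rewrite -subr_eq0 addrAC subrr add0r -nrm_eq0 nrm_real gtr0_norm// gt_eqF.
(* Balls of pairs are squares, and [nrm] is at most the sum of the two coordinates. *)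
apply/nbhs_ballP; exists (rho / 2) => /=; first by rewrite divr_gt0.
move=> [x y] [/=]; rewrite -!ball_normE /= => h1 h2.
have [z [/andP[? ?] /andP[? ?]] Fz] : exists2 z,
    box (Re p - d) (Re p + d) (Im p - d) (Im p + d) z & F z = Complex x y.
  apply: im; apply: le_lt_trans (nrm_le_Re_Im _) _.
  by rewrite Re_add Im_add Re_opp Im_opp/= distrC [`|y - _|]distrC; lra.
by exists z; [split; apply/andP; split; lra|rewrite Fz].
Qed.

End Total.
End BoxImage.

(** * Area of boxes and open sets of the plane *)

Section PlaneArea.
Variable R : realType.

Local Notation plane := (measurableTypeR R * measurableTypeR R)%type.

Definition area : set plane -> \bar R :=
  (@lebesgue_measure R \x @lebesgue_measure R)%E.

Lemma area_box (a b c d : R) : a <= b -> c <= d ->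
  area (`]a, b[%classic `*` `]c, d[%classic) = ((b - a) * (d - c))%:E.
Proof.
move=> ab cd; rewrite /area product_measure1E; [|exact: measurable_itv..].
have len (x y : R) : x <= y -> lebesgue_measure (`]x, y[%classic : set R) = (y - x)%:E.
  move=> xy; rewrite lebesgue_measure_itv/= lte_fin; case: ifPn => [_|].
    by rewrite -EFinB.
  by rewrite -leNgt => yx; have -> : y = x by [apply/le_anti/andP]; rewrite subrr.
by rewrite EFinM; congr (_ * _)%E; exact: len.
Qed.

(** The sigma-algebra is that of the product, so an open set is written as a countable union of
    boxes with rational centres and radii 1/(n+1), those not contained in it being replaced by the
    empty set. *)
Lemma open_measurable_plane (A : set plane) : open (A : set (R * R)) -> measurable A.
Proof.
move=> oA; pose B (i : rat * rat * nat) : set plane :=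
  `](ratr i.1.1 : R) - i.2.+1%:R^-1, ratr i.1.1 + i.2.+1%:R^-1[%classic `*`
  `](ratr i.1.2 : R) - i.2.+1%:R^-1, ratr i.1.2 + i.2.+1%:R^-1[%classic.
have -> : A = \bigcup_i (if pselect (B i `<=` A) then B i else set0).
  rewrite eqEsubset; split=> [[x y] Axy|q [i _]]; last by case: pselect => // h /h.
  move: (oA); rewrite openE => /(_ _ Axy) /nbhs_ballP[e /= e0 he].
  have [n hn] : exists n : nat, 2 / e < n.+1%:R.
    exists (Num.bound (2 / e)); apply: lt_trans (_ : (Num.bound (2 / e))%:R < _).
      by rewrite archi_boundP// divr_ge0// ltW.
    by rewrite ltr_nat.
  have n0 : 0 < (n.+1%:R : R) by rewrite ltr0n.
  have i0 : 0 < (n.+1%:R^-1 : R) by rewrite invr_gt0.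
  have ne : 2 * n.+1%:R^-1 < e.
    by rewrite ltr_pdivrMr// mulrC -ltr_pdivrMr.
  have [r rE] : exists r : R, r = n.+1%:R^-1 by eexists.
  rewrite -rE in i0 ne.
  have xr : x < x + r by rewrite ltrDl.
  have yr : y < y + r by rewrite ltrDl.
  have [q1 hq1] := rat_in_itvoo xr; have [q2 hq2] := rat_in_itvoo yr.
  move: hq1 hq2; rewrite !in_itv/= => /andP[? ?] /andP[? ?].
  exists (q1, q2, n) => //; rewrite /B/= -rE; case: pselect => [h|[]].
    by split; rewrite /= in_itv/=; apply/andP; split; lra.
  move=> [x' y'] [/=]; rewrite !in_itv/= => /andP[? ?] /andP[? ?]; apply: he.
  by split; rewrite -ball_normE /= ltr_norml; apply/andP; split; lra.
apply: countable_bigcupT_measurable; first exact: countableP.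
move=> i; case: pselect => h; last exact: measurable0.
by apply: measurableX; exact: measurable_itv.
Qed.

Lemma area_ge0 (A : set plane) : (0 <= area A)%E.
Proof. exact: measure_ge0. Qed.

Lemma area_set0 : area set0 = 0%E.
Proof. exact: measure0. Qed.

Lemma area_bigcup_le (B : nat -> set plane) : (forall k, measurable (B k)) ->
  (area (\bigcup_k B k) <= \sum_(0 <= k <oo) area (B k))%E.
Proof.
move=> mB; apply: generalized_Boole_inequality => //.
exact: bigcupT_measurable.
Qed.

Lemma area_le (A B : set plane) : measurable A -> measurable B -> A `<=` B ->
  (area A <= area B)%E.
Proof. by move=> mA mB AB; apply: le_measure => //; rewrite inE. Qed.

Lemma area_superadditive (A A1 A2 A3 A4 : set plane) :
  measurable A -> measurable A1 -> measurable A2 -> measurable A3 -> measurable A4 ->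
  A1 `<=` A -> A2 `<=` A -> A3 `<=` A -> A4 `<=` A ->
  A1 `&` A2 = set0 -> A1 `&` A3 = set0 -> A1 `&` A4 = set0 ->
  A2 `&` A3 = set0 -> A2 `&` A4 = set0 -> A3 `&` A4 = set0 ->
  (area A < +oo)%E ->
  fine (area A1) + fine (area A2) + fine (area A3) + fine (area A4) <= fine (area A).
Proof.
move=> mA m1 m2 m3 m4 s1 s2 s3 s4 d12 d13 d14 d23 d24 d34 Aoo.
have fin B : measurable B -> B `<=` A -> area B \is a fin_num.
  move=> mB BA; rewrite ge0_fin_numE ?area_ge0//.
  by apply: le_lt_trans Aoo; exact: area_le.
have m12 : measurable (A1 `|` A2) by exact: measurableU.
have m123 : measurable (A1 `|` A2 `|` A3) by exact: measurableU.
have m1234 : measurable (A1 `|` A2 `|` A3 `|` A4) by exact: measurableU.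
have s12 : A1 `|` A2 `<=` A by rewrite subUset.
have s123 : A1 `|` A2 `|` A3 `<=` A by rewrite subUset.
have s1234 : A1 `|` A2 `|` A3 `|` A4 `<=` A by rewrite subUset.
have e12 : (area A1 + area A2 = area (A1 `|` A2))%E by rewrite /area [RHS]measureU.
have e123 : (area (A1 `|` A2) + area A3 = area (A1 `|` A2 `|` A3))%E.
  have d : (A1 `|` A2) `&` A3 = set0 by rewrite setIUl d13 d23 setU0.
  by rewrite /area [RHS]measureU.
have e1234 : (area (A1 `|` A2 `|` A3) + area A4 = area (A1 `|` A2 `|` A3 `|` A4))%E.
  have d : (A1 `|` A2 `|` A3) `&` A4 = set0 by rewrite !setIUl d14 d24 d34 !setU0.
  by rewrite /area [RHS]measureU.
rewrite -(fineD (fin _ m1 s1) (fin _ m2 s2)) e12.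
rewrite -(fineD (fin _ m12 s12) (fin _ m3 s3)) e123.
rewrite -(fineD (fin _ m123 s123) (fin _ m4 s4)) e1234.
by apply: fine_le; [exact: fin|exact: fin|exact: area_le].
Qed.

End PlaneArea.

#[global] Opaque area.

(** * Integrals of complex-valued functions *)

Section CurveIntegral.
Variable R : realType.
Implicit Types (z w v l m c : R[i]) (e d t s a b M : R) (F : R[i] -> R[i])
  (f g G H phi psi : R -> R[i]).

Local Notation cpx x := (x%:C)%C.

Definition rderiv G t l := forall e, 0 < e -> exists2 d, 0 < d &
  forall s, `|s - t| < d -> nrm (G s - G t - cpx (s - t) * l) <= e * `|s - t|.

Lemma rderiv_is_derive (g : R -> R) t (l : R) : is_derive t 1 g l ->
  rderiv (fun s => cpx (g s)) t (cpx l).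
Proof.
move=> [dg dgE] e e0.
have : h^-1 *: ((g \o shift t) (h *: (1 : R)) - g t) @[h --> (0:R)^'] --> l.
  by rewrite -dgE; exact: dg.
move=> /cvgrPdist_lt/(_ _ e0)/nbhs_ballP[d d0 hd]; exists d => // s st.
have [->|nst] := eqVneq s t; first by rewrite !subrr rmorph0 mul0r subr0 nrm0 normr0 mulr0.
have st0 : s - t != 0 by rewrite subr_eq0.
have sc : (s - t) *: (1 : R) + t = s by rewrite /GRing.scale/= mulr1 subrK.
have /ltW hle : `|l - (s - t)^-1 *: (g s - g t)| < e.
  by have := hd (s - t); rewrite -ball_normE /= sub0r normrN sc; apply.
have -> : cpx (g s) - cpx (g t) - cpx (s - t) * cpx l =
   cpx (- (s - t) * (l - (s - t)^-1 *: (g s - g t))).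
  rewrite -!rmorphB -rmorphM -rmorphB; congr (cpx _).
  have alg (h u v : R) : h != 0 -> u - h * v = - h * (v - h^-1 * u).
    by move=> h0; field.
  exact: alg.
by rewrite nrm_real normrM normrN mulrC ler_wpM2r.
Qed.

Lemma rderiv_cont f t l : rderiv f t l -> forall e, 0 < e ->
  exists2 d, 0 < d & forall s, `|s - t| < d -> nrm (f s - f t) < e.
Proof.
move=> df e e0; have [d d0 hd] := df 1 ltr01.
have n1 : 0 < nrm l + 2 by have := nrm_ge0 l; lra.
exists (Num.min d (e / (nrm l + 2))); first by rewrite lt_min d0 divr_gt0.
move=> s; rewrite lt_min ltr_pdivlMr// => /andP[sd se].
have := nrmD (f s - f t - cpx (s - t) * l) (cpx (s - t) * l).
rewrite subrK nrmM nrm_real => h; apply: le_lt_trans h _; apply: le_lt_trans se.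
have := hd s sd; have := normr_ge0 (s - t); nra.
Qed.

Lemma rderivD f g t l m : rderiv f t l -> rderiv g t m ->
  rderiv (fun s => f s + g s) t (l + m).
Proof.
move=> df dg e e0; have e2 : 0 < e / 2 by rewrite divr_gt0.
have [d d0 hd] := df _ e2; have [d' d'0 hd'] := dg _ e2.
exists (Num.min d d'); first by rewrite lt_min d0.
move=> s; rewrite lt_min => /andP[/hd h1 /hd' h2].
have -> : f s + g s - (f t + g t) - cpx (s - t) * (l + m) =
  (f s - f t - cpx (s - t) * l) + (g s - g t - cpx (s - t) * m) by ring.
by apply: le_trans (nrmD _ _) _; lra.
Qed.

Lemma rderiv_cst c t : rderiv (fun=> c) t 0.
Proof.
by move=> e e0; exists 1 => // s _; rewrite mulr0 !subrr nrm0 mulr_ge0// ltW.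
Qed.

Lemma rderiv_id t : rderiv (fun s => cpx s) t 1.
Proof.
move=> e e0; exists 1 => // s _.
by rewrite mulr1 rmorphB subrr nrm0 mulr_ge0// ltW.
Qed.

Lemma rderivM f g t l m : rderiv f t l -> rderiv g t m ->
  rderiv (fun s => f s * g s) t (l * g t + f t * m).
Proof.
move=> df dg e e0; pose K := nrm (f t) + nrm (g t) + nrm m + 2.
have f0 := nrm_ge0 (f t); have g0 := nrm_ge0 (g t); have m0 := nrm_ge0 m.
have K0 : 0 < K by rewrite /K; lra.
have eK : 0 < e / K by rewrite divr_gt0.
have [d d0 hd] := df _ eK; have [d' d'0 hd'] := dg _ eK.
have mK : 0 < Num.min 1 (e / K) by rewrite lt_min ltr01.
have [d2 d20 hd2] := rderiv_cont df mK.
exists (Num.min d (Num.min d' d2)); first by rewrite !lt_min d0 d'0.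
move=> s; rewrite !lt_min => /and3P[/hd h1 /hd' h2 /hd2].
rewrite lt_min => /andP[h3 h4].
have -> : f s * g s - f t * g t - cpx (s - t) * (l * g t + f t * m) =
  f s * (g s - g t - cpx (s - t) * m) + g t * (f s - f t - cpx (s - t) * l) +
  cpx (s - t) * m * (f s - f t) by ring.
have x0 := normr_ge0 (s - t).
have fs : nrm (f s) <= nrm (f t) + 1.
  by have := nrmD (f s - f t) (f t); rewrite subrK; lra.
have i1 : nrm (f s) * nrm (g s - g t - cpx (s - t) * m) <= (nrm (f t) + 1) * (e / K * `|s - t|).
  by apply: ler_pM => //; exact: nrm_ge0.
have i2 : nrm (g t) * nrm (f s - f t - cpx (s - t) * l) <= nrm (g t) * (e / K * `|s - t|).
  by apply: ler_wpM2l.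
have i3 : `|s - t| * nrm m * nrm (f s - f t) <= `|s - t| * nrm m * (e / K).
  by rewrite ler_wpM2l ?mulr_ge0// ltW.
have -> : e = e / K * K by rewrite divfK// gt_eqF.
have := nrmD (f s * (g s - g t - cpx (s - t) * m) + g t * (f s - f t - cpx (s - t) * l))
  (cpx (s - t) * m * (f s - f t)).
have := nrmD (f s * (g s - g t - cpx (s - t) * m)) (g t * (f s - f t - cpx (s - t) * l)).
rewrite !nrmM nrm_real /K in i1 i2 i3 *; set q := e / _ in i1 i2 i3 *.
have q0 : 0 < q by [].
have : 0 <= q * `|s - t| by rewrite mulr_ge0// ltW.
by lra.
Qed.

Lemma rderivZ c f t l : rderiv f t l -> rderiv (fun s => c * f s) t (c * l).
Proof.
move=> df; have := rderivM (rderiv_cst c t) df.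
by rewrite mul0r add0r.
Qed.

Lemma rderivB f g t l m : rderiv f t l -> rderiv g t m ->
  rderiv (fun s => f s - g s) t (l - m).
Proof.
move=> df dg; have := rderivD df (rderivZ (-1) dg); rewrite mulN1r.
by under [X in rderiv X]eq_fun do rewrite mulN1r.
Qed.

Lemma cderiv_comp F g t l m : cderiv F (g t) l -> rderiv g t m ->
  rderiv (fun s => F (g s)) t (l * m).
Proof.
move=> dF dg e e0; pose K := nrm l + nrm m + 2.
have l0 := nrm_ge0 l; have m0 := nrm_ge0 m.
have K0 : 0 < K by rewrite /K; lra.
have eK : 0 < Num.min 1 (e / K) by rewrite lt_min ltr01 divr_gt0.
have [d d0 hd] := dF _ eK; have [d' d'0 hd'] := dg _ eK.
have [d2 d20 hd2] := rderiv_cont dg d0.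
exists (Num.min d' d2); first by rewrite lt_min d'0.
move=> s; rewrite lt_min => /andP[/hd' h1 /hd2 /hd h2].
have -> : F (g s) - F (g t) - cpx (s - t) * (l * m) =
  (F (g s) - F (g t) - l * (g s - g t)) + l * (g s - g t - cpx (s - t) * m) by ring.
apply: le_trans (nrmD _ _) _; rewrite nrmM.
have q1 : Num.min 1 (e / K) <= 1 by rewrite ge_min lexx.
have q2 : Num.min 1 (e / K) * K <= e by rewrite -ler_pdivlMr// ge_min lexx orbT.
set q := Num.min _ _ in eK h1 h2 q1 q2 *; set x := `|s - t| in h1 *.
have x0 : 0 <= x by exact: normr_ge0.
have hg : nrm (g s - g t) <= (1 + nrm m) * x.
  have := nrmD (g s - g t - cpx (s - t) * m) (cpx (s - t) * m).
  have : q * x <= 1 * x by rewrite ler_wpM2r.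
  by rewrite subrK nrmM nrm_real -/x; lra.
apply: (@le_trans _ _ (q * ((1 + nrm m) * x) + nrm l * (q * x))).
  apply: lerD; first by apply: le_trans h2 _; rewrite ler_pM2l.
  exact: ler_wpM2l.
apply: (@le_trans _ _ (q * K * x)); last by rewrite ler_wpM2r.
have qx0 : 0 <= q * x by rewrite mulr_ge0// ltW.
by rewrite /K; lra.
Qed.

Lemma le_slack (x y c : R) : 0 <= c -> (forall e, 0 < e -> x <= y + e * c) -> x <= y.
Proof.
move=> c0 h; apply/ler_addgt0Pr => e e0; have c1 : 0 < c + 1 by lra.
apply: le_trans (h (e / (c + 1)) (divr_gt0 e0 c1)) _.
by rewrite lerD2l mulrAC ler_pdivrMr// ler_pM2l//; lra.
Qed.

(** Project [G] onto the direction of its total increment [v]: the real function |v| Re H - Re (G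
    conj v) does not decrease. Only the real part of [H] counts; it is complex-valued so that one
    integral serves for integrands and majorants. *)
Lemma rderiv_dominated G H g h a b : a <= b ->
  (forall t, a <= t <= b -> rderiv G t (g t)) ->
  (forall t, a <= t <= b -> rderiv H t (h t)) ->
  (forall t, a <= t <= b -> nrm (g t) <= Re (h t)) ->
  nrm (G b - G a) <= Re (H b - H a).
Proof.
move=> ab dG dH gh; set v := G b - G a.
have [v0|v0] := eqVneq (nrm v) 0.
  rewrite v0 Re_add Re_opp subr_ge0; apply: (@le_slack _ _ (b - a)); first by rewrite subr_ge0.
  move=> e e0; suff : Re (H a) + e * a <= Re (H b) + e * b by lra.
  apply: (@locally_nondecreasing R (fun t => Re (H t) + e * t) a b ab) => t tab.
  have [d d0 hd] := dH t tab e e0; exists d => // s _ /hd.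
  move=> /(le_trans (Re_le_nrm _)); rewrite !(Re_add, Re_opp) Re_mul/= mul0r subr0.
  have r0 : 0 <= Re (h t) by exact: le_trans (nrm_ge0 _) (gh t tab).
  rewrite ler_norml => /andP[h1 h2]; split=> ts.
    rewrite gtr0_norm ?subr_gt0// in h1 h2.
    by have : 0 <= Re (h t) * (s - t) by [rewrite mulr_ge0// subr_ge0 ltW]; lra.
  rewrite ltr0_norm ?subr_lt0// in h1 h2.
  by have : 0 <= Re (h t) * (t - s) by [rewrite mulr_ge0// subr_ge0 ltW]; lra.
have vp : 0 < nrm v by rewrite lt0r v0 nrm_ge0.
apply: (@le_slack _ _ (b - a)); first by rewrite subr_ge0.
(* The slack [e * t] turns the weak inequality between derivatives into local monotonicity; it is
   removed by [le_slack]. *)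
move=> e e0; pose psi t := nrm v * (Re (H t) + e * t) - Re (G t * v^*).
have : psi a <= psi b.
  apply: locally_nondecreasing => // t tab; have e2 : 0 < e / 2 by rewrite divr_gt0.
  have [d d0 hd] := dG t tab _ e2; have [d' d'0 hd'] := dH t tab _ e2.
  exists (Num.min d d'); first by rewrite lt_min d0.
  move=> s _; rewrite lt_min => /andP[/hd h1 /hd' h2].
  have hle := gh t tab.
  have G1 : nrm (G s - G t) <= (Re (h t) + e / 2) * `|s - t|.
    have := nrmD (G s - G t - cpx (s - t) * g t) (cpx (s - t) * g t).
    rewrite subrK nrmM nrm_real; have := normr_ge0 (s - t); nra.
  have := le_trans (Re_le_nrm _) h2; rewrite !(Re_add, Re_opp) Re_mul/= mul0r subr0.
  rewrite ler_norml => /andP[h3 h4].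
  have G2 : `|Re ((G s - G t) * v^*)| <= nrm v * ((Re (h t) + e / 2) * `|s - t|).
    apply: le_trans (Re_le_nrm _) _; rewrite nrmM nrmJ mulrC ler_pM2l//.
  move: G2; rewrite mulrBl Re_add Re_opp ler_norml /psi => /andP[h5 h6].
  split=> ts.
    rewrite gtr0_norm ?subr_gt0// in h3 h4 h5 h6.
    have : nrm v * ((Re (h t) + e / 2) * (s - t)) <=
        nrm v * (Re (H s) - Re (H t) + e * (s - t)).
      by rewrite ler_pM2l//; lra.
    by lra.
  rewrite ltr0_norm ?subr_lt0// in h3 h4 h5 h6.
  have : nrm v * ((Re (h t) + e / 2) * - (s - t)) <=
      nrm v * (Re (H t) - Re (H s) - e * (s - t)).
    by rewrite ler_pM2l//; lra.
  by lra.
have : Re (G b * v^*) - Re (G a * v^*) = nrm v ^+ 2.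
  have -> : Re (G b * v^*) - Re (G a * v^*) = Re (v * v^*).
    by rewrite /v mulrBl Re_add Re_opp.
  by rewrite mulJ.
rewrite /psi => h1 h2; rewrite -(ler_pM2l vp) Re_add Re_opp; lra.
Qed.

Lemma rderiv_eq_increment G1 G2 g a b :
  (forall t, rderiv G1 t (g t)) -> (forall t, rderiv G2 t (g t)) ->
  G1 b - G1 a = G2 b - G2 a.
Proof.
move=> d1 d2.
have cst x y : x <= y -> (G1 y - G2 y) - (G1 x - G2 x) = 0.
  move=> xy; apply/eqP; rewrite -nrm_eq0 eq_le nrm_ge0 andbT.
  have := @rderiv_dominated (fun t => G1 t - G2 t) (fun=> 0) (fun=> 0) (fun=> 0) x y xy.
  rewrite subrr; apply => t _; [|exact: rderiv_cst|by rewrite nrm0].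
  by have := rderivB (d1 t) (d2 t); rewrite subrr.
apply/eqP; rewrite -subr_eq0; apply/eqP.
case: (leP a b) => [/cst|/ltW/cst] h; first by rewrite -[RHS]h; ring.
by rewrite -[RHS]oppr0 -h; ring.
Qed.

Definition rcontinuous phi := forall t e, 0 < e -> exists2 d, 0 < d &
  forall s, `|s - t| < d -> nrm (phi s - phi t) < e.


Lemma near_rderiv f g t l d : 0 < d -> (forall s, `|s - t| < d -> f s = g s) ->
  rderiv f t l -> rderiv g t l.
Proof.
move=> d0 fg df e e0; have [d' d'0 hd] := df e e0.
exists (Num.min d d'); first by rewrite lt_min d0.
move=> s; rewrite lt_min => /andP[s1 /hd]; rewrite !fg//.
by rewrite subrr normr0.
Qed.

Lemma ex_real_primitive (f : R -> R) (c : R) : continuous f ->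
  exists G : R -> R, forall t, c < t -> is_derive t 1 G (f t).
Proof.
move=> cf; exists (fun x => \int[lebesgue_measure]_(u in `[c, x]) f u)%R => t ct.
have tt : t < t + 1 by rewrite ltrDl.
have int : lebesgue_measure.-integrable `[c, t + 1] (EFin \o f).
  apply: continuous_compact_integrable; first exact: segment_compact.
  exact: continuous_subspaceT.
have [d dE] := continuous_FTC1_closed tt int ct (cf t).
by apply: (DeriveDef d); rewrite -derive1E; exact: dE.
Qed.

(* Two one-sided primitives, glued on the overlap of their domains. *)
Lemma ex_real_rderiv (f : R -> R) : continuous f ->
  exists G, forall t, rderiv G t (cpx (f t)).
Proof.
move=> cf; have [G1 dG1] := ex_real_primitive (-1) cf.
have cfN : continuous (fun x => - f (- x)).
  move=> x; apply: (@continuousN R R R (fun y => f (- y)) x).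
  by apply: (@continuous_comp _ _ _ -%R f); [exact: opp_continuous|exact: cf].
have [G2 dG2] := ex_real_primitive (-1) cfN.
have h1 t : -1 < t -> rderiv (fun s => cpx (G1 s)) t (cpx (f t)).
  by move=> t1; apply: rderiv_is_derive; exact: dG1.
have h2 t : t < 1 -> rderiv (fun s => cpx (G2 (- s))) t (cpx (f t)).
  move=> t1; have := dG2 (- t) (ltac:(by rewrite ltrN2)) => /rderiv_is_derive d.
  move=> e e0; have [d' d'0 hd] := d e e0; exists d' => // s st.
  have sN : `|- s - - t| = `|s - t| by rewrite -opprD normrN.
  have := hd (- s); rewrite sN => /(_ st); rewrite !opprK.
  by have -> : - s + t = - (s - t) by [ring]; rewrite !rmorphN mulrNN.
pose c := cpx (G1 0) - cpx (G2 0).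
have glue t : -1 < t -> t < 1 -> cpx (G1 t) = cpx (G2 (- t)) + c.
  move=> t1 t2; pose D s := cpx (G1 s) - cpx (G2 (- s)).
  have dD s : -1 < s -> s < 1 -> rderiv D s 0.
    by move=> s1 s2; have := rderivB (h1 s s1) (h2 s s2); rewrite subrr.
  have DE x y : -1 < x -> x <= y -> y < 1 -> D y = D x.
    move=> x1 xy y1; apply/eqP; rewrite -subr_eq0 -nrm_eq0 eq_le nrm_ge0 andbT.
    have := @rderiv_dominated D (fun=> 0) (fun=> 0) (fun=> 0) x y xy.
    rewrite subrr; apply => s /andP[sx sy]; [|exact: rderiv_cst|by rewrite nrm0].
    by apply: dD; lra.
  have D0 : D t = D 0.
    by case: (leP 0 t) => t0; [|symmetry]; apply: DE => //; lra.
  have : D t = c by rewrite D0 /D /c oppr0.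
  by rewrite /D => <-; ring.
exists (fun s => if s < 0 then cpx (G2 (- s)) + c else cpx (G1 s)) => t.
case: (ltP t 0) => t0.
  have : rderiv (fun s => cpx (G2 (- s)) + c) t (cpx (f t)).
    by have := rderivD (h2 t (lt_trans t0 ltr01)) (rderiv_cst c t); rewrite addr0.
  apply: (@near_rderiv _ _ _ _ (- t)); first by rewrite oppr_gt0.
  move=> s; rewrite ltr_norml => /andP[_ ts]; case: ifPn => //.
  by rewrite -leNgt => ?; exfalso; lra.
have : rderiv (fun s => cpx (G1 s)) t (cpx (f t)) by apply: h1; lra.
apply: (@near_rderiv _ _ _ _ 1) => // s; rewrite ltr_norml => /andP[ts _].
by case: ifPn => // s0; apply: glue; lra.
Qed.

Lemma rcontinuous_real phi (g : R[i] -> R) : rcontinuous phi ->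
  (forall z w, `|g z - g w| <= nrm (z - w)) -> continuous (fun t => g (phi t)).
Proof.
move=> cphi hg t; apply/cvgrPdist_lt => e e0.
have [d d0 hd] := cphi t e e0; apply/nbhs_ballP; exists d => // s.
rewrite /= distrC => /hd h; rewrite distrC.
exact: le_lt_trans (hg _ _) h.
Qed.

Lemma ex_primitive phi : rcontinuous phi -> exists G, forall t, rderiv G t (phi t).
Proof.
move=> cphi.
have cRe : continuous (fun t => Re (phi t)).
  by apply: rcontinuous_real => // z w; rewrite -Re_opp -Re_add; exact: Re_le_nrm.
have cIm : continuous (fun t => Im (phi t)).
  by apply: rcontinuous_real => // z w; rewrite -Im_opp -Im_add; exact: Im_le_nrm.
have [G1 d1] := ex_real_rderiv cRe; have [G2 d2] := ex_real_rderiv cIm.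
exists (fun t => G1 t + Complex 0 1 * G2 t) => t.
have := rderivD (d1 t) (rderivZ (Complex 0 1) (d2 t)).
congr (rderiv _ _ _); case: (phi t) => x y; apply: complex_ext => /=; ring.
Qed.

(** Writing integrals as increments of a chosen primitive makes additivity over intervals and the
    cancellation of inner edges of rectangles identities that [ring] proves for every integrand. *)
Definition primitive phi : R -> R[i] :=
  xget (fun=> 0) [set G | forall t, rderiv G t (phi t)].

(* A junk value unless [phi] has a primitive. *)
Definition cint phi a b := primitive phi b - primitive phi a.

Lemma primitiveP phi : rcontinuous phi -> forall t, rderiv (primitive phi) t (phi t).
Proof.
move=> cphi; have [G dG] := ex_primitive cphi.
exact: (@xgetPex _ (fun=> 0) [set G | forall t, rderiv G t (phi t)] (ex_intro _ G dG)).
Qed.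

Lemma cint_primitive phi G a b : (forall t, rderiv G t (phi t)) ->
  cint phi a b = G b - G a.
Proof.
move=> dG; apply: (rderiv_eq_increment a b _ dG).
exact: (@xgetPex _ (fun=> 0) [set G | forall t, rderiv G t (phi t)] (ex_intro _ G dG)).
Qed.

Lemma cint_linear c phi psi a b : rcontinuous phi -> rcontinuous psi ->
  cint (fun t => phi t + c * psi t) a b = cint phi a b + c * cint psi a b.
Proof.
move=> cp cs; rewrite (@cint_primitive _ (fun t => primitive phi t + c * primitive psi t)).
  by rewrite /cint; ring.
by move=> t; apply: rderivD; [|apply: rderivZ]; exact: primitiveP.
Qed.

Lemma cint_dominated phi psi a b : rcontinuous phi -> rcontinuous psi -> a <= b ->
  (forall t, a <= t <= b -> nrm (phi t) <= Re (psi t)) ->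
  nrm (cint phi a b) <= Re (cint psi a b).
Proof.
move=> cp cs ab h; apply: (rderiv_dominated (g := phi) (h := psi)) => // t _; exact: primitiveP.
Qed.

Lemma cint_bound phi a b M : rcontinuous phi -> a <= b ->
  (forall t, a <= t <= b -> nrm (phi t) <= M) ->
  nrm (cint phi a b) <= M * (b - a).
Proof.
move=> cp ab h; have := @rderiv_dominated (primitive phi) (fun t => cpx M * cpx t) phi
  (fun=> cpx M) a b ab.
rewrite -mulrBr -rmorphB/= mul0r subr0; apply => [t _|t _|t /h//]; first exact: primitiveP.
by have := rderivZ (cpx M) (rderiv_id t); rewrite mulr1.
Qed.

End CurveIntegral.

(** * Integrals over rectangles *)

Section RectangleIntegral.
Variable R : realType.
Implicit Types (z w v l A B : R[i]) (e d t s : R) (F G : R[i] -> R[i]).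

Local Notation cpx x := (x%:C)%C.

Lemma geometric_small (c d : R) : 0 < c -> 0 < d ->
  exists N, forall n, (N <= n)%N -> c * 2^-1 ^+ n < d.
Proof.
move=> c0 d0; exists (Num.bound (c / d)) => n Nn.
have b0 : 0 <= c / d by rewrite divr_ge0// ltW.
have := archi_boundP b0; rewrite ltr_pdivrMr// => hb.
rewrite exprVn ltr_pdivrMr ?exprn_gt0//; apply: lt_le_trans hb _.
rewrite mulrC ler_pM2l// -natrX ler_nat; apply: leq_trans Nn _.
by apply: ltnW; rewrite ltn_expl.
Qed.

(** If [P] fails for a rectangle it fails for one of its quarters. The nested quarters shrink to a
    point (a, b), where the local hypothesis contradicts the failure. All rectangles keep the
    proportions of [w] and [h]. *)
Lemma bisection (P : R -> R -> nat -> Prop) (w h : R) (s := fun n => (2^-1 : R) ^+ n) :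
  0 < w -> 0 < h ->
  (forall x y n, P x y n.+1 -> P (x + w * s n.+1) y n.+1 -> P x (y + h * s n.+1) n.+1 ->
     P (x + w * s n.+1) (y + h * s n.+1) n.+1 -> P x y n) ->
  (forall a b, exists N, forall n x y, (N <= n)%N -> x <= a <= x + w * s n ->
     y <= b <= y + h * s n -> P x y n) ->
  forall x y, P x y 0.
Proof.
move=> w0 h0 step loc x y; apply: contrapT => nP.
have sS n : s n = 2 * s n.+1 by rewrite /s exprS mulrA divff// mul1r.
have s0 n : 0 < s n by rewrite exprn_gt0// invr_gt0.
(* The implication inside the existential makes the choice of a quarter total. *)
have nxt (q : (R * R) * nat) : exists q' : R * R, ~ P q.1.1 q.1.2 q.2 ->
    [/\ ~ P q'.1 q'.2 q.2.+1,
        q.1.1 <= q'.1 /\ q'.1 + w * s q.2.+1 <= q.1.1 + w * s q.2 &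
        q.1.2 <= q'.2 /\ q'.2 + h * s q.2.+1 <= q.1.2 + h * s q.2].
  case: q => -[a b] n /=; have [Pn|nPn] := pselect (P a b n); first by exists (a, b).
  have ws : 0 < w * s n.+1 by rewrite mulr_gt0.
  have hs : 0 < h * s n.+1 by rewrite mulr_gt0.
  rewrite (sS n); have [P1|n1] := pselect (P a b n.+1); last first.
    by exists (a, b) => _; split=> //=; split; lra.
  have [P2|n2] := pselect (P (a + w * s n.+1) b n.+1); last first.
    by exists (a + w * s n.+1, b) => _; split=> //=; split; lra.
  have [P3|n3] := pselect (P a (b + h * s n.+1) n.+1); last first.
    by exists (a, b + h * s n.+1) => _; split=> //=; split; lra.
  exists (a + w * s n.+1, b + h * s n.+1) => _; split=> //=; try by split; lra.
  by move=> P4; apply: nPn; apply: step.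
have [g hg] := choice nxt.
pose u := fix u n := if n is m.+1 then g (u m, m) else (x, y).
have nPu n : ~ P (u n).1 (u n).2 n by elim: n => [//|n /(hg (u n, n))[]].
have uS n := hg (u n, n) (nPu n).
have mono (c : R * R -> R) (v : R) : 0 < v ->
    (forall n, c (u n) <= c (u n.+1) /\ c (u n.+1) + v * s n.+1 <= c (u n) + v * s n) ->
    exists a, forall n, c (u n) <= a <= c (u n) + v * s n.
  move=> v0 hc.
  have up n j : c (u n) <= c (u (n + j)%N) /\
      c (u (n + j)%N) + v * s (n + j)%N <= c (u n) + v * s n.
    elim: j => [|j [i1 i2]]; first by rewrite addn0.
    by rewrite addnS; have [h1 h2] := hc (n + j)%N; split; lra.
  have bd n m : c (u m) <= c (u n) + v * s n.
    have vs j : 0 < v * s j by rewrite mulr_gt0.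
    case: (leqP n m) => nm.
      have [_] := up n (m - n)%N; rewrite (subnKC nm); apply: le_trans.
      by rewrite lerDl ltW.
    have [+ _] := up m (n - m)%N; rewrite (subnKC (ltnW nm)) => h1.
    by apply: le_trans h1 _; rewrite lerDl ltW.
  pose S := [set c (u n) | n in setT].
  have S0 : S !=set0 by exists (c (u 0)), 0%N.
  have hS : has_sup S by split=> //; exists (c (u 0) + v * s 0) => _ [m _ <-]; exact: bd.
  exists (sup S) => n; apply/andP; split; first by apply: sup_upper_bound => //; exists n.
  by apply: ge_sup => // _ [m _ <-]; exact: bd.
have [a ha] := mono fst w w0 (fun n => let: And3 _ h1 _ := uS n in h1).
have [b hb] := mono snd h h0 (fun n => let: And3 _ _ h2 := uS n in h2).
have [N hN] := loc a b.
exact: (nPu N (hN N _ _ (leqnn N) (ha N) (hb N))).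
Qed.

Definition rect_int F (x0 x1 y0 y1 : R) : R[i] :=
  cint (fun t => F (Complex t y0)) x0 x1 +
  Complex 0 1 * cint (fun t => F (Complex x1 t)) y0 y1 -
  cint (fun t => F (Complex t y1)) x0 x1 -
  Complex 0 1 * cint (fun t => F (Complex x0 t)) y0 y1.

Lemma rect_int_split F x0 xm x1 y0 ym y1 :
  rect_int F x0 x1 y0 y1 = rect_int F x0 xm y0 ym + rect_int F xm x1 y0 ym +
    rect_int F x0 xm ym y1 + rect_int F xm x1 ym y1.
Proof. by rewrite /rect_int /cint; ring. Qed.

Lemma rect_int_swapx F x0 x1 y0 y1 : rect_int F x0 x1 y0 y1 = - rect_int F x1 x0 y0 y1.
Proof. by rewrite /rect_int /cint; ring. Qed.

Lemma rect_int_swapy F x0 x1 y0 y1 : rect_int F x0 x1 y0 y1 = - rect_int F x0 x1 y1 y0.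
Proof. by rewrite /rect_int /cint; ring. Qed.

Lemma ccontinuous_horizontal F y : ccontinuous F -> rcontinuous (fun t => F (Complex t y)).
Proof.
move=> cF t e e0; have [d d0 hd] := cF (Complex t y) e e0; exists d => // s st.
by apply: hd; apply: le_lt_trans (nrm_le_Re_Im _) _; rewrite /= subrr normr0 addr0.
Qed.

Lemma ccontinuous_vertical F x : ccontinuous F -> rcontinuous (fun t => F (Complex x t)).
Proof.
move=> cF t e e0; have [d d0 hd] := cF (Complex x t) e e0; exists d => // s st.
by apply: hd; apply: le_lt_trans (nrm_le_Re_Im _) _; rewrite /= subrr normr0 add0r.
Qed.

Lemma cint_affine A B a b : cint (fun t => A * cpx t + B) a b =
  A / 2%:R * (cpx b * cpx b - cpx a * cpx a) + B * (cpx b - cpx a).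
Proof.
rewrite (@cint_primitive _ _ (fun t => A / 2%:R * (cpx t * cpx t) + B * cpx t)); first by ring.
move=> t; have := rderivD (rderivZ (A / 2%:R) (rderivM (rderiv_id t) (rderiv_id t)))
  (rderivZ B (rderiv_id t)).
have two : (2%:R : R[i]) != 0 by rewrite pnatr_eq0.
by congr (rderiv _ _ _); field.
Qed.

Lemma rect_int_affine A B x0 x1 y0 y1 : rect_int (fun z => A * z + B) x0 x1 y0 y1 = 0.
Proof.
have H y a b : cint (fun t => A * Complex t y + B) a b =
    cint (fun t => A * cpx t + (A * (Complex 0 1 * cpx y) + B)) a b.
  congr (cint _ _ _); apply/funext => t; rewrite addrA -mulrDr; congr (A * _ + B).
  by apply: complex_ext => /=; ring.
have V x a b : cint (fun t => A * Complex x t + B) a b =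
    cint (fun t => A * Complex 0 1 * cpx t + (A * cpx x + B)) a b.
  congr (cint _ _ _); apply/funext => t; rewrite addrA -mulrA -mulrDr; congr (A * _ + B).
  by apply: complex_ext => /=; ring.
rewrite /rect_int !H !V !cint_affine.
have two : (2%:R : R[i]) != 0 by rewrite pnatr_eq0.
have ii : (Complex 0 1 : R[i]) * Complex 0 1 = -1 by exact: sqr_i.
set I := Complex 0 1 in ii *; pose q := A / 2%:R.
have -> : A * I / 2%:R = q * I by rewrite /q; ring.
rewrite -/q; have -> : A = q + q by rewrite /q; field.
move: (cpx x0) (cpx x1) (cpx y0) (cpx y1) => a b c d.
by ring: ii.
Qed.

(** An affine function integrates to zero, so it can be subtracted first; what remains is perimeter
    times supremum. [A] is the derivative near a point of differentiability and 0 where only the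
    oscillation is known. *)
Lemma rect_int_bound F A B (x0 x1 y0 y1 M : R) : ccontinuous F -> x0 <= x1 -> y0 <= y1 ->
  (forall z, x0 <= Re z <= x1 -> y0 <= Im z <= y1 -> nrm (F z - (A * z + B)) <= M) ->
  nrm (rect_int F x0 x1 y0 y1) <= 2 * (x1 - x0 + (y1 - y0)) * M.
Proof.
move=> cF hx hy hM; pose G z := A * z + B; pose D z := F z - G z.
have cG : ccontinuous G.
  move=> z e e0; have n1 : 0 < nrm A + 1 by have := nrm_ge0 A; lra.
  exists (e / (nrm A + 1)); first by rewrite divr_gt0.
  move=> w; rewrite ltr_pdivlMr// => hw.
  have -> : G w - G z = A * (w - z) by rewrite /G; ring.
  by rewrite nrmM; have := nrm_ge0 (w - z); nra.
have cD : ccontinuous D.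
  move=> z e e0; have e2 : 0 < e / 2 by rewrite divr_gt0.
  have [d d0 hd] := cF z _ e2; have [d' d'0 hd'] := cG z _ e2.
  exists (Num.min d d'); first by rewrite lt_min d0.
  move=> w; rewrite lt_min => /andP[/hd h1 /hd' h2].
  have -> : D w - D z = (F w - F z) - (G w - G z) by rewrite /D; ring.
  by apply: le_lt_trans (nrmD _ _) _; rewrite nrmN; lra.
have split_int (c : R -> R[i]) a b : rcontinuous (fun t => D (c t)) ->
    rcontinuous (fun t => G (c t)) ->
    cint (fun t => F (c t)) a b = cint (fun t => D (c t)) a b + cint (fun t => G (c t)) a b.
  move=> c1 c2; rewrite -[X in _ + X]mul1r -cint_linear//.
  by congr (cint _ _ _); apply/funext => t; rewrite /D; ring.
have -> : rect_int F x0 x1 y0 y1 = rect_int D x0 x1 y0 y1.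
  have := rect_int_affine A B x0 x1 y0 y1; rewrite -/G /rect_int => rG.
  rewrite (split_int (fun t => Complex t y0)) ?(split_int (fun t => Complex x1 t))
   ?(split_int (fun t => Complex t y1)) ?(split_int (fun t => Complex x0 t));
   try exact: ccontinuous_horizontal; try exact: ccontinuous_vertical.
  by rewrite -[RHS]addr0 -[X in _ = _ + X]rG; ring.
have b1 y : y0 <= y <= y1 -> nrm (cint (fun t => D (Complex t y)) x0 x1) <= M * (x1 - x0).
  move=> hyy; apply: cint_bound => //; first exact: ccontinuous_horizontal.
  by move=> t ht; apply: hM.
have b2 x : x0 <= x <= x1 -> nrm (cint (fun t => D (Complex x t)) y0 y1) <= M * (y1 - y0).
  move=> hxx; apply: cint_bound => //; first exact: ccontinuous_vertical.
  by move=> t ht; apply: hM.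
have i1 : nrm (Complex 0 1 : R[i]) = 1 by rewrite /= expr0n expr1n add0r sqrtr1.
have h1 := b1 y0 (introT andP (conj (lexx _) hy)).
have h2 := b1 y1 (introT andP (conj hy (lexx _))).
have h3 := b2 x0 (introT andP (conj (lexx _) hx)).
have h4 := b2 x1 (introT andP (conj hx (lexx _))).
rewrite /rect_int; apply: le_trans (nrmD _ _) _; rewrite nrmN nrmM i1 mul1r.
set u1 := cint _ x0 x1 in h1 *; set u2 := cint _ y0 y1 in h4 *; set u3 := cint _ x0 x1 in h2 *.
have := nrmD (u1 + Complex 0 1 * u2) (- u3); have := nrmD u1 (Complex 0 1 * u2).
by rewrite nrmN nrmM i1 mul1r; lra.
Qed.

End RectangleIntegral.

(** * Goursat's argument with areas as majorants *)

Section Goursat.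
Variable R : realType.
Implicit Types (z w v l p : R[i]) (e d t s : R) (F : R[i] -> R[i]).

Local Notation plane := (measurableTypeR R * measurableTypeR R)%type.
Local Notation cpx x := (x%:C)%C.

(** Boxes are open, so the quarters miss the dividing lines and the result is an inequality. [Phi]
    is either the trace on the open cover or the image under [F]. *)
Lemma area_image_superadditive (Phi : set R[i] -> set plane) (x0 xm x1 y0 ym y1 : R) :
  x0 <= xm -> xm <= x1 -> y0 <= ym -> ym <= y1 ->
  (forall U V, U `<=` V -> Phi U `<=` Phi V) ->
  (forall U V, U `&` V = set0 -> Phi U `&` Phi V = set0) ->
  (forall a b c d, measurable (Phi (box a b c d))) ->
  (area (Phi (box x0 x1 y0 y1)) < +oo)%E ->
  fine (area (Phi (box x0 xm y0 ym))) + fine (area (Phi (box xm x1 y0 ym))) +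
    fine (area (Phi (box x0 xm ym y1))) + fine (area (Phi (box xm x1 ym y1)))
  <= fine (area (Phi (box x0 x1 y0 y1))).
Proof.
move=> hx0 hx1 hy0 hy1 sub dis meas fin.
apply: area_superadditive => //.
1-4: by apply: sub => z [/andP[? ?] /andP[? ?]]; split; apply/andP; split; lra.
all: apply: dis; rewrite -subset0 => z [[/andP[? ?] /andP[? ?]] [/andP[? ?] /andP[? ?]]].
all: by move=> /=; lra.
Qed.

(** Under quartering the norm of the integral is subadditive and [S] superadditive, so a bound on
    all small rectangles around each point propagates upwards. *)
Lemma rect_int_superadditive F (S : R -> R -> R -> R -> R) (w h : R)
    (s := fun n => (2^-1 : R) ^+ n) : 0 < w -> 0 < h ->
  (forall x0 xm x1 y0 ym y1, x0 <= xm -> xm <= x1 -> y0 <= ym -> ym <= y1 ->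
    S x0 xm y0 ym + S xm x1 y0 ym + S x0 xm ym y1 + S xm x1 ym y1 <= S x0 x1 y0 y1) ->
  (forall a b, exists N, forall n x y, (N <= n)%N -> x <= a <= x + w * s n ->
     y <= b <= y + h * s n ->
     nrm (rect_int F x (x + w * s n) y (y + h * s n)) <= S x (x + w * s n) y (y + h * s n)) ->
  forall x y, nrm (rect_int F x (x + w) y (y + h)) <= S x (x + w) y (y + h).
Proof.
move=> w0 h0 sup loc x y.
pose P x y n := nrm (rect_int F x (x + w * s n) y (y + h * s n)) <=
  S x (x + w * s n) y (y + h * s n).
suff : P x y 0%N by rewrite /P /s expr0 !mulr1.
apply: (@bisection R P w h w0 h0) => // {x y} x y n.
have sS : s n = 2 * s n.+1 by rewrite /s exprS mulrA divff// mul1r.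
have u0 : 0 < s n.+1 by rewrite exprn_gt0// invr_gt0.
rewrite -/(s n.+1) /P sS; set u := s n.+1 in u0 *.
have wu : 0 < w * u by rewrite mulr_gt0.
have hu : 0 < h * u by rewrite mulr_gt0.
have -> : x + w * u + w * u = x + w * (2 * u) by ring.
have -> : y + h * u + h * u = y + h * (2 * u) by ring.
have := sup x (x + w * u) (x + w * (2 * u)) y (y + h * u) (y + h * (2 * u)).
rewrite (rect_int_split F x (x + w * u) (x + w * (2 * u)) y (y + h * u)).
set J1 := rect_int _ _ _ _ _; set J2 := rect_int _ _ _ _ _.
set J3 := rect_int _ _ _ _ _; set J4 := rect_int _ _ _ _ _.
have n1 := nrmD (J1 + J2 + J3) J4; have n2 := nrmD (J1 + J2) J3; have n3 := nrmD J1 J2.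
move=> hS; have {}hS := hS (ltac:(lra)) (ltac:(lra)) (ltac:(lra)) (ltac:(lra)).
by move=> p1 p2 p3 p4; clear -p1 p2 p3 p4 n1 n2 n3 hS; lra.
Qed.

Lemma amgm (a b t : R) : 0 < t -> 2 * (a * b) <= a ^+ 2 / t + t * b ^+ 2.
Proof.
move=> t0; rewrite -subr_ge0.
have -> : a ^+ 2 / t + t * b ^+ 2 - 2 * (a * b) = (a - t * b) ^+ 2 / t.
  by field; rewrite gt_eqF.
by rewrite divr_ge0 ?sqr_ge0// ltW.
Qed.

Section Rectangle.
Variables (k : R) (F : R[i] -> R[i]).
Hypotheses (k0 : 0 < k) (sF : sectorial k setT F) (iF : injective F).

(** Quasisymmetry against the pair 0, 1 keeps the image in a bounded box; [r] exceeds |z| for all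
    [z] in the source box. *)
Lemma image_box_finite x0 x1 y0 y1 :
  (area (image_set F (box x0 x1 y0 y1) : set plane) < +oo)%E.
Proof.
pose r := `|x0| + `|x1| + `|y0| + `|y1| + 1.
have [L L0 hL] := sectorial_quasisymmetric k0 sF r.
pose M := L * nrm (F 1 - F 0) + 1.
have M0 : 0 < M by rewrite ltr_wpDl// mulr_ge0 ?nrm_ge0// ltW.
pose B : set plane := `]Re (F 0) - M, Re (F 0) + M[%classic `*`
  `]Im (F 0) - M, Im (F 0) + M[%classic.
have mB : measurable B by apply: measurableX; exact: measurable_itv.
apply: (@le_lt_trans _ _ (area B)).
  apply: area_le => //.
    by apply: open_measurable_plane; exact: (image_set_box_open k0 sF iF).
  move=> _ [z [/andP[? ?] /andP[? ?]] <-].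
  have : nrm (F z - F 0) < M.
    rewrite /M ltr_pwDr// ; apply: hL; rewrite !subr0 nrm1 mulr1.
    apply: le_trans (nrm_le_Re_Im _) _; rewrite /r.
    have bnd (a b c : R) : a < c -> c < b -> `|c| <= `|a| + `|b|.
      move=> ac cb; have := ler_norm b; have := ler_norm (- a); rewrite normrN => h1 h2.
      have := normr_ge0 a; have := normr_ge0 b; rewrite ler_norml => ? ?.
      by apply/andP; split; lra.
    have h1 : `|Re z| <= `|x0| + `|x1| by exact: bnd.
    have h2 : `|Im z| <= `|y0| + `|y1| by exact: bnd.
    by lra.
  move=> hM; have := le_lt_trans (Re_le_nrm _) hM; have := le_lt_trans (Im_le_nrm _) hM.
  rewrite Re_add Re_opp Im_add Im_opp !ltr_norml => /andP[? ?] /andP[? ?].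
  by split; rewrite /= in_itv/=; apply/andP; split; lra.
by rewrite area_box ?ltry//; lra.
Qed.

Lemma image_set_id_box (x0 x1 y0 y1 : R) :
  image_set id (box x0 x1 y0 y1) = `]x0, x1[%classic `*` `]y0, y1[%classic.
Proof.
rewrite eqEsubset; split=> [_ [z [? ?] <-]|[x y] []]; first by split; rewrite /= in_itv.
by rewrite /= !in_itv/= => hx hy; exists (Complex x y).
Qed.

Lemma area_boxE x0 x1 y0 y1 : x0 <= x1 -> y0 <= y1 ->
  area (image_set id (box x0 x1 y0 y1) : set plane) = ((x1 - x0) * (y1 - y0))%:E.
Proof. by rewrite image_set_id_box; exact: area_box. Qed.

Lemma image_box_measurable x0 x1 y0 y1 :
  measurable (image_set F (box x0 x1 y0 y1) : set plane).
Proof. by apply: open_measurable_plane; exact: (image_set_box_open k0 sF iF). Qed.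

Lemma box_measurable x0 x1 y0 y1 :
  measurable (image_set id (box x0 x1 y0 y1) : set plane).
Proof. by rewrite image_set_id_box; apply: measurableX; exact: measurable_itv. Qed.

(* The image contains a square whose side is comparable to the oscillation. *)
Lemma oscillation_area (w h : R) : 0 < w -> 0 < h -> exists2 C, 0 < C &
  forall x y s, 0 < s -> exists rho, [/\ 0 <= rho,
    rho ^+ 2 <= fine (area (image_set F (box x (x + w * s) y (y + h * s)) : set plane)) &
    forall z, x <= Re z <= x + w * s -> y <= Im z <= y + h * s ->
      nrm (F z - F (Complex (x + w * s / 2) (y + h * s / 2))) <= C * rho].
Proof.
(* With half-sides w' and h' this [r] gives both w' <= r h', as [sectorial_box_image] requires, and
   w' + h' <= r w', which bounds the distance from the centre. It depends on the proportions only
   and so serves all scales [s]. *)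
move=> w0 h0; pose r := 1 + h / w + w / h.
have hw0 : 0 < h / w by rewrite divr_gt0.
have wh0 : 0 < w / h by rewrite divr_gt0.
have [L L0 hL] := sectorial_quasisymmetric k0 sF r.
exists (L * (2 * L)); first by rewrite !mulr_gt0.
move=> x y s s0; set p := Complex _ _.
pose w' := w * s / 2; pose h' := h * s / 2.
have w'0 : 0 < w' by rewrite divr_gt0// mulr_gt0.
have h'0 : 0 < h' by rewrite divr_gt0// mulr_gt0.
have r1 : 1 <= r by rewrite /r; lra.
have wrh : w' <= r * h'.
  have -> : w' = w / h * h' by rewrite /w' /h'; field; rewrite gt_eqF.
  by rewrite ler_wpM2r ?(ltW h'0)// /r; lra.
have im v := @sectorial_box_image _ _ _ k0 sF iF L r w' h' p v L0 w'0 h'0 r1 wrh hL.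
set rho := nrm (F (p + cpx w') - F p) / (2 * L) in im.
have rho0 : 0 <= rho by rewrite divr_ge0 ?nrm_ge0// mulr_ge0// ltW.
exists rho; split=> //.
  have meas := image_box_measurable x (x + w * s) y (y + h * s).
  have fin := image_box_finite x (x + w * s) y (y + h * s).
  (* The square of side [rho] about [F p] lies within distance [rho] of [F p], hence in the
     image. *)
  have -> : rho ^+ 2 = fine (area (`]Re (F p) - rho / 2, Re (F p) + rho / 2[%classic `*`
      `]Im (F p) - rho / 2, Im (F p) + rho / 2[%classic : set plane)).
    by rewrite area_box /=; [field|lra|lra].
  apply: fine_le; first by rewrite area_box//; lra.
    by rewrite ge0_fin_numE// area_ge0.
  apply: area_le => //; first by apply: measurableX; exact: measurable_itv.
  move=> [a b] [/=]; rewrite !in_itv/= => /andP[? ?] /andP[? ?].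
  have [z [/andP[z1 z2] /andP[z3 z4]] Fz] : exists2 z,
      box (Re p - w') (Re p + w') (Im p - h') (Im p + h') z & F z = Complex a b.
    apply: im; apply: le_lt_trans (nrm_le_Re_Im _) _; rewrite Re_add Im_add Re_opp Im_opp.
    rewrite [Re (Complex _ _)]/= [Im (Complex _ _)]/=.
    have : `|a - Re (F p)| < rho / 2 by rewrite ltr_norml; apply/andP; split; lra.
    have : `|b - Im (F p)| < rho / 2 by rewrite ltr_norml; apply/andP; split; lra.
    by lra.
  exists z; last by rewrite Fz.
  by move: z1 z2 z3 z4; rewrite /w' /h' /= => *; split; apply/andP; split; lra.
move=> z /andP[z1 z2] /andP[z3 z4].
have -> : L * (2 * L) * rho = L * nrm (F (p + cpx w') - F p).
  by rewrite /rho; field; rewrite gt_eqF.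
apply: hL; rewrite [p + _]addrC addrK nrm_real gtr0_norm//.
apply: le_trans (nrm_le_Re_Im _) _; rewrite Re_add Im_add Re_opp Im_opp [Re p]/= [Im p]/=.
have i1 : `|Re z - (x + w * s / 2)| <= w' by rewrite ler_norml /w'; apply/andP; split; lra.
have i2 : `|Im z - (y + h * s / 2)| <= h' by rewrite ler_norml /h'; apply/andP; split; lra.
have e1 : h / w * w' = h' by rewrite /w' /h'; field; rewrite gt_eqF.
have : 0 <= w / h * w' by rewrite mulr_ge0// ltW.
by rewrite /r !mulrDl mul1r e1; lra.
Qed.

(** The right-hand side is superadditive under quartering, so only small rectangles matter: the
    first term handles those around a point of differentiability, the other two those inside [O].
    [C] is fixed before [O], [e] and [t]. *)
Lemma rect_int_estimate (w h : R) : 0 < w -> 0 < h -> exists2 C, 0 < C &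
  forall (O : set plane) e t x y, open (O : set (R * R)) -> 0 < e -> 0 < t ->
    (forall z, (exists l, cderiv F z l) \/ O (Re z, Im z)) ->
    nrm (rect_int F x (x + w) y (y + h)) <= e * (w * h) +
      C / t * fine (area (O `&` image_set id (box x (x + w) y (y + h)))) +
      C * t * fine (area (image_set F (box x (x + w) y (y + h)) : set plane)).
Proof.
move=> w0 h0; have [C C0 hC] := oscillation_area w0 h0.
have wh0 : 0 < w * h by rewrite mulr_gt0.
(* The factor (w h)^-1 converts s^2 into the area w h s^2 of the small rectangle; the summand 1
   serves the image term. *)
pose C1 := (w + h) * C * (1 + (w * h)^-1).
have whi : 0 < (w * h)^-1 by rewrite invr_gt0.
have wh_gt0 : 0 < w + h by rewrite addr_gt0.
have wC : 0 < (w + h) * C by rewrite mulr_gt0.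
have C10 : 0 < C1 by rewrite mulr_gt0// addr_gt0.
exists C1 => // O e t x y oO e0 t0 cov.
have cF := sectorial_continuous k0 sF.
have mO : measurable O by exact: open_measurable_plane.
pose s n := (2^-1 : R) ^+ n.
have s0 n : 0 < s n by rewrite exprn_gt0// invr_gt0.
pose PhiO U := O `&` image_set id U; pose PhiF U : set plane := image_set F U.
have mPO a b c d : measurable (PhiO (box a b c d)).
  by apply: measurableI => //; exact: box_measurable.
have finO a b c d : (area (PhiO (box a b c d)) < +oo)%E.
  apply: (@le_lt_trans _ _ (area (image_set id (box a b c d) : set plane))).
    by apply: area_le => //; [exact: box_measurable|exact: subIsetr].
  have [ab|ba] := leP a b; last first.
    have -> : image_set id (box a b c d) = set0.
      by rewrite -subset0 => _ [z [/andP[? ?] _] _] /=; lra.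
    by rewrite area_set0 ltry.
  have [cd|dc] := leP c d; last first.
    have -> : image_set id (box a b c d) = set0.
      by rewrite -subset0 => _ [z [_ /andP[? ?]] _] /=; lra.
    by rewrite area_set0 ltry.
  by rewrite area_boxE// ltry.
have image_mono (G : R[i] -> R[i]) U V : U `<=` V -> image_set G U `<=` image_set G V.
  by move=> UV _ [z Uz <-]; exists z => //; exact: UV.
have image_disj (G : R[i] -> R[i]) U V : injective G -> U `&` V = set0 ->
    image_set G U `&` image_set G V = set0.
  move=> iG UV; rewrite -subset0 => _ [[z Uz <-] [z' Vz' [e1 e2]]].
  have zz : z' = z by apply: iG; exact: complex_ext.
  by have : (U `&` V) z by [split=> //; rewrite -zz]; rewrite UV.
have monoO U V : U `<=` V -> PhiO U `<=` PhiO V.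
  by move=> UV; apply: setIS; exact: image_mono.
have monoF U V : U `<=` V -> PhiF U `<=` PhiF V by exact: image_mono.
have disF U V : U `&` V = set0 -> PhiF U `&` PhiF V = set0 by exact: image_disj.
have disO U V : U `&` V = set0 -> PhiO U `&` PhiO V = set0.
  by move=> UV; rewrite /PhiO setIACA setIid (image_disj id)// setI0.
pose aO a b c d := fine (area (PhiO (box a b c d))).
pose aF a b c d := fine (area (PhiF (box a b c d))).
have supO a am b c cm d : a <= am -> am <= b -> c <= cm -> cm <= d ->
    aO a am c cm + aO am b c cm + aO a am cm d + aO am b cm d <= aO a b c d.
  by move=> *; exact: area_image_superadditive.
have supF a am b c cm d : a <= am -> am <= b -> c <= cm -> cm <= d ->
    aF a am c cm + aF am b c cm + aF a am cm d + aF am b cm d <= aF a b c d.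
  move=> *; apply: area_image_superadditive => //; first exact: image_box_measurable.
  exact: image_box_finite.
pose S (a b c d : R) : R := e * ((b - a) * (d - c)) + C1 / t * aO a b c d + C1 * t * aF a b c d.
have -> : e * (w * h) = e * ((x + w - x) * (y + h - y)) by ring.
have Ct : 0 <= C1 / t by rewrite divr_ge0// ltW.
have Ct' : 0 <= C1 * t by rewrite mulr_ge0// ltW.
have supS a am b c cm d : a <= am -> am <= b -> c <= cm -> cm <= d ->
    S a am c cm + S am b c cm + S a am cm d + S am b cm d <= S a b c d.
  move=> le1 le2 le3 le4.
  have := ler_wpM2l Ct (supO _ _ _ _ _ _ le1 le2 le3 le4).
  have := ler_wpM2l Ct' (supF _ _ _ _ _ _ le1 le2 le3 le4).
  rewrite /S; move: (C1 / t) (C1 * t) => u1 u2; clearbody aO aF; lra.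
suff loc : forall a b, exists N, forall n x y, (N <= n)%N -> x <= a <= x + w * s n ->
     y <= b <= y + h * s n ->
     nrm (rect_int F x (x + w * s n) y (y + h * s n)) <= S x (x + w * s n) y (y + h * s n).
  exact: (rect_int_superadditive w0 h0 supS loc).
clear x y.
move=> a b; have [[l dl]|Oab] := cov (Complex a b).
  (* Perimeter 2 (w + h) s times deviation e' (w + h) s is then exactly e w h s^2. *)
  pose e' := e * (w * h) / (2 * (w + h) * (w + h)).
  have wh2 : 0 < 2 * (w + h) * (w + h) by rewrite !mulr_gt0// addr_gt0.
  have e'0 : 0 < e' by rewrite divr_gt0// mulr_gt0.
  have [d d0 hd] := dl e' e'0.
  have [N hN] := geometric_small wh_gt0 d0.
  exists N => n x y Nn /andP[x1 x2] /andP[y1 y2]; have sn := s0 n; have dn : (w + h) * s n < d := hN n Nn.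
  have ws : 0 < w * s n by rewrite mulr_gt0.
  have hs : 0 < h * s n by rewrite mulr_gt0.
  have := @rect_int_bound _ F l (F (Complex a b) - l * Complex a b)
    x (x + w * s n) y (y + h * s n) (e' * ((w + h) * s n)) cF (ltac:(lra)) (ltac:(lra)).
  move=> hb; apply: le_trans (hb _) _.
    move=> z /andP[? ?] /andP[? ?].
    have zab : nrm (z - Complex a b) <= (w + h) * s n.
      apply: le_trans (nrm_le_Re_Im _) _; rewrite Re_add Im_add Re_opp Im_opp/=.
      have : `|Re z - a| <= w * s n by rewrite ler_norml; apply/andP; split; lra.
      have : `|Im z - b| <= h * s n by rewrite ler_norml; apply/andP; split; lra.
      by lra.
    have -> : F z - (l * z + (F (Complex a b) - l * Complex a b)) =
      F z - F (Complex a b) - l * (z - Complex a b) by ring.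
    apply: le_trans (hd z _) _; first exact: le_lt_trans zab dn.
    by rewrite ler_pM2l.
  have -> : 2 * (x + w * s n - x + (y + h * s n - y)) * (e' * ((w + h) * s n)) =
      e * ((x + w * s n - x) * (y + h * s n - y)).
    by rewrite /e'; field; rewrite gt_eqF// addr_gt0.
  by rewrite /S -[leRHS]addrA lerDl addr_ge0// mulr_ge0// /aO /aF fine_ge0// area_ge0.
have [d d0 hd] : exists2 d, 0 < d & forall x y, `|x - a| < d -> `|y - b| < d -> O (x, y).
  move: oO; rewrite openE => /(_ _ Oab) /nbhs_ballP[d d0 hd]; exists d => // x y xa yb.
  by apply: hd; split; rewrite -ball_normE /= distrC.
have [N hN] := geometric_small wh_gt0 d0.
exists N => n x y Nn /andP[x1 x2] /andP[y1 y2]; have sn := s0 n; have dn : (w + h) * s n < d := hN n Nn.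
have ws : 0 < w * s n by rewrite mulr_gt0.
have hs : 0 < h * s n by rewrite mulr_gt0.
have AO : aO x (x + w * s n) y (y + h * s n) = (w * h) * s n ^+ 2.
  rewrite /aO.
  have -> : PhiO (box x (x + w * s n) y (y + h * s n)) =
      image_set id (box x (x + w * s n) y (y + h * s n)).
    apply/setIidr => _ [z [/andP[z1 z2] /andP[z3 z4]] <-].
    apply: hd; rewrite ltr_norml; clear -x1 x2 y1 y2 dn ws hs z1 z2 z3 z4.
      by apply/andP; split; lra.
    by apply/andP; split; lra.
  by rewrite area_boxE/=; [ring|lra|lra].
have [rho [rho0 hrho osc]] := hC x y (s n) sn.
have := @rect_int_bound _ F 0 (F (Complex (x + w * s n / 2) (y + h * s n / 2)))
  x (x + w * s n) y (y + h * s n) (C * rho) cF (ltac:(lra)) (ltac:(lra)).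
move=> hb; apply: le_trans (hb _) _.
  by move=> z hz1 hz2; rewrite mul0r add0r; exact: osc.
have -> : 2 * (x + w * s n - x + (y + h * s n - y)) * (C * rho) =
  (w + h) * C * (2 * (s n * rho)) by ring.
rewrite /S AO -[leRHS]addrA; apply: ler_wpDl.
  by rewrite mulr_ge0 ?(ltW e0)// mulr_ge0//; lra.
(* The product of side and oscillation splits into s^2, paid by the area of the rectangle inside
   [O], and rho^2, paid by the area of its image. *)
have := @amgm (s n) rho t t0 => hst.
apply: (@le_trans _ _ ((w + h) * C * (s n ^+ 2 / t + t * rho ^+ 2))); first by rewrite ler_pM2l.
rewrite mulrDr; apply: lerD.
  have -> : C1 / t * (w * h * s n ^+ 2) = (w + h) * C * (s n ^+ 2 / t) * (1 + w * h).
    by rewrite /C1; field; rewrite !gt_eqF.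
  have : 0 <= (w + h) * C * (s n ^+ 2 / t) * (w * h).
    by rewrite mulr_ge0 ?(ltW wh0)// mulr_ge0 ?(ltW wC)// divr_ge0 ?sqr_ge0// ltW.
  by lra.
apply: (@le_trans _ _ (C1 * t * rho ^+ 2)).
  rewrite mulrA ler_wpM2r ?sqr_ge0// ler_wpM2r ?(ltW t0)// /C1 ler_peMr ?(ltW wC)//.
  by lra.
by rewrite ler_pM2l// mulr_gt0.
Qed.

Lemma rect_int_zero :
  (forall e, 0 < e -> exists O : set plane, [/\ open (O : set (R * R)),
     (area O <= e%:E)%E & forall z, (exists l, cderiv F z l) \/ O (Re z, Im z)]) ->
  forall x0 x1 y0 y1, rect_int F x0 x1 y0 y1 = 0.
Proof.
move=> cov.
have pos (x y w h : R) : 0 < w -> 0 < h -> rect_int F x (x + w) y (y + h) = 0.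
  move=> w0 h0; have [C C0 hC] := rect_int_estimate w0 h0.
  have wh0 : 0 < w * h by rewrite mulr_gt0.
  apply/eqP; rewrite -nrm_eq0 eq_le nrm_ge0 andbT; apply/ler_addgt0Pr => e e0; rewrite add0r.
  set V := fine (area (image_set F (box x (x + w) y (y + h)) : set plane)) in hC.
  have V0 : 0 <= V by rewrite fine_ge0// area_ge0.
  (* First [t] makes the image term at most e/3, then the cover is taken of area [e2], which depends
     on [t]. The 1 added to [V] avoids a division by zero. *)
  pose t := e / (3 * (C * (V + 1))).
  have V1 : 0 < V + 1 by clear -V0; lra.
  have t0 : 0 < t by rewrite divr_gt0// mulr_gt0// mulr_gt0.
  pose e1 := e / (3 * (w * h)); have e10 : 0 < e1 by rewrite divr_gt0// mulr_gt0.
  pose e2 := e * t / (3 * C); have e20 : 0 < e2 by apply: divr_gt0; exact: mulr_gt0.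
  have [U [oU aU covU]] := cov e2 e20; have := hC U e1 t x y oU e10 t0 covU.
  rewrite -/V; set A := fine _ => hJ.
  have hA : A <= e2.
    have mU : measurable U by exact: open_measurable_plane.
    have mI : measurable (U `&` image_set id (box x (x + w) y (y + h))).
      by apply: measurableI => //; exact: box_measurable.
    have le2 : (area (U `&` image_set id (box x (x + w) y (y + h))) <= e2%:E)%E.
      by apply: le_trans aU; apply: area_le => //; exact: subIsetl.
    rewrite -lee_fin fineK// ge0_fin_numE ?area_ge0//.
    by apply: le_lt_trans le2 _; rewrite ltry.
  have i1 : e1 * (w * h) = e / 3 by rewrite /e1; field; rewrite !gt_eqF.
  have i2 : C / t * A <= e / 3.
    have -> : e / 3 = C / t * e2 by rewrite /e2; field; rewrite !gt_eqF.
    by rewrite ler_pM2l// divr_gt0.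
  have i3 : C * t * V <= e / 3.
    have -> : e / 3 = C * t * (V + 1).
      rewrite /t; field; rewrite !gt_eqF//; lra.
    by rewrite ler_pM2l ?lerDl//; exact: mulr_gt0.
  by lra.
have pos' x0 x1 y0 y1 : x0 < x1 -> y0 < y1 -> rect_int F x0 x1 y0 y1 = 0.
  move=> hx hy; have := @pos x0 y0 (x1 - x0) (y1 - y0); rewrite !subr_gt0 !subrKC => h.
  exact: h.
move=> x0 x1 y0 y1.
have [hx|hx|->] := ltrgtP x0 x1; last by rewrite /rect_int /cint; ring.
- have [hy|hy|->] := ltrgtP y0 y1; last by rewrite /rect_int /cint; ring.
    exact: pos'.
  by rewrite rect_int_swapy pos'// oppr0.
- rewrite rect_int_swapx; have [hy|hy|->] := ltrgtP y0 y1;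
    last by rewrite /rect_int /cint; ring.
    by rewrite pos'// oppr0.
  by rewrite rect_int_swapy pos'// !oppr0.
Qed.

End Rectangle.
End Goursat.

(** * Primitives and Liouville's theorem *)

Section Primitive.
Variable R : realType.
Implicit Types (z w v l c : R[i]) (a b d e s t M : R) (F P Q q : R[i] -> R[i])
  (f g phi psi : R -> R[i]).

Local Notation cpx x := (x%:C)%C.

Lemma rcontinuous_cst c : rcontinuous (fun _ : R => c).
Proof. by move=> t e e0; exists 1 => // s _; rewrite subrr nrm0. Qed.

Lemma rderiv_rcontinuous f f' : (forall t, rderiv f t (f' t)) -> rcontinuous f.
Proof. by move=> df t e e0; exact: rderiv_cont (df t) e e0. Qed.

Lemma rcontinuousD f g : rcontinuous f -> rcontinuous g ->
  rcontinuous (fun t => f t + g t).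
Proof.
move=> cf cg t e e0; have e2 : 0 < e / 2 by rewrite divr_gt0.
have [d d0 hd] := cf t _ e2; have [d' d'0 hd'] := cg t _ e2.
exists (Num.min d d'); first by rewrite lt_min d0.
move=> s; rewrite lt_min => /andP[/hd h1 /hd' h2].
have -> : f s + g s - (f t + g t) = (f s - f t) + (g s - g t) by ring.
by apply: le_lt_trans (nrmD _ _) _; lra.
Qed.

Lemma rcontinuousJ f : rcontinuous f -> rcontinuous (fun t => (f t)^*).
Proof.
move=> cf t e e0; have [d d0 hd] := cf t e e0; exists d => // s /hd.
by rewrite -nrmJ rmorphB.
Qed.

Lemma rcontinuousM f g : rcontinuous f -> rcontinuous g ->
  rcontinuous (fun t => f t * g t).
Proof.
move=> cf cg t e e0; have cgJ := rcontinuousJ cg.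
have [d d0 hd] := mulJ_approx (f t) (g t)^* e0.
have [d1 d10 h1] := cf t d d0; have [d2 d20 h2] := cgJ t d d0.
exists (Num.min d1 d2); first by rewrite lt_min d10.
move=> s; rewrite lt_min => /andP[/h1 fs /h2 gs].
by have := hd _ _ fs gs; rewrite !conjcK.
Qed.

Lemma rcontinuous_comp F f : ccontinuous F -> rcontinuous f ->
  rcontinuous (fun t => F (f t)).
Proof.
move=> cF cf t e e0; have [d d0 hd] := cF (f t) e e0.
by have [d' d'0 hd'] := cf t d d0; exists d' => // s /hd' /hd.
Qed.

Lemma cderiv_ccontinuous F F' : (forall z, cderiv F z (F' z)) -> ccontinuous F.
Proof.
move=> dF z e e0; have [d d0 hd] := dF z 1 ltr01.
have n1 : 0 < nrm (F' z) + 2 by have := nrm_ge0 (F' z); lra.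
exists (Num.min d (e / (nrm (F' z) + 2))); first by rewrite lt_min d0 divr_gt0.
move=> w; rewrite lt_min ltr_pdivlMr// => /andP[wd we].
have := nrmD (F w - F z - F' z * (w - z)) (F' z * (w - z)).
rewrite subrK nrmM => h; apply: le_lt_trans h _; apply: le_lt_trans we.
have := hd w wd; have := nrm_ge0 (w - z); nra.
Qed.

Lemma cint_bound_abs phi a b M : rcontinuous phi ->
  (forall t, `|t - a| <= `|b - a| -> nrm (phi t) <= M) ->
  nrm (cint phi a b) <= M * `|b - a|.
Proof.
move=> cp h; case: (lerP a b) => ab.
  rewrite ger0_norm ?subr_ge0// in h *.
  apply: cint_bound => // t /andP[t1 t2]; apply: h; rewrite ger0_norm; lra.
have -> : cint phi a b = - cint phi b a by rewrite /cint opprB.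
rewrite nrmN ltr0_norm ?subr_lt0// opprB in h *.
apply: cint_bound => //; first exact: ltW.
by move=> t /andP[t1 t2]; apply: h; rewrite ler0_norm; lra.
Qed.

Lemma cint_subc phi c a b : rcontinuous phi ->
  cint (fun t => phi t - c) a b = cint phi a b - c * cpx (b - a).
Proof.
move=> cp.
have -> : (fun t => phi t - c) = (fun t => phi t + - c * 1).
  by apply/funext => t; rewrite mulr1.
rewrite cint_linear//; last exact: rcontinuous_cst.
by rewrite (cint_primitive a b (@rderiv_id R)) rmorphB mulNr.
Qed.

(** The primitive integrates along the real axis and then vertically. A vanishing rectangle integral
    turns its increment into integrals along the path from [z] to [w] with its corner at (Re w, Im
    z). Rectangles with sides in reverse order are included in the hypothesis, so no case
    distinction arises. *)
Lemma ex_cprimitive F : ccontinuous F ->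
  (forall x0 x1 y0 y1, rect_int F x0 x1 y0 y1 = 0) ->
  exists P, forall z, cderiv P z (F z).
Proof.
move=> cF F0; pose I : R[i] := Complex 0 1.
exists (fun z => cint (fun t => F (Complex t 0)) 0 (Re z) +
  I * cint (fun t => F (Complex (Re z) t)) 0 (Im z)) => z e e0.
have e2 : 0 < e / 2 by rewrite divr_gt0.
have [d d0 hd] := cF z _ e2; exists (d / 2); first by rewrite divr_gt0.
move=> w hw; have hre := Re_le_nrm (w - z); have him := Im_le_nrm (w - z).
rewrite Re_add Re_opp in hre; rewrite Im_add Im_opp in him.
have i1 : nrm I = 1 by rewrite /= expr0n expr1n add0r sqrtr1.
have hF (u : R[i]) : nrm (u - z) <= 2 * nrm (w - z) -> nrm (F u - F z) <= e / 2.
  by move=> hu; apply/ltW/hd; lra.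
have b1 : nrm (cint (fun t => F (Complex t (Im z)) - F z) (Re z) (Re w)) <= e / 2 * nrm (w - z).
  apply: le_trans (_ : _ <= e / 2 * `|Re w - Re z|) _; last by rewrite ler_pM2l.
  apply: cint_bound_abs => [|t ht].
    by apply: rcontinuousD; [exact: ccontinuous_horizontal|exact: rcontinuous_cst].
  apply: hF; apply: le_trans (nrm_le_Re_Im _) _.
  rewrite Re_add Re_opp Im_add Im_opp/= subrr normr0 addr0.
  by have := nrm_ge0 (w - z); lra.
have b2 : nrm (cint (fun t => F (Complex (Re w) t) - F z) (Im z) (Im w)) <= e / 2 * nrm (w - z).
  apply: le_trans (_ : _ <= e / 2 * `|Im w - Im z|) _; last by rewrite ler_pM2l.
  apply: cint_bound_abs => [|t ht].
    by apply: rcontinuousD; [exact: ccontinuous_vertical|exact: rcontinuous_cst].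
  apply: hF; apply: le_trans (nrm_le_Re_Im _) _.
  by rewrite Re_add Re_opp Im_add Im_opp/=; lra.
rewrite !cint_subc in b1 b2; [|exact: ccontinuous_vertical|exact: ccontinuous_horizontal].
have := F0 (Re z) (Re w) 0 (Im z); rewrite /rect_int -/I => r0.
set X := (X in nrm X <= _).
have -> : X = (cint (fun t => F (Complex t (Im z))) (Re z) (Re w) - F z * cpx (Re w - Re z)) +
    I * (cint (fun t => F (Complex (Re w) t)) (Im z) (Im w) - F z * cpx (Im w - Im z)).
  have wz : w - z = cpx (Re w - Re z) + I * cpx (Im w - Im z).
    by case: (w) => w1 w2; case: (z) => z1 z2; apply: complex_ext => /=; ring.
  rewrite /X {X} wz; apply/eqP; rewrite -subr_eq0 -[X in _ == X]r0; apply/eqP.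
  by rewrite /cint; ring.
apply: le_trans (nrmD _ _) _; rewrite nrmM i1 mul1r.
have -> : e * nrm (w - z) = e / 2 * nrm (w - z) + e / 2 * nrm (w - z) by field.
exact: lerD.
Qed.

(** Differentiability uniform in both points, from the mean value inequality on the segment between
    them and the continuity of [q]. It is what differentiation under the integral uses. *)
Lemma cderiv_strict Q q : (forall z, cderiv Q z (q z)) -> ccontinuous q ->
  forall p e, 0 < e -> exists2 d, 0 < d & forall z w, nrm (z - p) < d -> nrm (w - p) < d ->
    nrm (Q w - Q z - q z * (w - z)) <= e * nrm (w - z).
Proof.
move=> dQ cq p e e0; have e2 : 0 < e / 2 by rewrite divr_gt0.
have [d d0 hd] := cq p _ e2; exists d => // z w zp wp.
pose g t := z + cpx t * (w - z).
have dg t : rderiv g t (w - z).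
  have := rderivD (rderiv_cst z t) (rderivM (rderiv_id t) (rderiv_cst (w - z) t)).
  by rewrite add0r mul1r mulr0 addr0.
have dG t : rderiv (fun s => Q (g s) - q z * (w - z) * cpx s) t ((q (g t) - q z) * (w - z)).
  have := rderivB (cderiv_comp (dQ (g t)) (dg t)) (rderivZ (q z * (w - z)) (rderiv_id t)).
  by rewrite mulr1 -mulrBl.
have dH t : rderiv (fun s => cpx (e * nrm (w - z)) * cpx s) t (cpx (e * nrm (w - z))).
  by have := rderivZ (cpx (e * nrm (w - z))) (rderiv_id t); rewrite mulr1.
have := rderiv_dominated ler01 (fun t _ => dG t) (fun t _ => dH t).
have g0 : g 0 = z by rewrite /g mul0r addr0.
have g1 : g 1 = w by rewrite /g mul1r addrC subrK.
rewrite g0 g1 rmorph0 rmorph1 !mulr0 !mulr1 !subr0 /=.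
have -> : Q w - q z * (w - z) - Q z = Q w - Q z - q z * (w - z) by ring.
apply=> t /andP[t0 t1]; rewrite nrmM ler_wpM2r ?nrm_ge0//.
have gp : nrm (g t - p) < d.
  have -> : g t - p = cpx (1 - t) * (z - p) + cpx t * (w - p).
    by rewrite /g rmorphB rmorph1; ring.
  apply: le_lt_trans (nrmD _ _) _; rewrite !nrmM !nrm_real !ger0_norm ?subr_ge0//.
  set x := nrm (z - p) in zp *; set y := nrm (w - p) in wp *.
  by have [xy|yx] := leP x y; [apply: le_lt_trans wp|apply: le_lt_trans zp]; nra.
have := hd _ gp; have := hd _ zp; have := nrm_triangle (q (g t)) (q z) (q p).
by rewrite [nrm (q p - _)]nrm_distC; lra.
Qed.

(** Compactness of the segment, obtained by showing that the indicator of [good] does not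
    decrease. *)
Lemma uniform_on_segment (A : R -> R -> Prop) a b : a <= b ->
  (forall t d d', d' <= d -> A t d -> A t d') ->
  (forall t, a <= t <= b -> exists2 d, 0 < d & forall s, `|s - t| < d -> A s d) ->
  exists2 d, 0 < d & forall t, a <= t <= b -> A t d.
Proof.
move=> ab mono loc.
pose good (u : R) := exists2 d : R, 0 < d & forall t, a <= t <= u -> A t d.
pose phi u : R := (`[< good u >])%:R.
have ga : good a.
  have [d d0 hd] := loc a (introT andP (conj (lexx _) ab)).
  by exists d => // t /le_anti <-; apply: hd; rewrite subrr normr0.
have down (u v : R) : u <= v -> good v -> good u.
  by move=> uv [d d0 hd]; exists d => // t /andP[t1 t2]; apply: hd; rewrite t1 (le_trans t2).
have up t d (u v : R) : 0 < d -> (forall s, `|s - t| < d -> A s d) ->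
    `|v - t| < d -> t - d < u -> good u -> good v.
  move=> d0 hd hv ut [d' d'0 hd']; exists (Num.min d d'); first by rewrite lt_min d0.
  move=> x /andP[ax xv]; have [xu|ux] := leP x u.
    by apply: mono (hd' x _); [rewrite ge_min lexx orbT|rewrite ax].
  apply: mono (hd x _); first by rewrite ge_min lexx.
  by move: hv; rewrite !ltr_norml => /andP[? ?]; apply/andP; split; lra.
have : phi a <= phi b.
  apply: locally_nondecreasing => // t tab; have [d d0 hd] := loc t tab.
  exists d => // s sab std; have imp (u v : R) : (good u -> good v) -> phi u <= phi v.
    by move=> uv; rewrite /phi ler_nat; case: asboolP => // /uv gv; rewrite asboolT.
  split=> ts; apply: imp.
    by apply: (up t d) => //; lra.
  apply: (up t d) => //; first by rewrite subrr normr0.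
  by move: std; rewrite ltr_norml => /andP[? ?]; lra.
rewrite /phi asboolT// ; case: asboolP => //= _; lra.
Qed.

(** Differentiation under the integral along a family of curves affine in the parameter; this covers
    circles of varying radius as well as circles of varying centre. *)
Lemma cderiv_cint Q q (c d w : R -> R[i]) a b z : a <= b ->
  (forall z, cderiv Q z (q z)) -> ccontinuous q ->
  rcontinuous c -> rcontinuous d -> rcontinuous w ->
  cderiv (fun z => cint (fun t => Q (c t + z * d t) * w t) a b) z
    (cint (fun t => q (c t + z * d t) * d t * w t) a b).
Proof.
move=> ab dQ cq cc cd cw e e0; have cQ := cderiv_ccontinuous dQ.
have cl v : rcontinuous (fun t => c t + v * d t).
  by apply: rcontinuousD => //; apply: rcontinuousM => //; exact: rcontinuous_cst.
have cQl v : rcontinuous (fun t => Q (c t + v * d t) * w t).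
  by apply: rcontinuousM => //; exact: rcontinuous_comp.
have cql : rcontinuous (fun t => q (c t + z * d t) * d t * w t).
  by apply: rcontinuousM => //; apply: rcontinuousM => //; exact: rcontinuous_comp.
pose e' := e / (b - a + 1).
have e'0 : 0 < e' by rewrite divr_gt0//; lra.
pose A t r := forall v, nrm (v - z) < r ->
  nrm ((Q (c t + v * d t) - Q (c t + z * d t) - q (c t + z * d t) * ((v - z) * d t)) * w t)
    <= e' * nrm (v - z).
have [r r0 hr] : exists2 r, 0 < r & forall t, a <= t <= b -> A t r.
  apply: uniform_on_segment => // [t r r' r'r h v hv|t tab].
    by apply: h; exact: lt_le_trans r'r.
  pose M := (nrm (d t) + 1) * (nrm (w t) + 1).
  have nd := nrm_ge0 (d t); have nw := nrm_ge0 (w t).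
  have M0 : 0 < M by rewrite mulr_gt0//; lra.
  have eM : 0 < e' / M by rewrite divr_gt0.
  have [rho rho0 hrho] := cderiv_strict dQ cq (c t + z * d t) eM.
  have rho2 : 0 < rho / 2 by rewrite divr_gt0.
  have [r1 r10 h1] := cl z t _ rho2.
  have [r2 r20 h2] := cd t 1 ltr01; have [r3 r30 h3] := cw t 1 ltr01.
  pose r4 := rho / 2 / (nrm (d t) + 1).
  have r40 : 0 < r4 by rewrite divr_gt0//; lra.
  exists (Num.min (Num.min r1 r2) (Num.min r3 r4)); first by rewrite !lt_min r10 r20 r30.
  move=> s; rewrite !lt_min => /and3P[/andP[/h1 s1 /h2 s2] /h3 s3 _] v.
  rewrite !lt_min => /and3P[_ _ v4].
  have ds : nrm (d s) <= nrm (d t) + 1.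
    by have := nrmD (d s - d t) (d t); rewrite subrK; lra.
  have ws : nrm (w s) <= nrm (w t) + 1.
    by have := nrmD (w s - w t) (w t); rewrite subrK; lra.
  have vd : nrm ((v - z) * d s) <= rho / 2.
    rewrite nrmM; move: v4; rewrite /r4 ltr_pdivlMr; last lra.
    by have := nrm_ge0 (v - z); have := nrm_ge0 (d s); nra.
  have e1 : (c s + v * d s) - (c s + z * d s) = (v - z) * d s by ring.
  have near : nrm (c s + v * d s - (c t + z * d t)) < rho.
    have := nrm_triangle (c s + v * d s) (c t + z * d t) (c s + z * d s).
    by rewrite e1; lra.
  have := hrho (c s + z * d s) (c s + v * d s) (ltac:(lra)) near; rewrite e1 => hh.
  rewrite nrmM; apply: (@le_trans _ _ (e' / M * nrm ((v - z) * d s) * (nrm (w t) + 1))).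
    by apply: ler_pM => //; exact: nrm_ge0.
  rewrite nrmM; have -> : e' * nrm (v - z) = e' / M * nrm (v - z) * M.
    by field; rewrite gt_eqF.
  have hM : nrm (d s) * (nrm (w t) + 1) <= M by rewrite /M ler_wpM2r//; lra.
  have -> : e' / M * (nrm (v - z) * nrm (d s)) * (nrm (w t) + 1) =
    e' / M * nrm (v - z) * (nrm (d s) * (nrm (w t) + 1)) by ring.
  by apply: ler_wpM2l => //; apply: mulr_ge0; [exact: ltW|exact: nrm_ge0].
exists r => // v hv; set X := (X in nrm X <= _).
have -> : X = cint (fun t => (Q (c t + v * d t) - Q (c t + z * d t) -
     q (c t + z * d t) * ((v - z) * d t)) * w t) a b.
  have -> : (fun t => (Q (c t + v * d t) - Q (c t + z * d t) -
     q (c t + z * d t) * ((v - z) * d t)) * w t) =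
    (fun t => (Q (c t + v * d t) * w t + -1 * (Q (c t + z * d t) * w t)) +
       (- (v - z)) * (q (c t + z * d t) * d t * w t)).
    by apply/funext => t; ring.
  rewrite !cint_linear//; first by rewrite /X; ring.
  apply: rcontinuousD => //; apply: rcontinuousM => //; exact: rcontinuous_cst.
have bnd : nrm (cint (fun t => (Q (c t + v * d t) - Q (c t + z * d t) -
     q (c t + z * d t) * ((v - z) * d t)) * w t) a b) <= e' * nrm (v - z) * (b - a).
  apply: cint_bound => //; last by move=> t tab; exact: hr.
  have cN f : rcontinuous f -> rcontinuous (fun t => - f t).
    move=> cf; have := rcontinuousM (rcontinuous_cst (-1)) cf.
    by under [X in rcontinuous X -> _]eq_fun do rewrite mulN1r.
  apply: rcontinuousM => //; apply: rcontinuousD.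
    by apply: rcontinuousD; [|apply: cN]; exact: rcontinuous_comp.
  apply: cN; apply: rcontinuousM; first exact: rcontinuous_comp.
  by apply: rcontinuousM => //; exact: rcontinuous_cst.
apply: le_trans bnd _; rewrite /e' mulrAC ler_wpM2r ?nrm_ge0//.
by rewrite mulrAC ler_pdivrMr; [rewrite ler_pM2l//; lra|lra].
Qed.

End Primitive.

(** * Liouville's theorem from Fourier coefficients on circles *)

Section Liouville.
Variable R : realType.
Implicit Types (a z v r : R[i]) (d e s t : R) (w f : R -> R[i]).

Local Notation cpx x := (x%:C)%C.
Local Notation I := (Complex (0 : R) 1).
Local Notation T := (2 * pi : R).

Definition expi t : R[i] := Complex (cos t) (sin t).

Lemma rderivJ f t l : rderiv f t l -> rderiv (fun s => (f s)^*) t l^*.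
Proof.
move=> df e e0; have [d d0 hd] := df e e0; exists d => // s /hd.
rewrite -(nrmJ (f s - _ - _)) !rmorphB rmorphM/=; congr (nrm _ <= _).
by congr (_ - _ * _); apply: complex_ext => //=; rewrite subrr oppr0.
Qed.

Lemma rderiv_expi t : rderiv expi t (I * expi t).
Proof.
have := rderivD (rderiv_is_derive (is_derive_cos t))
  (rderivZ I (rderiv_is_derive (is_derive_sin t))).
have -> : (fun s => cpx (cos s) + I * cpx (sin s)) = expi.
  by apply/funext => s; apply: complex_ext => /=; ring.
by congr (rderiv _ _ _); apply: complex_ext => /=; ring.
Qed.

Lemma rderiv_expiJ t : rderiv (fun s => (expi s)^*) t (- I * (expi t)^*).
Proof.
have := rderivJ (rderiv_expi t); rewrite rmorphM/=.
by congr (rderiv _ _ _); apply: complex_ext => /=; ring.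
Qed.

Lemma expi_mulJ t : expi t * (expi t)^* = 1.
Proof. by rewrite mulJ nrm_sqr/= cos2Dsin2. Qed.

Lemma nrm_expi t : nrm (expi t) = 1.
Proof. by rewrite /= cos2Dsin2 sqrtr1. Qed.

Lemma expi_2pi : expi T = expi 0.
Proof.
by rewrite /expi mulr_natl -[_ *+ 2]add0r cosD2pi sinD2pi.
Qed.

Lemma cintJ f (a b : R) : rcontinuous f -> cint (fun t => (f t)^*) a b = (cint f a b)^*.
Proof.
move=> cf; rewrite (cint_primitive a b (fun t => rderivJ (primitiveP cf t))).
by rewrite /cint rmorphB.
Qed.

Lemma rderiv_invX (n : nat) (s : R) : 0 < s ->
  rderiv (fun s => cpx (s^-1) ^+ n) s (- n%:R * cpx (s^-1) ^+ n.+1).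
Proof.
move=> s0; have dinv : rderiv (fun s => cpx (s^-1)) s (- cpx (s^-1) ^+ 2).
  have sn0 : s != 0 by rewrite gt_eqF.
  have := rderiv_is_derive (@is_deriveV R id s 1 1 sn0 (is_derive_id s 1)).
  congr (rderiv _ _ _); have -> : - id s ^- 2 *: (1 : R) = - s^-1 ^+ 2 :> R.
    by rewrite exprVn; exact: mulr1.
  by rewrite rmorphN rmorphXn.
elim: n => [|n IHn]; first by rewrite oppr0 mul0r; exact: rderiv_cst.
have := rderivM dinv IHn.
have -> : (fun s => cpx s^-1 * cpx s^-1 ^+ n) = (fun s : R => cpx s^-1 ^+ n.+1).
  by apply/funext => u; rewrite exprS.
by congr (rderiv _ _ _); rewrite !exprS -natr1; ring.
Qed.

(** Euler's equation s A' = n A says that [A] is homogeneous of degree n: the derivative of A / s^n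
    vanishes. *)
Lemma homogeneous_cst (n : nat) (A A' : R -> R[i]) :
  (forall s, 0 < s -> rderiv A s (A' s)) ->
  (forall s, 0 < s -> cpx s * A' s = n%:R * A s) ->
  forall s t, 0 < s -> 0 < t -> A s * cpx (s^-1) ^+ n = A t * cpx (t^-1) ^+ n.
Proof.
move=> dA hA.
have dB s : 0 < s -> rderiv (fun s => A s * cpx (s^-1) ^+ n) s 0.
  move=> s0; have := rderivM (dA s s0) (rderiv_invX n s0).
  congr (rderiv _ _ _); have ss : cpx s^-1 * cpx s = 1 by rewrite -rmorphM/= mulVf ?gt_eqF.
  have -> : A' s = cpx s^-1 * (n%:R * A s) by rewrite -hA// mulrA ss mul1r.
  by rewrite exprS; ring.
have le s t : 0 < s -> s <= t -> A t * cpx (t^-1) ^+ n = A s * cpx (s^-1) ^+ n.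
  move=> s0 st; apply/eqP; rewrite -subr_eq0 -nrm_eq0 eq_le nrm_ge0 andbT.
  have := @rderiv_dominated R (fun s => A s * cpx (s^-1) ^+ n)
    (fun=> 0) (fun=> 0) (fun=> 0) s t st.
  rewrite subrr; apply => u /andP[su ut]; [|exact: rderiv_cst|by rewrite nrm0].
  exact/dB/(lt_le_trans s0).
by move=> s t s0 t0; case: (leP s t) => st; [rewrite (le s t)|rewrite (le t s)//; exact: ltW].
Qed.

Section Primitive.
Variables Q q : R[i] -> R[i].
Hypotheses (dQ : forall z, cderiv Q z (q z)) (cq : ccontinuous q).

Let T0 : 0 < T. Proof. by rewrite mulr_gt0// pi_gt0. Qed.

Let cexpi : rcontinuous expi. Proof. exact: rderiv_rcontinuous rderiv_expi. Qed.

Let ccircle a r : rcontinuous (fun t => a + r * expi t).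
Proof.
apply: rcontinuousD; first exact: rcontinuous_cst.
by apply: rcontinuousM => //; exact: rcontinuous_cst.
Qed.

Let cQ : ccontinuous Q. Proof. exact: cderiv_ccontinuous dQ. Qed.

(** Integration by parts over a full period, with [w] a multiple of the exponential of -n i t. It
    links Fourier coefficients of [q] and [Q]: the case n = 0 is Cauchy's theorem on the circle, and
    n = 1, 2 give Euler's equations in the radius. *)
Lemma circle_parts a r (n : R[i]) w : (forall t, rderiv w t (- n * I * w t)) -> w T = w 0 ->
  r * cint (fun t => q (a + r * expi t) * expi t * w t) 0 T =
  n * cint (fun t => Q (a + r * expi t) * w t) 0 T.
Proof.
move=> dw wT; have cw := rderiv_rcontinuous dw.
have dg t : rderiv (fun s => a + r * expi s) t (r * (I * expi t)).
  by have := rderivD (rderiv_cst a t) (rderivZ r (rderiv_expi t)); rewrite add0r.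
have dG t := rderivM (cderiv_comp (dQ _) (dg t)) (dw t).
have := cint_primitive 0 T dG; rewrite expi_2pi wT subrr => h0.
have c1 : rcontinuous (fun t => q (a + r * expi t) * expi t * w t).
  apply: rcontinuousM => //; apply: rcontinuousM => //; exact: rcontinuous_comp.
have c2 : rcontinuous (fun t => Q (a + r * expi t) * w t).
  by apply: rcontinuousM => //; exact: rcontinuous_comp.
have c3 := rcontinuousM (rcontinuous_cst (r * I)) c1.
have : cint (fun t => r * I * (q (a + r * expi t) * expi t * w t) +
    - (n * I) * (Q (a + r * expi t) * w t)) 0 T = 0.
  by rewrite -[RHS]h0; congr (cint _ _ _); apply/funext => t; ring.
rewrite cint_linear//.
have -> : (fun t => r * I * (q (a + r * expi t) * expi t * w t)) =
   (fun t => 0 + r * I * (q (a + r * expi t) * expi t * w t)).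
  by apply/funext => t; rewrite add0r.
rewrite cint_linear//; last exact: rcontinuous_cst.
rewrite (cint_primitive 0 T (fun t => rderiv_cst 0 t)) subrr add0r => h.
have I0 : I != 0 by rewrite -nrm_eq0 /= expr0n expr1n add0r sqrtr1 oner_eq0.
apply: (mulfI I0); apply/eqP; rewrite -subr_eq0 -[X in _ == X]h; apply/eqP; ring.
Qed.

Let parts0 a r : r * cint (fun t => q (a + r * expi t) * expi t) 0 T = 0.
Proof.
have := @circle_parts a r 0 (fun=> 1) _ erefl; rewrite mul0r => h.
rewrite -[RHS]h; first by congr (_ * cint _ _ _); apply/funext => t; rewrite mulr1.
by move=> t; rewrite oppr0 !mul0r; exact: rderiv_cst.
Qed.

Let parts1 a r : r * cint (fun t => q (a + r * expi t)) 0 T =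
  cint (fun t => Q (a + r * expi t) * (expi t)^*) 0 T.
Proof.
have := @circle_parts a r 1 (fun t => (expi t)^*) _ (congr1 conjc expi_2pi).
rewrite mul1r => <-; last by move=> t; rewrite mulN1r; exact: rderiv_expiJ.
by congr (_ * cint _ _ _); apply/funext => t; rewrite -mulrA expi_mulJ mulr1.
Qed.

Let parts2 a r : r * cint (fun t => q (a + r * expi t) * (expi t)^*) 0 T =
  2%:R * cint (fun t => Q (a + r * expi t) * ((expi t)^* * (expi t)^*)) 0 T.
Proof.
have := @circle_parts a r 2%:R (fun t => (expi t)^* * (expi t)^*) _
  (congr1 (fun z => z^* * z^*) expi_2pi).
move=> <-; last first.
  move=> t; have := rderivM (rderiv_expiJ t) (rderiv_expiJ t).
  by congr (rderiv _ _ _); ring.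
congr (_ * cint _ _ _); apply/funext => t.
by rewrite -mulrA [expi t * _]mulrA expi_mulJ mul1r.
Qed.

Let cexpiJ : rcontinuous (fun t => (expi t)^*). Proof. exact: rcontinuousJ. Qed.

Let dcircle a w r : rcontinuous w ->
  cderiv (fun r => cint (fun t => Q (a + r * expi t) * w t) 0 T) r
    (cint (fun t => q (a + r * expi t) * expi t * w t) 0 T).
Proof.
move=> cw; apply: (@cderiv_cint R Q q (fun=> a) expi w 0 T r) => //; first exact: ltW.
exact: rcontinuous_cst.
Qed.

(** The first coefficient A(s) of [Q] has derivative A'(s), the integral of [q], and s A' = A. So A'
    = A / s does not depend on s, and its limit at 0 is 2 pi q(a). *)
Lemma mean_value a (s : R) : 0 < s -> cint (fun t => q (a + cpx s * expi t)) 0 T = cpx T * q a.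
Proof.
pose A s := cint (fun t => Q (a + cpx s * expi t) * (expi t)^*) 0 T.
pose A' s := cint (fun t => q (a + cpx s * expi t)) 0 T.
have dA u : 0 < u -> rderiv A u (A' u).
  move=> _; have := cderiv_comp (dcircle a (cpx u) cexpiJ) (rderiv_id u); rewrite mulr1.
  congr (rderiv _ _ _); congr (cint _ _ _); apply/funext => t.
  by rewrite -mulrA expi_mulJ mulr1.
have hA u : 0 < u -> cpx u * A' u = 1%:R * A u by move=> _; rewrite mul1r; exact: parts1.
have AE u : 0 < u -> A u * cpx (u^-1) ^+ 1 = A' u.
  move=> u0; rewrite expr1 -[A u]mul1r -hA// mulrAC -rmorphM/= divff ?gt_eqF//.
  by rewrite mul1r.
move=> s0; rewrite -/(A' s); apply/eqP; rewrite -subr_eq0 -nrm_eq0 eq_le nrm_ge0 andbT.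
apply/ler_addgt0Pr => e e0; rewrite add0r.
have eT : 0 < e / T by rewrite divr_gt0.
have [d d0 hd] := cq a eT; have d2 : 0 < d / 2 by rewrite divr_gt0.
have -> : A' s = A' (d / 2) by rewrite -AE// -(AE (d / 2))//; exact: (homogeneous_cst dA hA).
have -> : A' (d / 2) - cpx T * q a = cint (fun t => q (a + cpx (d / 2) * expi t) - q a) 0 T.
  by rewrite cint_subc; [rewrite subr0 [cpx T * _]mulrC|exact: rcontinuous_comp].
have -> : e = e / T * (T - 0) by rewrite subr0 divfK// gt_eqF.
apply: cint_bound; [|exact: ltW|].
  by apply: rcontinuousD; [exact: rcontinuous_comp|exact: rcontinuous_cst].
move=> t _; apply/ltW/hd; rewrite [a + _]addrC addrK nrmM nrm_expi mulr1 nrm_real gtr0_norm//.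
by lra.
Qed.

(* The first Fourier coefficient of [q] on the circle of radius [s] is
   proportional to [s] and bounded by twice the mean of [Re q]. *)
Lemma first_coefficient_eq0 a : (forall z, 0 <= Re (q z)) ->
  cint (fun t => q (a + 1 * expi t) * (expi t)^*) 0 T = 0.
Proof.
move=> q0; pose A s := cint (fun t => Q (a + cpx s * expi t) * ((expi t)^* * (expi t)^*)) 0 T.
pose A' s := cint (fun t => q (a + cpx s * expi t) * (expi t)^*) 0 T.
have c2 : rcontinuous (fun t => (expi t)^* * (expi t)^*) by exact: rcontinuousM.
have dA u : 0 < u -> rderiv A u (A' u).
  move=> _; have := cderiv_comp (dcircle a (cpx u) c2) (rderiv_id u); rewrite mulr1.
  congr (rderiv _ _ _); congr (cint _ _ _); apply/funext => t.
  by rewrite -mulrA [expi t * _]mulrA expi_mulJ mul1r.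
have hA u : 0 < u -> cpx u * A' u = 2%:R * A u by move=> _; exact: parts2.
(* [A] is homogeneous of degree 2, so its derivative is of degree 1. *)
have A'E u : 0 < u -> A' u = cpx u * A' 1.
  move=> u0; have uu : cpx u * cpx u^-1 = 1 by rewrite -rmorphM/= divff ?gt_eqF.
  have := homogeneous_cst dA hA u0 ltr01; rewrite invr1 expr1n mulr1 => h.
  have := hA 1 ltr01; rewrite mul1r -h => ->.
  transitivity ((cpx u * cpx u^-1) ^+ 2 * A' u); first by rewrite uu expr1n mul1r.
  transitivity (cpx u * cpx u^-1 ^+ 2 * (cpx u * A' u)); first by ring.
  by rewrite hA//; ring.
have bound u : 0 < u -> nrm (A' u) <= 2 * T * Re (q a).
  move=> u0; pose f t := q (a + cpx u * expi t).
  have cf : rcontinuous f by exact: rcontinuous_comp.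
  have cfe : rcontinuous (fun t => f t * expi t) by exact: rcontinuousM.
  have z0 : cint (fun t => (f t * expi t)^*) 0 T = 0.
    rewrite cintJ//; have := parts0 a (cpx u); rewrite -/f => /eqP.
    by rewrite mulf_eq0 -nrm_eq0 nrm_real normr_eq0 gt_eqF//= => /eqP ->; rewrite rmorph0.
  have cfJ : rcontinuous (fun t => (f t * expi t)^*) by exact: rcontinuousJ.
  have cfE : rcontinuous (fun t => f t * (expi t)^*) by exact: rcontinuousM.
  (* The opposite coefficient vanishes, so its conjugate may be added. This replaces [f] by twice
     its real part, whose absolute value integrates to the mean value since it is nonnegative. *)
  have -> : A' u = cint (fun t => f t * (expi t)^* + 1 * (f t * expi t)^*) 0 T.
    by rewrite cint_linear// z0 mulr0 addr0.
  have -> : 2 * T * Re (q a) = Re (cint (fun t => f t + 1 * f t) 0 T).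
    by rewrite cint_linear// mean_value// mul1r Re_add Re_mul/= mul0r subr0; ring.
  apply: cint_dominated; [| |exact: ltW|].
  - apply: rcontinuousD => //; apply: rcontinuousM => //; exact: rcontinuous_cst.
  - apply: rcontinuousD => //; apply: rcontinuousM => //; exact: rcontinuous_cst.
  move=> t _; have -> : f t * (expi t)^* + 1 * (f t * expi t)^* = (f t + (f t)^*) * (expi t)^*.
    by rewrite rmorphM/=; ring.
  rewrite nrmM nrmJ nrm_expi mulr1 mul1r.
  have -> : f t + (f t)^* = cpx (Re (f t) + Re (f t)).
    by case: (f t) => x y; apply: complex_ext => /=; ring.
  by rewrite nrm_real Re_add ger0_norm// addr_ge0// q0.
have -> : cint (fun t => q (a + 1 * expi t) * (expi t)^*) 0 T = A' 1 by rewrite /A' rmorph1.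
apply/eqP; rewrite -nrm_eq0 eq_le nrm_ge0 andbT leNgt; apply/negP => A0.
(* A radius at which linear growth exceeds the bound. *)
pose u := (2 * T * Re (q a) + 1) / nrm (A' 1).
have M0 : 0 <= 2 * T * Re (q a) by rewrite !mulr_ge0// ltW// pi_gt0.
have u0 : 0 < u by rewrite divr_gt0// ltr_wpDl.
have := bound u u0; rewrite A'E// nrmM nrm_real gtr0_norm// /u divfK ?gt_eqF//.
by lra.
Qed.

(* The primitive [Q] stands in for the regularity of [q]: that [q] itself is
   differentiable is only obtained in the proof, from its mean value property. *)
Lemma liouville : (forall z, 0 <= Re (q z)) -> forall z, q z = q 0.
Proof.
(* By the mean value property [Y] is 2 pi times [q], but its integrand involves [Q], so it can be
   differentiated in the centre; the derivative is the first coefficient of [q] on the unit circle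
   about [z], which is zero. *)
move=> q0; pose Y z := cint (fun t => Q (expi t + z * 1) * (expi t)^*) 0 T.
have YE z : Y z = cpx T * q z.
  rewrite -(mean_value z ltr01); have := parts1 z 1; rewrite mul1r rmorph1 => ->.
  by congr (cint _ _ _); apply/funext => t; rewrite mulr1 mul1r addrC.
have dY z : cderiv Y z 0.
  have := @cderiv_cint R Q q expi (fun=> 1) (fun t => (expi t)^*) 0 T z (ltW T0) dQ cq cexpi
    (rcontinuous_cst 1) cexpiJ.
  congr (cderiv _ _ _); rewrite -(first_coefficient_eq0 z q0).
  by congr (cint _ _ _); apply/funext => t; rewrite !mulr1 mul1r addrC.
move=> z; have dg t : rderiv (fun s => Y (z * cpx s)) t 0.
  have := cderiv_comp (dY (z * cpx t)) (rderivZ z (rderiv_id t)).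
  by rewrite mul0r.
have := @rderiv_dominated R (fun s => Y (z * cpx s)) (fun=> 0) (fun=> 0) (fun=> 0) 0 1 ler01
  (fun t _ => dg t) (fun t _ => rderiv_cst 0 t).
rewrite subrr rmorph0 rmorph1 mulr0 mulr1 => h.
have : Y z - Y 0 = 0.
  by apply/eqP; rewrite -nrm_eq0 eq_le nrm_ge0 andbT; apply: h => t _; rewrite nrm0.
rewrite !YE -mulrBr => /eqP; rewrite mulf_eq0 -nrm_eq0 nrm_real gt_eqF/=; last first.
  by rewrite gtr0_norm.
by rewrite subr_eq0 => /eqP.
Qed.

End Primitive.
End Liouville.

(** * The main theorem *)

Section NullCover.
Variable R : realType.
Implicit Types (K : set R[i]^o).

Local Notation plane := (measurableTypeR R * measurableTypeR R)%type.

Definition square (c : R[i]) (r : R) : set plane :=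
  `]Re c - r, Re c + r[%classic `*` `]Im c - r, Im c + r[%classic.

Lemma square_open c r : open (square c r : set (R * R)).
Proof.
rewrite openE => -[x y] [/=]; rewrite !in_itv/= => /andP[x1 x2] /andP[y1 y2].
pose d := Num.min (Num.min (x - (Re c - r)) (Re c + r - x))
  (Num.min (y - (Im c - r)) (Im c + r - y)).
have d0 : 0 < d by rewrite !lt_min !subr_gt0 x1 x2 y1.
have : d <= d by []; rewrite {2}/d !le_min => /andP[/andP[d1 d2] /andP[d3 d4]].
apply/nbhs_ballP; exists d => // -[x' y'] [/=]; rewrite -!ball_normE /= !ltr_norml.
by move=> /andP[? ?] /andP[? ?]; split; rewrite /= in_itv/=; apply/andP; split; lra.
Qed.

Lemma square_measurable c r : measurable (square c r).
Proof. by apply: measurableX; exact: measurable_itv. Qed.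

Lemma mem_square c r (z : R[i]) : nrm (z - c) < r -> square c r (Re z, Im z).
Proof.
move=> h; have := le_lt_trans (Re_le_nrm _) h; have := le_lt_trans (Im_le_nrm _) h.
rewrite Re_add Re_opp Im_add Im_opp !ltr_norml => /andP[? ?] /andP[? ?].
by split; rewrite /= in_itv/=; apply/andP; split; lra.
Qed.

Lemma area_square c r : 0 <= r -> area (square c r) = (4 * r ^+ 2)%:E.
Proof.
move=> r0; rewrite area_box; [|lra|lra].
by congr EFin; ring.
Qed.

Lemma normv_le_diam n (U : set 'rV[R]_n) u v : U u -> U v ->
  ((normv (u - v))%:E <= diam U)%E.
Proof. by move=> Uu Uv; apply: ereal_sup_ubound; exists (u, v). Qed.

(* The error term takes care of the sets of diameter zero. *)
Lemma diam_square (U : set 'rV[R]_2) (e : R) : 0 < e -> (diam U <= 1%:E)%E ->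
  exists c r, [/\ 0 <= r,
    forall z : R[i], U (plane_of_complex z) -> nrm (z - c) < r &
    ((4 * r ^+ 2)%:E <=
      8%:E * (if U != set0 then poweR (diam U) 2 else 0) + (8 * e ^+ 2)%:E)%E].
Proof.
move=> e0 dU; have [->|Un0] := eqVneq U set0.
  exists 0, e; split=> //; first exact: ltW.
  by rewrite mule0 add0e lee_fin; have := sqr_ge0 e; lra.
have /set0P[p Up] := Un0.
have d0 : (0 <= diam U)%E.
  by apply: le_trans (normv_le_diam Up Up); rewrite lee_fin sqrtr_ge0.
have dfin : diam U \is a fin_num.
  by rewrite ge0_fin_numE//; apply: le_lt_trans dU _; rewrite ltry.
pose d := fine (diam U); have dE : diam U = d%:E by rewrite fineK.
have dge0 : 0 <= d by rewrite fine_ge0.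
(* Any point of [U] serves as centre; the area bound is 4 (d + e)^2 <= 8 d^2 + 8 e^2. *)
exists (complex_of_plane p), (d + e); split.
- by rewrite addr_ge0// ltW.
- move=> z Uz; have := normv_le_diam Uz Up; rewrite dE lee_fin.
  rewrite -(complex_of_planeK p) -plane_of_complexB normv_plane complex_of_planeK.
  by move=> h; apply: le_lt_trans h _; rewrite ltrDl.
rewrite dE poweR_EFin powR_mulrn// -EFinM -EFinD lee_fin.
by have := sqr_ge0 (d - e); rewrite sqrrB sqrrD; lra.
Qed.

Lemma null_cover K (e : R) : 0 < e ->
  Hausdorff_measure 2 (@plane_of_complex R @` K) = 0%E ->
  exists U : set plane, [/\ open (U : set (R * R)), (area U <= e%:E)%E &
    forall z, K z -> U (Re z, Im z)].
Proof.
(* The diameters cost 8h and the error terms another 8h. Only the content at scale 1 is used, as it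
   is below the measure. *)
move=> e0 H0; pose h := e / 16; have h0 : 0 < h by rewrite divr_gt0.
have : (Hausdorff_content 2 1 (@plane_of_complex R @` K) < h%:E)%E.
  apply: (@le_lt_trans _ _ 0%E); last by rewrite lte_fin.
  by rewrite -H0; apply: ereal_sup_ubound; exists 1 => //=.
move=> /ereal_inf_lt[_ [V [KV dV] <-] sV].
(* The squares of these radii sum to [h]. *)
pose eps k := Num.sqrt (h / (2 ^ k.+1)%:R).
have p2 k : 0 < ((2 ^ k.+1)%:R : R) by rewrite ltr0n expn_gt0.
have eps0 k : 0 < eps k by rewrite sqrtr_gt0 divr_gt0.
have [c hc] := choice (fun k => diam_square (eps0 k) (dV k)).
have [r hr] := choice hc.
exists (\bigcup_k square (c k) (r k)); split.
- by apply: bigcup_open => k _; exact: square_open.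
- apply: (@le_trans _ _ (\sum_(0 <= k <oo) area (square (c k) (r k)))%E).
    by apply: area_bigcup_le => k; exact: square_measurable.
  pose D k := (if V k != set0 then poweR (diam (V k)) 2 else 0%E).
  have D0 k : (0 <= D k)%E by rewrite /D; case: ifP => // _; exact: poweR_ge0.
  apply: (@le_trans _ _ (\sum_(0 <= k <oo) (8%:E * D k + ((8 * h) / (2 ^ k.+1)%:R)%:E))%E).
    apply: lee_nneseries => [k _ _|k _]; first exact: area_ge0.
    have [r0 _ hk] := hr k; rewrite area_square//.
    have -> : 8 * h / (2 ^ k.+1)%:R = 8 * eps k ^+ 2.
      by rewrite sqr_sqrtr ?mulrA//; apply: divr_ge0 => //; exact: ltW.
    exact: hk.
  apply: le_trans (epsilon_trick _ _ _) _.
  - by move=> k; apply: mule_ge0.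
  - by rewrite mulr_ge0// ltW.
  rewrite nneseriesZl//.
  have : (\sum_(0 <= k <oo) D k <= h%:E)%E by rewrite /D -eseries_mkcond; exact: ltW.
  move=> hD; apply: (@le_trans _ _ (8%:E * h%:E + (8 * h)%:E)%E).
    by rewrite leeD2r// lee_wpmul2l// lee_fin.
  by rewrite -EFinM -EFinD lee_fin /h; lra.
move=> z Kz; have [k _ Vk] := KV _ (ex_intro2 _ _ z Kz erefl).
by exists k => //; apply: mem_square; have [_ + _] := hr k; exact.
Qed.

End NullCover.

(** * From a primitive of the extension to affinity *)

Section Linear.
Variable R : realType.
Implicit Types (z w p l h : R[i]) (F f : R[i] -> R[i]).

Lemma sectorial_linear (k : R) F p l : 0 < k -> sectorial k setT F -> ccontinuous F ->
  (exists P, forall z, cderiv P z (F z)) -> cderiv F p l ->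
  forall z, F z = F p + l * (z - p).
Proof.
move=> k0 sF cF [P dP] dF.
have incr h z : F (z + h) - F z = F h - F 0.
  have [->|h0] := eqVneq h 0; first by rewrite addr0 !subrr.
  (* A difference of translates of [P] provides the primitive [Q] of [q] that [liouville] works
     with. *)
  pose q z := (F (z + h) - F z) * h^*; pose Q z := (P (z + h) - P z) * h^*.
  have hJ0 : h^* != 0 by rewrite conjc_eq0.
  have dQ u : cderiv Q u (q u).
    move=> e e0; pose e' := e / (2 * nrm h).
    have nh : 0 < nrm h by rewrite nrm_gt0.
    have e'0 : 0 < e' by rewrite divr_gt0// mulr_gt0.
    have [d d0 hd] := dP (u + h) _ e'0; have [d' d'0 hd'] := dP u _ e'0.
    exists (Num.min d d'); first by rewrite lt_min d0.
    move=> w; rewrite lt_min => /andP[w1 w2].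
    have wh : w + h - (u + h) = w - u by ring.
    have := hd (w + h); rewrite wh => /(_ w1) h1; have h2 := hd' w w2.
    have -> : Q w - Q u - q u * (w - u) =
      ((P (w + h) - P (u + h) - F (u + h) * (w - u)) - (P w - P u - F u * (w - u))) * h^*.
      by rewrite /Q /q; ring.
    rewrite nrmM nrmJ; have := nrmD (P (w + h) - P (u + h) - F (u + h) * (w - u))
      (- (P w - P u - F u * (w - u))); rewrite nrmN => h3.
    have -> : e * nrm (w - u) = (e' * nrm (w - u) + e' * nrm (w - u)) * nrm h.
      by rewrite /e'; field; rewrite gt_eqF.
    by rewrite ler_pM2r//; lra.
  have cq : ccontinuous q.
    move=> u e e0; have nh : 0 < nrm h by rewrite nrm_gt0.
    have e2 : 0 < e / (2 * nrm h) by rewrite divr_gt0// mulr_gt0.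
    have [d d0 hd] := cF (u + h) _ e2; have [d' d'0 hd'] := cF u _ e2.
    exists (Num.min d d'); first by rewrite lt_min d0.
    move=> w; rewrite lt_min => /andP[w1 /hd' h2].
    have wh : w + h - (u + h) = w - u by ring.
    have := hd (w + h); rewrite wh => /(_ w1) h1.
    have -> : q w - q u = ((F (w + h) - F (u + h)) - (F w - F u)) * h^* by rewrite /q; ring.
    rewrite nrmM nrmJ; have := nrmD (F (w + h) - F (u + h)) (- (F w - F u)).
    rewrite nrmN -ltr_pdivlMr// => h3; apply: le_lt_trans h3 _.
    have -> : e / nrm h = e / (2 * nrm h) + e / (2 * nrm h).
      by field; rewrite gt_eqF.
    lra.
  have q0 u : 0 <= Re (q u).
    apply: (cone_Re_ge0 k0); have := sF u (u + h) I I.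
    by rewrite [u + h - u]addrAC subrr add0r.
  have := liouville dQ cq q0 z; rewrite /q add0r => /(mulIf hJ0).
  by rewrite -[in RHS](add0r h).
pose A h := F h - F 0.
have AE h : A h = F (p + h) - F p by rewrite incr.
have AD h h' : A (h + h') = A h + A h'.
  by rewrite /A -(incr h' h); ring.
have AN h n : A (n%:R * h) = n%:R * A h.
  elim: n => [|n IHn]; first by rewrite !mul0r /A subrr.
  by rewrite -natr1 !mulrDl !mul1r AD IHn.
(* Additivity gives A h = n A (h / n); for large n the derivative at [p] identifies the right-hand
   side with [l * h], since the error bound scales back to [e]. *)
have Al h : A h = l * h.
  have [->|h0] := eqVneq h 0; first by rewrite mulr0 /A subrr.
  have nh : 0 < nrm h by rewrite nrm_gt0.
  apply/eqP; rewrite -subr_eq0 -nrm_eq0 eq_le nrm_ge0 andbT.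
  apply/ler_addgt0Pr => e e0; rewrite add0r.
  have [d d0 hd] := dF (e / nrm h) (divr_gt0 e0 nh).
  pose n := (Num.bound (nrm h / d)).+1.
  have n0 : (0 : R) < n%:R by rewrite ltr0n.
  have n0C : (n%:R : R[i]) != 0 by rewrite pnatr_eq0.
  have nn (u : R[i]) : nrm (n%:R * u) = n%:R * nrm u.
    by rewrite nrmM -(rmorph_nat (real_complex R)) nrm_real ger0_norm.
  pose x := h / n%:R; have hx : h = n%:R * x by rewrite mulrC divfK.
  have nx : nrm x < d.
    have : nrm h / d < n%:R.
      apply: (@lt_trans _ _ (Num.bound (nrm h / d))%:R); last by rewrite ltr_nat.
      by rewrite archi_boundP// divr_ge0// ltW.
    by rewrite ltr_pdivrMr// hx nn ltr_pM2l.
  have := hd (p + x); rewrite [p + x - p]addrAC subrr add0r => /(_ nx).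
  rewrite -AE => hle; rewrite {1 2}hx AN.
  have -> : n%:R * A x - l * (n%:R * x) = n%:R * (A x - l * x) by ring.
  rewrite nn; apply: (@le_trans _ _ (n%:R * (e / nrm h * nrm x))); first by rewrite ler_pM2l.
  by rewrite mulrCA -nn -hx divfK// gt_eqF.
by move=> z; have := AE (z - p); rewrite subrKC Al => ->; rewrite subrKC.
Qed.

Lemma holomorphic_affine (c d : R[i]^o) : holomorphic_on setT (fun z : R[i]^o => c * z + d).
Proof.
move=> z _; apply: derivableD; last exact: derivable_cst.
by apply: (@derivableZ _ _ _ id c); exact: derivable_id.
Qed.

End Linear.

Unset Implicit Arguments.

Theorem theorem8p1 (R : realType) (K : set R[i]^o) (f : R[i]^o -> R[i]^o) :
  closed K ->
  Lipschitz_thin (@plane_of_complex R @` K) ->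
  Hausdorff_measure 2 (@plane_of_complex R @` K) = 0%E ->
  holomorphic_on (~` K) f ->
  (exists alpha : R, alpha < pi / 2 /\
     forall z, ~ K z -> derive1 f z != 0 /\ `|Arg (derive1 f z)| <= alpha) ->
  exists g : R[i]^o -> R[i]^o,
    [/\ holomorphic_on setT g,
        (forall z, ~ K z -> g z = f z)
      & exists c d : R[i]^o, forall z, g z = c * z + d].
Proof.
move=> clK thin null hol [alpha [halpha hArg]].
have [k0 k00 hk0] := Arg_cone halpha; pose k := 2 * k0 + 3.
have k_gt0 : 0 < k by rewrite /k; lra.
have df z : ~ K z -> cderiv f z (derive1 f z) by move=> Kz; apply/derivable_cderiv/hol.
have cf z : ~ K z -> derive1 f z != 0 /\ cone k0 (derive1 f z).
  by move=> Kz; have [f0 fa] := hArg z Kz; split=> //; exact: hk0.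
have sf : sectorial k (~` K) f by exact: (thin_sectorial k00 thin df cf).
have dense := thin_compl_dense thin.
have [F Ff sF] := sectorial_extension k_gt0 sf dense.
(* [K] is closed, so [F] agrees with [f] on a whole disc about [z]. *)
have dF z : ~ K z -> cderiv F z (derive1 f z).
  move=> Kz e e0; have [d d0 hd] := df z Kz e e0.
  have [r r0 hr] := closed_compl_ball clK Kz.
  exists (Num.min d r); first by rewrite lt_min d0.
  by move=> w; rewrite lt_min => /andP[wd /hr Kw]; rewrite !Ff//; exact: hd.
have [p Kp _] := dense 0 1 ltr01; have [lp _] := cf p Kp.
have iF := sectorial_injective k_gt0 sF lp (dF p Kp).
have cF := sectorial_continuous k_gt0 sF.
have rect0 : forall x0 x1 y0 y1, rect_int F x0 x1 y0 y1 = 0.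
  apply: (rect_int_zero k_gt0 sF iF) => e e0.
  have [U [oU aU KU]] := null_cover e0 null; exists U; split=> // z.
  have [Kz|nKz] := pselect (K z); first by right; exact: KU.
  by left; exists (derive1 f z); exact: dF.
have FE := sectorial_linear k_gt0 sF cF (ex_cprimitive cF rect0) (dF p Kp).
set c := derive1 f p in FE; pose d := F p - c * p.
have gE z : c * z + d = F z by rewrite FE /d; ring.
exists (fun z => c * z + d); split; first exact: holomorphic_affine.
  by move=> z Kz; rewrite gE Ff.
by exists c, d.
Qed.
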